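(* Let $m\ge1$ and $0<h<2$. Then $$\delta_m(h)=4\arccos\left(\frac h2\right)^{1/m}.$$ Moreover, let $\alpha\in(0,\pi)$ be defined by $h=2\sin^m\frac\alpha2$, and write $m=2n$ or $m=2n+1$. Set $x_{km}=\cos\frac{\pi(2k-1)}{2m}$, $a_{km}(\alpha)=1-2x_{km}^2\sin^2\frac\alpha2$ ($k=1,\dots,n$), $S_n(z)=\prod_{k=1}^n(z^2-2a_{km}(\alpha)z+1)$ (with $S_0\equiv1$), and $P^*_m=S_n$ if $m=2n$, $P^*_m(z)=(z-1)S_n(z)$ if $m=2n+1$. Then $P\in\mathfrak{P}_m(\Gamma)$ satisfies $\mathrm{mes}\{t\in\mathbb{T}:|P(e^{it})|\ge h\}=\delta_m(h)$ if and only if $P(z)=e^{im\theta}P^*_m(ze^{-i\theta})$ for some $\theta\in\mathbb{R}$.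
   Context: $\Gamma$ is the unit circle of $\mathbb{C}$; $\mathfrak{P}_m(\Gamma)$ is the set of polynomials $\prod_{j=1}^m(z-e^{i\phi_j})$, $\phi_j\in\mathbb{R}$. $\mathbb{T}=[0,2\pi)$ with endpoints identified, with Lebesgue measure $\mathrm{mes}$. For $0\le h\le2$, $\delta_m(h)=\inf\{\mathrm{mes}\{t\in\mathbb{T}:|P(e^{it})|\ge h\}:P\in\mathfrak{P}_m(\Gamma)\}$. The polynomial $e^{im\theta}P(ze^{-i\theta})$ is the rotation of $P$ by angle $\theta$ (its zeros are those of $P$ multiplied by $e^{i\theta}$). *)

(* Defs.v *)
From Stdlib Require Import Reals List.
Open Scope R_scope.

Definition Cx : Type := (R * R)%type.
Definition Cre (z : Cx) : R := fst z.
Definition Cim (z : Cx) : R := snd z.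
Definition RtoC (x : R) : Cx := (x, 0).
Definition Cadd (z w : Cx) : Cx := (Cre z + Cre w, Cim z + Cim w).
Definition Csub (z w : Cx) : Cx := (Cre z - Cre w, Cim z - Cim w).
Definition Cmul (z w : Cx) : Cx :=
  (Cre z * Cre w - Cim z * Cim w, Cre z * Cim w + Cim z * Cre w).
Definition Cmod (z : Cx) : R := sqrt (Cre z ^ 2 + Cim z ^ 2).
Definition cexp_i (t : R) : Cx := (cos t, sin t).

(* The polynomial prod_j (z - e^{i phi_j}), as a function on C; it is an
   element of P_m(Gamma) when length phis = m. *)
Definition Ppoly (phis : list R) (z : Cx) : Cx :=
  fold_right (fun phi acc => Cmul (Csub z (cexp_i phi)) acc) (RtoC 1) phis.

Definition level_ind (phis : list R) (h : R) (t : R) : R :=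
  if Rle_dec h (Cmod (Ppoly phis (cexp_i t))) then 1 else 0.

Definition level_mes (phis : list R) (h L : R) : Prop :=
  exists pr : Riemann_integrable (level_ind phis h) 0 (2 * PI),
    RiemannInt pr = L.

Definition is_glb (E : R -> Prop) (l : R) : Prop :=
  (forall x, E x -> l <= x) /\ (forall b, (forall x, E x -> b <= x) -> b <= l).

Definition delta_is (m : nat) (h l : R) : Prop :=
  is_glb (fun x => exists phis : list R, length phis = m /\ level_mes phis h x) l.

Definition x_km (k m : nat) : R := cos (PI * (2 * INR k - 1) / (2 * INR m)).
Definition a_km (k m : nat) (alpha : R) : R :=
  1 - 2 * (x_km k m) ^ 2 * (sin (alpha / 2)) ^ 2.

Fixpoint S_poly (n m : nat) (alpha : R) (z : Cx) : Cx :=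
  match n with
  | O => RtoC 1
  | S n' => Cmul (S_poly n' m alpha z)
              (Cadd (Csub (Cmul z z) (Cmul (RtoC (2 * a_km n m alpha)) z)) (RtoC 1))
  end.

Definition Pstar (m : nat) (alpha : R) (z : Cx) : Cx :=
  if Nat.even m then S_poly (Nat.div2 m) m alpha z
  else Cmul (Csub z (RtoC 1)) (S_poly (Nat.div2 m) m alpha z).

Definition rotate (m : nat) (theta : R) (Q : Cx -> Cx) (z : Cx) : Cx :=
  Cmul (cexp_i (INR m * theta)) (Q (Cmul z (cexp_i (- theta)))).

(* Main.v *)
(* On the circle |P| is the modulus of F(t) = prod_j 2 sin ((t - phi_j) / 2).  Let E = {|F| < h}.
   Among all choices of m zeros take one minimizing c = sup_E |F|, so that c <= h.  Minimality
   forces the zeros to be distinct and |F| to reach c between any two neighbours, since otherwise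
   pushing these apart would lower |F| on E.  Hence {|F| < c} consists of m arcs, of total length
   4 eps say, whose closures cover E.  Let p, a, b be the monic polynomials with zeros at the zeros of F,
   the left and the right end points of the arcs; then p^2 - c^2 p(0) X^m = a b.  Put
   lam = e^(2 i eps), q = p + lam a and let b1 be the monic multiple of b - lam^2 a, which vanishes
   at 0.  Then the product of |q| over the zeros of b1 is (c / sin eps)^m, while |q(0)| = 2.  The
   zeros of b1 lie in the closed disc, and a minimum principle on the curve
   q^2 - 2 p q + c^2 p(0) z^m = 0 gives |q| >= c there.  So (c / sin eps)^m >= 2 c^(m-1), that is
   2 sin^m eps <= c <= h, which bounds the length of E.

   In the case of equality the nonzero zeros of b1 lie on the circle, so a and b have m - 1 common
   zeros and p solves a Pell equation.  Differentiating it yields a first order linear system whose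
   monic solution is unique up to a rotation; P*_m solves it too, because
   |P*_m(e^(it))| = 2 sin^m(alpha/2) |T_m(sin(t/2) / sin(alpha/2))|. *)
From Stdlib Require Import Reals Lra Lia List.
From Coquelicot Require Coquelicot.
From mathcomp Require all_boot all_order all_algebra complex.
From mathcomp Require boolp classical_sets reals topology normedtype derive Rstruct.
From mathcomp Require ring lra zify.
Require Import Defs.
Open Scope R_scope.

(** For an arbitrary polynomial the set {|F| < h} may have fewer than m arcs, some of them holding
    several zeros, and then p^2 - h^2 p(0) X^m need not have all its roots on the circle. This is
    why the polynomial is changed while E is kept.

    The polynomial q is read off the curve, which says (q - p)^2 = a b. All roots of a and b lie on
    the circle, so p + sqrt(a b) has a branch in the open disc; at a root of b1 one has b = lam^2 a,
    and p + lam a is the value of that branch. The sum of the lengths of the arcs is the difference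
    of the sums of their end points, hence b(0) = e^(4 i eps) a(0) = lam^2 a(0), which explains both
    the root 0 of b1 and the value q(0) = 2 p(0).

    On the curve q = 0 is possible only over z = 0, and there the chosen branch has q = 2 p(0)
    instead. So |q| has no small value inside the disc and can be compared with its values over the
    circle. The branch itself is never constructed: a sign condition on a continuous function of (z,
    q) singles it out. *)

Module RiemannLevel.
Import Coquelicot.Coquelicot.

(** * Integrals of periodic functions and of level indicators *)

Lemma is_RInt_shift (f : R -> R) a b p L : (forall t, f (t + p) = f t) ->
  is_RInt f a b L -> is_RInt f (a + p) (b + p) L.
Proof.
intros per H.
assert (H' : is_RInt f (1 * (a + p) + - p) (1 * (b + p) + - p) L).
{ replace (1 * (a + p) + - p) with a by ring. replace (1 * (b + p) + - p) with b by ring. exact H. }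
apply (is_RInt_comp_lin f 1 (- p)) in H'.
eapply is_RInt_ext; [|exact H'].
intros x _. cbn. unfold scal; cbn; unfold mult; cbn.
rewrite Rmult_1_l, Rmult_1_l, <- (per (x + - p)). f_equal; ring.
Qed.

(** The part of the integral over [b, a] is cut off and added back one period later. *)
Lemma is_RInt_window_le (f : R -> R) p L a b : 0 < p -> (forall t, f (t + p) = f t) ->
  b <= a <= b + p -> is_RInt f b (b + p) L -> is_RInt f a (a + p) L.
Proof.
intros p0 per ab H.
assert (E : ex_RInt f b (b + p)) by (exists L; exact H).
assert (E1 : ex_RInt f b a) by (apply (ex_RInt_Chasles_1 f b a (b + p)); auto).
assert (E2 : ex_RInt f a (b + p)) by (apply (ex_RInt_Chasles_2 f b a (b + p)); auto).
destruct E1 as [I1 H1]. destruct E2 as [I2 H2].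
assert (e : L = I1 + I2).
{ pose proof (is_RInt_Chasles f b a (b + p) I1 I2 H1 H2) as H3.
  pose proof (is_RInt_unique _ _ _ _ H) as u1. pose proof (is_RInt_unique _ _ _ _ H3) as u2.
  rewrite u1 in u2. exact u2. }
rewrite e, (Rplus_comm I1 I2).
apply (is_RInt_Chasles f a (b + p) (a + p)); auto.
apply is_RInt_shift; auto.
Qed.

Lemma is_RInt_window (f : R -> R) p L a b : 0 < p -> (forall t, f (t + p) = f t) ->
  is_RInt f b (b + p) L -> is_RInt f a (a + p) L.
Proof.
intros p0 per H.
assert (up : forall (n : nat) c, b <= c -> c <= b + INR n * p -> is_RInt f c (c + p) L).
{ induction n as [|n IH]; intros c h1 h2.
  - cbn in h2. replace c with b by lra. exact H.
  - rewrite S_INR in h2. destruct (Rle_dec c (b + INR n * p)) as [h|h]; [apply IH; auto|].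
    apply (is_RInt_window_le f p L c (Rmax b (c - p))); auto.
    + unfold Rmax; destruct (Rle_dec b (c - p)); lra.
    + apply IH; unfold Rmax; destruct (Rle_dec b (c - p)); try lra.
      pose proof (pos_INR n). nra. }
assert (down : forall n : nat, is_RInt f (b - INR n * p) (b - INR n * p + p) L).
{ induction n as [|n IH].
  - cbn. replace (b - 0 * p) with b by ring. exact H.
  - rewrite S_INR. replace (b - (INR n + 1) * p) with (b - INR n * p + - p) by ring.
    replace (b - INR n * p + - p + p) with (b - INR n * p + p + - p) by ring.
    apply is_RInt_shift; auto. intros t. rewrite <- (per (t + - p)). f_equal; ring. }
destruct (Rle_dec b a) as [h|h].
- destruct (INR_unbounded ((a - b) / p)) as [n hn].
  apply (up n); auto. apply Rmult_lt_compat_r with (r := p) in hn; auto.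
  unfold Rdiv in hn. rewrite Rmult_assoc, Rinv_l in hn; lra.
- destruct (INR_unbounded ((b - a) / p)) as [n hn].
  apply Rmult_lt_compat_r with (r := p) in hn; auto.
  unfold Rdiv in hn. rewrite Rmult_assoc, Rinv_l in hn; [|lra].
  (* The ascent of [up] again, now from a starting point n periods below b, hence below a. *)
  assert (G : forall (k : nat) c, b - INR n * p <= c -> c <= b - INR n * p + INR k * p -> is_RInt f c (c + p) L).
  { induction k as [|k IH]; intros c h1 h2.
    - cbn in h2. replace c with (b - INR n * p) by lra. apply down.
    - rewrite S_INR in h2. destruct (Rle_dec c (b - INR n * p + INR k * p)) as [h3|h3]; [apply IH; auto|].
      apply (is_RInt_window_le f p L c (Rmax (b - INR n * p) (c - p))); auto.
      + unfold Rmax; destruct (Rle_dec (b - INR n * p) (c - p)); lra.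
      + apply IH; unfold Rmax; destruct (Rle_dec (b - INR n * p) (c - p)); try lra.
        pose proof (pos_INR k). nra. }
  apply (G n); lra.
Qed.

(** The exceptions are needed because the extremal polynomial touches the level inside its arc, so
    that the indicator jumps to 1 at finitely many points. A listed point inside the interval is
    removed by splitting there. *)
Lemma is_RInt_but_finite (f : R -> R) (c : R) (l : list R) a b : a <= b ->
  (forall t, a < t < b -> ~ In t l -> f t = c) -> is_RInt f a b (c * (b - a)).
Proof.
revert a b; induction l as [|x l IH]; intros a b ab H.
- eapply is_RInt_ext with (f := fun _ => c).
  + intros t. rewrite Rmin_left, Rmax_right by lra. intros ht. symmetry; apply H; auto.
  + replace (c * (b - a)) with (scal (b - a) c) by (unfold scal; cbn; unfold mult; cbn; ring).
    apply (is_RInt_const a b c).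
- destruct (Rlt_dec a x) as [ax|ax]; [destruct (Rlt_dec x b) as [xb|xb]|].
  + replace (c * (b - a)) with (c * (x - a) + c * (b - x)) by ring.
    apply (is_RInt_Chasles f a x b); apply IH; try lra; intros t ht hn; apply H; try lra.
    * intros [e|h]; [lra|auto].
    * intros [e|h]; [lra|auto].
  + apply IH; auto. intros t ht hn; apply H; auto. intros [e|h]; [lra|auto].
  + apply IH; auto. intros t ht hn; apply H; auto. intros [e|h]; [lra|auto].
Qed.

Fixpoint gap_sum (aa bb : nat -> R) (m : nat) : R :=
  match m with O => 0 | S n => gap_sum aa bb n + (aa (S n) - bb n) end.

(** On the bands only the sign of f is known, which is enough for a lower bound. *)
Lemma gap_sum_le_RInt (f : R -> R) (aa bb : nat -> R) (m : nat) :
  (forall t, 0 <= f t) ->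
  (forall j, (j < m)%nat -> aa j <= bb j <= aa (S j)) ->
  (forall j t, (j < m)%nat -> bb j < t < aa (S j) -> f t = 1) ->
  ex_RInt f (aa O) (aa m) -> gap_sum aa bb m <= RInt f (aa O) (aa m).
Proof.
intros f0; induction m as [|m IH]; intros ord one ex.
- rewrite RInt_point. cbn. unfold zero; cbn; lra.
- assert (le : aa O <= aa m).
  { assert (G : forall k, (k <= m)%nat -> aa O <= aa k).
    { induction k as [|k IHk]; intros hk; [lra|].
      specialize (IHk ltac:(lia)). pose proof (ord k ltac:(lia)). lra. }
    apply G; lia. }
  pose proof (ord m ltac:(lia)) as om.
  assert (E1 : ex_RInt f (aa O) (aa m)) by (apply (ex_RInt_Chasles_1 f _ _ (aa (S m))); auto; lra).
  assert (E2 : ex_RInt f (aa m) (aa (S m))) by (apply (ex_RInt_Chasles_2 f (aa O)); auto; lra).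
  assert (E3 : ex_RInt f (aa m) (bb m)) by (apply (ex_RInt_Chasles_1 f _ _ (aa (S m))); auto; lra).
  assert (E4 : ex_RInt f (bb m) (aa (S m))) by (apply (ex_RInt_Chasles_2 f (aa m)); auto; lra).
  rewrite <- (RInt_Chasles f (aa O) (aa m) (aa (S m)) E1 E2).
  rewrite <- (RInt_Chasles f (aa m) (bb m) (aa (S m)) E3 E4).
  assert (H4 : RInt f (bb m) (aa (S m)) = aa (S m) - bb m).
  { apply is_RInt_unique. replace (aa (S m) - bb m) with (1 * (aa (S m) - bb m)) by ring.
    apply (is_RInt_but_finite f 1 nil); [lra|]. intros t ht _. apply (one m); auto. }
  assert (H3 : 0 <= RInt f (aa m) (bb m)) by (apply RInt_ge_0; auto; lra).
  assert (H1 : gap_sum aa bb m <= RInt f (aa O) (aa m)).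
  { apply IH; auto. intros j t hj. apply one; lia. }
  cbn [gap_sum]. rewrite H4.
  apply Rle_trans with (RInt f (aa O) (aa m) + (RInt f (aa m) (bb m) + (aa (S m) - bb m))); [lra|].
  apply Rle_refl.
Qed.

Lemma level_mes_RInt phis h L :
  level_mes phis h L <-> is_RInt (level_ind phis h) 0 (2 * PI) L.
Proof.
split.
- intros [pr <-]; rewrite <- RInt_Reals.
  apply (RInt_correct (V := R_CompleteNormedModule)), ex_RInt_Reals_1, pr.
- intros H.
  assert (pr : Riemann_integrable (level_ind phis h) 0 (2 * PI)).
  { apply ex_RInt_Reals_0; now exists L. }
  exists pr; rewrite <- RInt_Reals; now apply is_RInt_unique.
Qed.

Lemma level_mes_period phis h L a :
  (forall t, level_ind phis h (t + 2 * PI) = level_ind phis h t) ->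
  is_RInt (level_ind phis h) a (a + 2 * PI) L <-> level_mes phis h L.
Proof.
intros per; rewrite level_mes_RInt; assert (P0 := PI_RGT_0).
rewrite <- (Rplus_0_l (2 * PI)) at 2.
split; apply is_RInt_window; trivial; lra.
Qed.

(** Meant for the extremal polynomial, whose values below the level fill a single arc up to the
    touching points listed in [l]. *)
Lemma level_mes_two_arcs phis h a b l :
  (forall t, level_ind phis h (t + 2 * PI) = level_ind phis h t) ->
  a <= b <= a + 2 * PI ->
  (forall t, a < t < b -> ~ In t l -> level_ind phis h t = 0) ->
  (forall t, b < t < a + 2 * PI -> level_ind phis h t = 1) ->
  level_mes phis h (a + 2 * PI - b).
Proof.
intros per [ab ba] H0 H1; apply (level_mes_period _ _ _ a per).
replace (a + 2 * PI - b) with (plus (0 * (b - a)) (1 * (a + 2 * PI - b))).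
- apply (is_RInt_Chasles (level_ind phis h) a b (a + 2 * PI)).
  + now apply is_RInt_but_finite with l.
  + apply is_RInt_but_finite with nil; auto.
- unfold plus; simpl; ring.
Qed.

Lemma level_mes_gap_sum phis h L (aa bb : nat -> R) m :
  (forall t, level_ind phis h (t + 2 * PI) = level_ind phis h t) ->
  (forall j, (j < m)%nat -> aa j <= bb j <= aa (S j)) ->
  aa m = aa O + 2 * PI ->
  (forall j t, (j < m)%nat -> bb j < t < aa (S j) -> level_ind phis h t = 1) ->
  level_mes phis h L -> gap_sum aa bb m <= L.
Proof.
intros per ab am H1 HL; apply (level_mes_period _ _ _ (aa O) per) in HL.
rewrite <- am in HL.
rewrite <- (is_RInt_unique _ _ _ _ HL).
apply gap_sum_le_RInt; trivial; [|now exists L].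
intros t; unfold level_ind; destruct Rle_dec; lra.
Qed.

End RiemannLevel.

(** * The angle belonging to a level *)

Lemma acos_level (m : nat) h alpha : (1 <= m)%nat -> 0 < alpha < PI ->
  h = 2 * sin (alpha / 2) ^ m ->
  4 * acos (Rpower (h / 2) (/ INR m)) = 2 * PI - 2 * alpha.
Proof.
intros m1 [a0 aP] ->.
assert (s0 : 0 < sin (alpha / 2)) by (apply sin_gt_0; lra).
assert (m0 : INR m <> 0) by (apply not_0_INR; lia).
replace (2 * sin (alpha / 2) ^ m / 2) with (sin (alpha / 2) ^ m) by field.
rewrite <- Rpower_pow, Rpower_mult, Rinv_r, Rpower_1 by assumption.
rewrite <- cos_shift, acos_cos by lra; lra.
Qed.

Lemma level_angle (m : nat) h : (1 <= m)%nat -> 0 < h < 2 ->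
  exists alpha, 0 < alpha < PI /\ h = 2 * sin (alpha / 2) ^ m.
Proof.
intros m1 [h0 h2].
assert (m0 : 0 < INR m) by (apply lt_0_INR; lia).
set (x := Rpower (h / 2) (/ INR m)).
assert (x0 : 0 < x) by apply exp_pos.
assert (x1 : x < 1).
{ unfold x, Rpower; rewrite <- exp_0; apply exp_increasing.
  assert (ln (h / 2) < 0) by (rewrite <- ln_1; apply ln_increasing; lra).
  assert (0 < / INR m) by now apply Rinv_0_lt_compat.
  nra. }
assert (xm : x ^ m = h / 2).
{ rewrite <- Rpower_pow by assumption; unfold x.
  rewrite Rpower_mult, Rinv_l, Rpower_1; lra. }
exists (2 * asin x).
replace (2 * asin x / 2) with (asin x) by field.
rewrite sin_asin, xm by lra.
assert (B := asin_bound_lt x); split; [split|]; [|lra|field].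
enough (0 < asin x) by lra.
apply Rnot_le_lt; intros le.
assert (S := sin_ge_0 (- asin x)); rewrite sin_neg, sin_asin in S; lra.
Qed.

Module CirclePolynomials.
Import all_boot all_order all_algebra complex.
Import boolp classical_sets reals topology normedtype derive.
Import mathcomp.algebra_tactics.ring mathcomp.algebra_tactics.lra.
Set Implicit Arguments. Unset Strict Implicit. Unset Printing Implicit Defensive.
Import Order.TTheory GRing.Theory Num.Theory.
Import numFieldTopology.Exports numFieldNormedType.Exports.
Local Open Scope ring_scope.

(** * Polynomials with zeros on the unit circle *)

Section Alg.
Variable C : numClosedFieldType.
Implicit Types (s : seq C) (f g : {poly C}).

Definition rpoly s : {poly C} := \prod_(r <- s) ('X - r%:P).
Definition circle s := all (fun r => `|r| == 1) s.

Lemma hornerrpoly s z : (rpoly s).[z] = \prod_(r <- s) (z - r).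
Proof.
rewrite /rpoly horner_prod; apply: eq_bigr => r _; by rewrite hornerXsubC.
Qed.

Lemma monic_rpoly s : rpoly s \is monic.
Proof. by rewrite monic_prod // => r _; rewrite monicXsubC. Qed.

Lemma size_rpoly s : size (rpoly s) = (size s).+1.
Proof. by rewrite /rpoly size_prod_XsubC. Qed.

Lemma unitC_conj (z : C) : `|z| = 1 -> z * z^* = 1.
Proof. by move=> h; rewrite -normCK h expr1n. Qed.

Lemma unitC_neq0 (z : C) : `|z| = 1 -> z != 0.
Proof. by move=> h; rewrite -normr_gt0 h ltr01. Qed.

(** On the unit circle each factor satisfies conj(z - r) (- z r) = z - r; the polynomial is
    therefore self-reciprocal up to the constant p(0). *)
Lemma conj_rpoly s z : circle s -> `|z| = 1 ->
  (rpoly s).[z]^* * (z ^+ size s * (rpoly s).[0]) = (rpoly s).[z].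
Proof.
move=> + hz; rewrite !hornerrpoly; elim: s => [|r s IH] /=.
  by rewrite !big_nil expr0 !mulr1 conjC1.
case/andP => /eqP hr hs; rewrite !big_cons -[in RHS](IH hs) rmorphM exprS rmorphB /=.
have := unitC_conj hz; have := unitC_conj hr.
move: (\prod_(j <- s) (0 - j)) (\prod_(j <- s) (z - j))^* (z ^+ size s) => A B D.
move: (r^*) (z^*) => r' z' h1 h2.
transitivity (((z * z') * r - z * (r * r')) * (- (B * (D * A)))); first by ring.
rewrite h1 h2; ring.
Qed.

Lemma norm_rpoly0 s : circle s -> `|(rpoly s).[0]| = 1.
Proof.
rewrite hornerrpoly; elim: s => [|r s IH] /=; first by rewrite big_nil normr1.
case/andP => /eqP hr hs; by rewrite big_cons normrM IH // sub0r normrN hr mulr1.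
Qed.

(** Every root has distance at least r from z0, so each linear factor grows at most by 1 + |z1 - z0|
    / r. Read backwards, a value at z0 that is small compared with the one at z1 forces a root near
    z0; this takes the place of the open mapping theorem in the minimum principle. *)
Lemma root_near f z0 z1 (r : C) : f != 0 -> 0 < r ->
  (forall x, root f x -> r <= `|x - z0|) ->
  `|f.[z1]| <= `|f.[z0]| * (1 + `|z1 - z0| / r) ^+ (size f).-1.
Proof.
move=> f0 r0 hr.
have [s hs] := closed_field_poly_normal f.
have lf : lead_coef f != 0 by rewrite lead_coef_eq0.
have -> : (size f).-1 = size s by rewrite {1}hs size_scale // size_prod_XsubC.
have hr' : forall x, x \in s -> r <= `|x - z0|.
  by move=> x xs; apply: hr; rewrite hs rootZ // root_prod_XsubC.
rewrite hs !hornerZ !normrM -mulrA ler_wpM2l // -!/(rpoly s) !hornerrpoly.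
elim: s {hs} hr' => [|x s IH] hr'; first by rewrite !big_nil expr0 mulr1.
rewrite !big_cons !normrM exprS.
have h1 : `|z1 - x| <= `|z0 - x| * (1 + `|z1 - z0| / r).
  have -> : z1 - x = (z0 - x) + (z1 - z0) by ring.
  apply: le_trans (ler_normD _ _) _; rewrite mulrDr mulr1 lerD2l.
  rewrite mulrCA ler_peMr // ler_pdivlMr // mul1r distrC; apply: hr'.
  by rewrite in_cons eqxx.
have h2 : `|\prod_(j <- s) (z1 - j)| <=
  `|\prod_(j <- s) (z0 - j)| * (1 + `|z1 - z0| / r) ^+ size s.
  by apply: IH => y ys; apply: hr'; rewrite in_cons ys orbT.
rewrite mulrACA; apply: ler_pM => //.
Qed.

(** Both sides are the modulus of the resultant. *)
Lemma rpoly_exchange s1 s2 :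
  `|\prod_(r <- s1) (rpoly s2).[r]| = `|\prod_(r <- s2) (rpoly s1).[r]|.
Proof.
under eq_bigr do rewrite hornerrpoly.
under [in RHS]eq_bigr do rewrite hornerrpoly.
rewrite exchange_big /= !normr_prod; apply: eq_bigr => i _.
rewrite !normr_prod; apply: eq_bigr => j _; exact: distrC.
Qed.

End Alg.

Lemma prodr_const_seq (R : comNzRingType) (T : Type) (s : seq T) (x : R) :
  \prod_(i <- s) x = x ^+ size s.
Proof. by rewrite big_const_seq count_predT iter_mulr_1. Qed.

(** * The auxiliary polynomials q and b1 *)

Section Core.
Variable C : numClosedFieldType.
Variables (m : nat) (rp ra rb : seq C) (h w : C).
Hypotheses (m_gt0 : (0 < m)%N) (sp : size rp = m) (sa : size ra = m) (sb : size rb = m).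
Hypotheses (cp : circle rp) (ca : circle ra) (cb : circle rb) (ua : uniq ra).
Hypotheses (h_gt0 : 0 < h) (w1 : `|w| = 1) (Rew : 0 < 'Re w) (Imw : 0 < 'Im w).
Let lam := w ^+ 2.
Let p := rpoly rp.
Let a := rpoly ra.
Let b := rpoly rb.
Let kap := p.[0].
Hypotheses (Hab : p ^+ 2 - (h ^+ 2 * kap) *: 'X^m = a * b).
Hypotheses (Ha0 : kap = lam * a.[0]).

Let q := p + lam *: a.
Let b1 := (1 - lam ^+ 2)^-1 *: (b - lam ^+ 2 *: a).

Lemma lam1 : `|lam| = 1. Proof. by rewrite normrX w1 expr1n. Qed.

Lemma kap1 : `|kap| = 1. Proof. exact: norm_rpoly0. Qed.

Lemma lamB1 : lam - 1 = 2 * w * ('i * 'Im w).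
Proof.
have -> : lam - 1 = w * (w - w^*) by rewrite mulrBr (unitC_conj w1) /lam expr2.
rewrite [2 * w]mulrC -mulrA; congr (_ * _).
rewrite {1 2}[w]Crect conjC_rect ?Creal_Re ?Creal_Im //; ring.
Qed.

Lemma lamD1 : lam + 1 = 2 * w * 'Re w.
Proof.
have -> : lam + 1 = w * (w + w^*) by rewrite mulrDr (unitC_conj w1) /lam expr2.
rewrite [2 * w]mulrC -mulrA; congr (_ * _).
rewrite {1 2}[w]Crect conjC_rect ?Creal_Re ?Creal_Im //; ring.
Qed.

Lemma lamB1_neq0 : lam - 1 != 0.
Proof. by rewrite lamB1 !mulf_neq0 ?pnatr_eq0 ?neq0Ci ?(unitC_neq0 w1) ?gt_eqF. Qed.

Lemma lamD1_neq0 : lam + 1 != 0.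
Proof. by rewrite lamD1 !mulf_neq0 ?pnatr_eq0 ?(unitC_neq0 w1) ?gt_eqF. Qed.

Lemma lam2_neq1 : 1 - lam ^+ 2 != 0.
Proof.
have -> : 1 - lam ^+ 2 = - ((lam - 1) * (lam + 1)) by ring.
by rewrite oppr_eq0 mulf_neq0 ?lamB1_neq0 ?lamD1_neq0.
Qed.

Lemma norm_lamB1 : `|lam - 1| = 2 * 'Im w.
Proof.
by rewrite lamB1 !normrM w1 normCi mulr1 mul1r normr_nat ger0_norm // ltW.
Qed.

(** At 0 the term X^m disappears, which leaves p(0)^2 = a(0) b(0). *)
Lemma Hb0 : b.[0] = lam * kap.
Proof.
have := congr1 (fun f => f.[0]) Hab.
rewrite /= hornerM hornerD hornerN hornerZ hornerXn expr0n gtn_eqF // mulr0 subr0.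
rewrite horner_exp -/kap => e.
have k0 : a.[0] != 0 by rewrite -normr_gt0 norm_rpoly0 // ltr01.
by apply: (mulfI k0); rewrite -e expr2 mulrA [a.[0] * lam]mulrC -Ha0.
Qed.

Lemma b1E : (1 - lam ^+ 2) *: b1 = b - lam ^+ 2 *: a.
Proof. by rewrite /b1 scalerA divff ?lam2_neq1 // scale1r. Qed.

Lemma b1_0 : b1.[0] = 0.
Proof.
rewrite /b1 !hornerE Hb0 {1}Ha0; apply/eqP; rewrite mulf_eq0; apply/orP; right.
by rewrite subr_eq0 mulrA expr2.
Qed.

Lemma coef_rpoly_size s n : size s = n -> (@rpoly C s)`_n = 1.
Proof.
move=> <-; have := monic_rpoly s; by rewrite monicE lead_coefE size_rpoly => /eqP.
Qed.

Lemma size_lead_comb (x y : C) s1 s2 : x + y != 0 -> size s1 = m -> size s2 = m ->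
  size (x *: rpoly s1 + y *: rpoly s2) = m.+1 /\
  lead_coef (x *: rpoly s1 + y *: rpoly s2) = x + y.
Proof.
move=> xy h1 h2; set f := _ + _.
have le : (size f <= m.+1)%N.
  apply: leq_trans (size_polyD _ _) _; rewrite geq_max.
  by rewrite !(leq_trans (size_scale_leq _ _)) // size_rpoly ?h1 ?h2.
have co : f`_m = x + y by rewrite coefD !coefZ !coef_rpoly_size // !mulr1.
have e : size f = m.+1.
  apply/eqP; rewrite eqn_leq le /= ltnNge; apply/negP => /leq_sizeP /(_ m (leqnn _)).
  by rewrite co => e; move: xy; rewrite e eqxx.
by split => //; rewrite lead_coefE e.
Qed.

Lemma b1_monic : size b1 = m.+1 /\ b1 \is monic.
Proof.
have [] := @size_lead_comb 1 (- lam ^+ 2) rb ra lam2_neq1 sb sa.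
rewrite scale1r scaleNr -/a -/b => e1 e2.
rewrite /b1 size_scale ?invr_neq0 ?lam2_neq1 // monicE lead_coefZ e2.
by rewrite mulVf ?lam2_neq1.
Qed.

Lemma norm_p_ra r : r \in ra -> `|p.[r]| = h.
Proof.
move=> hr; have := congr1 (fun f => f.[r]) Hab.
have ar : a.[r] = 0 by apply/eqP; rewrite -/(root a r) root_prod_XsubC.
rewrite /= hornerM ar mul0r hornerD hornerN hornerZ hornerXn horner_exp => /eqP.
rewrite subr_eq0 => /eqP e; apply/eqP; rewrite -(@eqrXn2 _ 2) // ?ltW //.
by rewrite -normrX e !normrM kap1 !normrX (eqP (allP ca _ hr)) expr1n !mulr1 gtr0_norm.
Qed.

(* Since q (p - lam a) = (1 - lam^2) a b1 + h^2 kap X^m, the values of a b1 at the roots of q,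
   of p at the roots of a and of q at the roots of b1 determine each other. *)
Lemma prod_norm_q_roots_b1 rc : b1 = rpoly rc ->
  \prod_(c <- rc) `|q.[c]| = (h / 'Im w) ^+ m.
Proof.
move=> hc.
have sc : size rc = m.
  by have [+ _] := b1_monic; rewrite hc size_rpoly => /eqP; rewrite eqSS => /eqP.
have [rq hq] := closed_field_poly_normal q.
have L0 := lamD1_neq0.
have [sq lq] : size q = m.+1 /\ lead_coef q = lam + 1.
  have := @size_lead_comb 1 lam rp ra; rewrite scale1r => H.
  by have := H _ sp sa; rewrite addrC; apply.
rewrite lq -/(rpoly rq) in hq.
have szq : size rq = m.
  by move: sq; rewrite hq size_scale // size_rpoly => /eqP; rewrite eqSS => /eqP.
set L := `|lam + 1|.
have Lp : 0 < L by rewrite normr_gt0.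
have key e : e \in rq -> `|1 - lam ^+ 2| * `|a.[e]| * `|b1.[e]| = h ^+ 2 * `|e| ^+ m.
  move=> he.
  have qe : q.[e] = 0.
    by apply/eqP; rewrite -/(root q e) hq rootZ // root_prod_XsubC.
  have E : (1 - lam ^+ 2) * (a.[e] * b1.[e]) = - (h ^+ 2 * kap * e ^+ m).
    have e1 : (1 - lam ^+ 2) * b1.[e] = b.[e] - lam ^+ 2 * a.[e].
      by have := congr1 (fun f => f.[e]) b1E; rewrite !hornerE.
    have e2 : p.[e] ^+ 2 - h ^+ 2 * kap * e ^+ m = a.[e] * b.[e].
      by have := congr1 (fun f => f.[e]) Hab; rewrite !hornerE.
    have e3 : p.[e] = - (lam * a.[e]).
      by apply/eqP; rewrite -subr_eq0 opprK -qe /q !hornerE.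
    rewrite mulrCA e1 mulrBr -e2 e3; ring.
  rewrite -mulrA -!normrM E normrN normrM [`|_ * kap|]normrM kap1 mulr1 !normrX.
  by rewrite (gtr0_norm h_gt0).
have P1 : L * \prod_(e <- rq) `|e| = 2.
  have : `|q.[0]| = 2.
    have -> : q.[0] = 2 * kap by rewrite /q !hornerE -Ha0 -/kap; ring.
    by rewrite normrM kap1 mulr1 normr_nat.
  rewrite hq hornerZ normrM hornerrpoly normr_prod => <-.
  by congr (_ * _); apply: eq_bigr => i _; rewrite sub0r normrN.
have P2 : L ^+ m * \prod_(e <- rq) `|a.[e]| = h ^+ m.
  rewrite -normr_prod rpoly_exchange normr_prod -sa -!prodr_const_seq -big_split /=.
  rewrite big_seq [RHS]big_seq; apply: eq_bigr => r hr.
  have ar : a.[r] = 0 by apply/eqP; rewrite -/(root a r) root_prod_XsubC.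
  by rewrite -(norm_p_ra hr) -normrM -hornerZ -hq /q hornerD hornerZ ar mulr0 addr0.
have P3 : L ^+ m * \prod_(e <- rq) `|b1.[e]| = \prod_(c <- rc) `|q.[c]|.
  rewrite -normr_prod hc rpoly_exchange normr_prod -{1}sc -!prodr_const_seq -big_split /=.
  by apply: eq_bigr => c _; rewrite hq hornerZ normrM.
have P4 : `|1 - lam ^+ 2| ^+ m * \prod_(e <- rq) `|a.[e]| * \prod_(e <- rq) `|b1.[e]|
  = (h ^+ 2 * \prod_(e <- rq) `|e|) ^+ m.
  rewrite [in RHS]exprMn (big_morph (fun x => x ^+ m) (fun x y => exprMn m x y) (expr1n _ m)).
  have cst (x : C) : x ^+ m = \prod_(e <- rq) x by rewrite prodr_const_seq szq.
  rewrite (cst `|_|) (cst (h ^+ 2)) -!big_split /=.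
  rewrite big_seq [RHS]big_seq; apply: eq_bigr => e he; exact: key.
(* This splitting supplies the powers of L that cancel those of [P1], [P2] and [P3], so that only
   the imaginary part of w remains. *)
have N : `|1 - lam ^+ 2| = 2 * 'Im w * L.
  have -> : 1 - lam ^+ 2 = - ((lam - 1) * (lam + 1)) by ring.
  by rewrite normrN normrM norm_lamB1.
move: P2 P3 P4; rewrite N.
set A := \prod_(e <- rq) `|a.[e]|; set B := \prod_(e <- rq) `|b1.[e]|.
set Q := \prod_(c <- rc) _; set E := \prod_(e <- rq) `|e| in P1 *.
move=> P2 P3 P4.
have hm : h ^+ m != 0 by rewrite expf_neq0 // gt_eqF.
have Im0 : 'Im w ^+ m != 0 by rewrite expf_neq0 // gt_eqF.
have t0 : (2 : C) ^+ m != 0 by rewrite expf_neq0 // pnatr_eq0.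
have Lm : L ^+ m != 0 by rewrite expf_neq0 // gt_eqF.
rewrite exprMn exprVn; apply/eqP; rewrite -(inj_eq (mulfI Im0)) mulrCA divff // mulr1.
rewrite -(inj_eq (mulfI hm)) -(inj_eq (mulfI t0)); apply/eqP.
transitivity (L ^+ m * ((2 * 'Im w * L) ^+ m * A * B)).
  rewrite -P3 -{1}P2 !exprMn; ring.
rewrite P4 -exprMn; transitivity ((h * h * 2) ^+ m); last by rewrite !exprMn; ring.
by congr (_ ^+ m); rewrite -P1; ring.
Qed.

End Core.

(** * Partial fractions and the Poisson kernel *)

Section Lagrange.
Variable C : numClosedFieldType.
Implicit Types (s : seq C) (f : {poly C}).

Lemma root_rpoly s x : root (rpoly s) x = (x \in s).
Proof. exact: root_prod_XsubC. Qed.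

Lemma rpoly_divX s r : r \in s -> rpoly s = ('X - r%:P) * (rpoly (rem r s)).
Proof. by move=> rs; rewrite /rpoly (perm_big _ (perm_to_rem rs)) big_cons. Qed.

Lemma deriv_rpoly s r : r \in s -> (rpoly s)^`().[r] = (rpoly (rem r s)).[r].
Proof.
move=> rs; rewrite {1}(rpoly_divX rs) derivM derivXsubC !hornerE.
by rewrite subrr mul0r addr0.
Qed.

Lemma lagrange_frac s f z : uniq s -> (size f <= size s)%N -> ~~ root (rpoly s) z ->
  f.[z] / (rpoly s).[z] = \sum_(r <- s) f.[r] / (rpoly s)^`().[r] / (z - r).
Proof.
move=> us sf az.
have d0 r : r \in s -> (rpoly s)^`().[r] != 0.
  move=> rs; rewrite deriv_rpoly // -/(root _ r) root_rpoly.
  by rewrite mem_rem_uniq // !inE eqxx.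
(* The Lagrange interpolation polynomial of f at the points of s. *)
pose g := \sum_(r <- s) (f.[r] / (rpoly s)^`().[r]) *: rpoly (rem r s).
have fg : f = g.
  apply/eqP; rewrite -subr_eq0; apply/eqP/(@roots_geq_poly_eq0 _ _ s) => //.
    apply/allP => t ts; rewrite /root !hornerE horner_sum (big_rem t) //= big1_seq.
      by rewrite hornerZ -deriv_rpoly // divfK ?d0 // addr0 subrr.
    move=> r /=; rewrite mem_rem_uniq // !inE => /andP[rt rs].
    rewrite hornerZ; have -> : (rpoly (rem r s)).[t] = 0.
      by apply/eqP; rewrite -/(root _ t) root_rpoly mem_rem_uniq // !inE ts andbT eq_sym.
    by rewrite mulr0.
  apply: leq_trans (size_polyD _ _) _; rewrite size_polyN geq_max sf /=.
  rewrite /g big_seq; elim/big_ind: _ => [|x y hx hy|r rs].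
  - by rewrite size_poly0.
  - by apply: leq_trans (size_polyD _ _) _; rewrite geq_max hx.
  - apply: leq_trans (size_scale_leq _ _) _; rewrite size_rpoly size_rem //.
    by rewrite prednK // -has_predT; apply/hasP; exists r.
rewrite {1}fg horner_sum mulr_suml big_seq [RHS]big_seq; apply: eq_bigr => r rs.
rewrite hornerZ -mulrA; congr (_ * _).
move: az; rewrite (rpoly_divX rs) /root !hornerE mulf_eq0 negb_or => /andP[h1 h2].
by rewrite invfM mulrCA divff // mulr1.
Qed.

End Lagrange.

Section ImR.
Variable C : numClosedFieldType.
Variables (m : nat) (rp ra rb : seq C) (h w : C).
Hypotheses (m_gt0 : (0 < m)%N) (sp : size rp = m) (sa : size ra = m) (sb : size rb = m).
Hypotheses (cp : circle rp) (ca : circle ra) (cb : circle rb) (ua : uniq ra).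
Hypotheses (h_gt0 : 0 < h) (w1 : `|w| = 1) (Rew : 0 < 'Re w) (Imw : 0 < 'Im w).
Let lam := w ^+ 2.
Let p := rpoly rp.
Let a := rpoly ra.
Let b := rpoly rb.
Let kap := p.[0].
Hypotheses (Hab : p ^+ 2 - (h ^+ 2 * kap) *: 'X^m = a * b).
Hypotheses (Ha0 : kap = lam * a.[0]).
Hypothesis Hres : forall r, r \in ra ->
  exists2 x : C, x <= 0 & b.[r] = 2 * 'i * x * lam * r * a^`().[r].

Let lam1' : `|lam| = 1. Proof. exact: lam1 w1. Qed.

Lemma Im_lam : 'Im lam = 2 * 'Re w * 'Im w.
Proof.
rewrite /lam {1}[w]Crect; move: (Creal_Re w) (Creal_Im w).
move: ('Re w) ('Im w) => x y rx ry.
have -> : (x + 'i * y) ^+ 2 = (x ^+ 2 - y ^+ 2) + 'i * (2 * x * y).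
  have := sqrCi C; move: ('i : C) => j hj.
  by have -> : (x + j * y) ^+ 2 = x ^+ 2 + j ^+ 2 * y ^+ 2 + j * (2 * x * y); [ring | rewrite hj; ring].
by rewrite Im_rect // ?rpredB ?rpredX ?rpredM ?realn.
Qed.

Lemma Im_lam_gt0 : 0 < 'Im lam.
Proof. by rewrite Im_lam !mulr_gt0. Qed.

Lemma outside_circle s (z : C) : circle s -> `|z| != 1 -> ~~ root (rpoly s) z.
Proof.
move=> cs hz; rewrite root_rpoly; apply/negP => zs.
by have := allP cs _ zs; rewrite (negbTE hz).
Qed.

(** The right side is minus the Poisson kernel of the disc. *)
Lemma Re_cayley (z r : C) : `|r| = 1 -> z != r ->
  'Re ((z + r) / (z - r)) = (`|z| ^+ 2 - 1) / `|z - r| ^+ 2.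
Proof.
move=> hr zr; have d0 : z - r != 0 by rewrite subr_eq0.
have n0 : `|z - r| ^+ 2 != 0 by rewrite expf_neq0 // normr_eq0.
have dc : (z - r)^* != 0 by rewrite conjC_eq0.
rewrite ReE rmorphM fmorphV /= rmorphD !rmorphB /=.
have hz := normCK z; have hr2 := unitC_conj hr; have hd := normCK (z - r).
rewrite hd hz; move: dc; rewrite rmorphB /= => dc.
have -> : z * z^* - 1 = z * z^* - r * r^* by rewrite hr2.
move: (z^*) (r^*) dc => z' r' dc.
by field; rewrite d0 dc.
Qed.

(** By [Hres] the residues of b / a are 2 i x lam r with x <= 0. After multiplication by conj(lam)
    the partial fractions become i x ((z + r) / (z - r) - 1), whose imaginary parts are Poisson
    kernels with weights of one sign, up to a constant. The sign of the left side thus tells the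
    inside of the circle from the outside. *)
Lemma ImR z : `|z| != 1 ->
  exists2 S : C, 0 < S & 'Im (lam^* * (b.[z] / a.[z])) = (1 - `|z| ^+ 2) * S.
Proof.
move=> hz.
have [X hX] : exists X : C -> C, forall r, r \in ra ->
   X r <= 0 /\ b.[r] = 2 * 'i * X r * lam * r * a^`().[r].
  have [X hX] : exists X : seq C, size X = size ra /\ forall i, (i < size ra)%N ->
     X`_i <= 0 /\ b.[ra`_i] = 2 * 'i * X`_i * lam * ra`_i * a^`().[ra`_i].
    move: Hres; clear; elim: ra => [|r s IH] H.
      by exists [::].
    have [x x0 hx] := H r (mem_head _ _).
    have [|X [hX1 hX2]] := IH; first by move=> t ts; apply: H; rewrite in_cons ts orbT.
    exists (x :: X); split; first by rewrite /= hX1.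
    by case=> [|i] /= hi; [split | apply: hX2].
  exists (fun r => X`_(index r ra)) => r rs.
  by have := hX.2 (index r ra); rewrite index_mem nth_index // => /(_ rs).
have a0 y : `|y| != 1 -> a.[y] != 0 by move=> hy; apply: outside_circle.
have d0 r : r \in ra -> a^`().[r] != 0.
  move=> rs; rewrite deriv_rpoly // -/(root _ r) root_rpoly.
  by rewrite mem_rem_uniq // !inE eqxx.
have sz : (size (b - a)%R <= size ra)%N.
  rewrite sa; apply/leq_sizeP => j; rewrite leq_eqVlt => /orP[/eqP <-|hj].
    by rewrite coefB !coef_rpoly_size // subrr.
  by rewrite coefB !nth_default ?subrr // size_rpoly ?sa ?sb.
have RE y : `|y| != 1 -> lam^* * (b.[y] / a.[y]) =
   lam^* + \sum_(r <- ra) 2 * 'i * X r * (r / (y - r)).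
  move=> hy.
  have -> : b.[y] / a.[y] = \sum_(r <- ra) b.[r] / a^`().[r] / (y - r) + 1.
    have := lagrange_frac ua sz (outside_circle ca hy).
    rewrite -/a hornerD hornerN mulrBl divff ?a0 // => /eqP; rewrite subr_eq => /eqP ->.
    congr (_ + _); rewrite big_seq [RHS]big_seq; apply: eq_bigr => r rs.
    have ar : a.[r] = 0 by apply/eqP; rewrite -/(root a r) root_rpoly.
    by rewrite hornerD hornerN ar subr0.
  rewrite mulrDr mulr1 addrC; congr (_ + _); rewrite mulr_sumr big_seq [RHS]big_seq.
  apply: eq_bigr => r rs.
  rewrite (hX r rs).2 mulfK ?d0 //.
  have := unitC_conj lam1'; move: (lam^*) => l' hl.
  transitivity ((lam * l') * (2 * 'i * X r * (r / (y - r)))); last by rewrite hl mul1r.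
  ring.
(* At 0 the quotient b / a is lam^2, which determines the total weight. It cancels the imaginary
   part of conj(lam) against the -1 in the Cayley terms, and it shows that the weights are not all
   0. *)
have sumX : \sum_(r <- ra) X r = - 'Im lam.
  have := RE 0; rewrite normr0 eq_sym oner_eq0 => /(_ isT).
  have a00 : a.[0] != 0 by apply: a0; rewrite normr0 eq_sym oner_eq0.
  have -> : b.[0] / a.[0] = lam * lam.
    by rewrite -/b (Hb0 m_gt0 ca Hab Ha0) -/p -/kap Ha0 mulrA mulfK.
  rewrite mulrA [lam^* * lam]mulrC unitC_conj // mul1r => e.
  have : \sum_(r <- ra) 2 * 'i * X r * (r / (0 - r)) = - (2 * 'i * \sum_(r <- ra) X r).
    rewrite mulr_sumr -sumrN big_seq [RHS]big_seq; apply: eq_bigr => r rs.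
    have r0 : r != 0 by apply: unitC_neq0; apply/eqP; apply: (allP ca).
    by rewrite sub0r invrN mulrN divff // mulrN1.
  move=> e2; rewrite e2 in e.
  have i2 : 2 * 'i != 0 :> C by rewrite mulf_neq0 ?pnatr_eq0 ?neq0Ci.
  apply: (mulfI i2); rewrite mulrN; apply/eqP; rewrite -eqr_oppLR; apply/eqP.
  have -> : - (2 * 'i * \sum_(r <- ra) X r) = lam - lam^*.
    by rewrite {1}e; ring.
  rewrite {1 2}[lam]Crect conjC_rect ?Creal_Re ?Creal_Im //; ring.
pose S := \sum_(r <- ra) (- X r) / `|z - r| ^+ 2.
have zr r : r \in ra -> z != r.
  move=> rs; apply: contra hz => /eqP ->; exact: (allP ca).
exists S; last first.
  rewrite RE // raddfD /= raddf_sum /= Im_conj -sumX -big_split /= /S mulr_sumr.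
  rewrite big_seq [RHS]big_seq; apply: eq_bigr => r rs.
  have rX : X r \is Num.real by apply: ler0_real; exact: (hX r rs).1.
  have zr0 : z - r != 0 by rewrite subr_eq0 zr.
  have -> : 2 * 'i * X r * (r / (z - r)) = 'i * (X r * ((z + r) / (z - r) - 1)).
    have -> : (z + r) / (z - r) - 1 = 2 * (r / (z - r)) by field.
    ring.
  rewrite ImMil ReMl // raddfB /= Re_cayley ?zr //; last by apply/eqP/(allP ca).
  rewrite (Creal_ReP 1 _) ?rpred1 //; ring.
rewrite /S big_seq lt0r; apply/andP; split; last first.
  apply: sumr_ge0 => r rs; rewrite divr_ge0 ?exprn_ge0 // oppr_ge0; exact: (hX r rs).1.
rewrite psumr_eq0; last first.
  move=> r rs; rewrite divr_ge0 ?exprn_ge0 // oppr_ge0; exact: (hX r rs).1.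
apply/negP => /allP H.
have : \sum_(r <- ra) X r = 0.
  rewrite big1_seq // => r /= rs; have := H r rs; rewrite rs /= mulf_eq0 invr_eq0.
  by rewrite expf_eq0 /= normr_eq0 subr_eq0 (negbTE (zr r rs)) orbF oppr_eq0 => /eqP.
by move/eqP; rewrite sumX oppr_eq0 gt_eqF // Im_lam_gt0.
Qed.

Lemma ImR_gt0 z : `|z| < 1 -> 0 < 'Im (lam^* * (b.[z] / a.[z])).
Proof.
move=> hz; have [|S S0 ->] := @ImR z; first by rewrite lt_eqF.
by rewrite mulr_gt0 // subr_gt0 expr_lt1.
Qed.

(** At such a point conj(lam) b / a equals lam, which lies in the upper half plane; outside the disc
    [ImR] would put it in the lower one. *)
Lemma root_b1_disc c : b.[c] = lam ^+ 2 * a.[c] -> `|c| <= 1.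
Proof.
move=> hc; have [->//|c1] := eqVneq `|c| 1.
have [S S0 e] := ImR c1.
have ac : a.[c] != 0 by apply: outside_circle.
move: e; rewrite hc mulfK // expr2 mulrA [lam^* * _]mulrC unitC_conj // mul1r => e.
have := Im_lam_gt0; rewrite e pmulr_lgt0 // subr_gt0 => h1.
by rewrite -(@expr_le1 _ 2) // ltW.
Qed.

End ImR.

(** * The Pell equation *)

Section Pell.
Variable C : numClosedFieldType.
Implicit Types (p d : {poly C}).

Definition quad (rho lam : C) : {poly C} := ('X - (rho / lam)%:P) * ('X - (rho * lam)%:P).

(* Differentiating p^2 - K X^m = Q d^2 gives p (2 X p' - m p) = d (X Q' d + 2 X Q d' - m Q d); as d
   is prime to p, it divides the first factor, and the quotient is m (X + rho). *)
Definition cheb_ode m (rho lam : C) p d :=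
  2 *: ('X * p^`()) - m%:R *: p = m%:R *: (('X + rho%:P) * d) /\
  m%:R *: (('X + rho%:P) * p) =
    'X * (quad rho lam)^`() * d + 2 *: ('X * quad rho lam * d^`()) - m%:R *: (quad rho lam * d).

Lemma quadE rho lam : lam != 0 -> quad rho lam =
  'X ^+ 2 - (rho * (lam + lam^-1)) *: 'X + (rho ^+ 2)%:P.
Proof.
move=> l0; have -> : rho ^+ 2 = (rho / lam) * (rho * lam) by field.
have -> : rho * (lam + lam^-1) = rho / lam + rho * lam by rewrite mulrDr addrC.
rewrite /quad -mul_polyC; move: (rho / lam) (rho * lam) => u v.
by rewrite polyCD polyCM; ring.
Qed.

Lemma coefXder p n : ('X * p^`())`_n = n%:R * p`_n.
Proof. by rewrite coefXM; case: n => [|n] /=; rewrite ?mul0r // coef_deriv mulr_natl. Qed.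

Lemma coefXaddM rho p n : (('X + rho%:P) * p)`_n = (if n == 0 then 0 else p`_n.-1) + rho * p`_n.
Proof. by rewrite mulrDl coefD coefXM coefCM. Qed.

(** The coefficients of the differences P and D are compared from the top down. If everything above
    vanishes, the coefficient of X^n in the first equation and that of X^(n+1) in the second give
    (2n - m) P_n = m D_(n-1) and m P_n = (2n - m) D_(n-1), hence 4 n (m - n) P_n = 0. Monicity
    starts the descent at n = m, and the constant term of the first equation ends it. *)
Lemma cheb_ode_uniq m rho lam p d p2 d2 : (0 < m)%N -> lam != 0 ->
  cheb_ode m rho lam p d -> cheb_ode m rho lam p2 d2 ->
  size p = m.+1 -> size p2 = m.+1 -> size d = m -> size d2 = m ->
  p \is monic -> p2 \is monic -> d \is monic -> d2 \is monic -> p = p2.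
Proof.
move=> m0 l0 [i1 i2] [j1 j2] sp sp2 sd sd2 mp mp2 md md2.
pose P := p - p2; pose D := d - d2.
have e1 : 2 *: ('X * P^`()) - m%:R *: P = m%:R *: (('X + rho%:P) * D).
  rewrite /P /D derivB !mulrBr !scalerBr -i1 -j1.
  rewrite -!mul_polyC; ring.
have e2 : m%:R *: (('X + rho%:P) * P) = 'X * (quad rho lam)^`() * D +
   2 *: ('X * quad rho lam * D^`()) - m%:R *: (quad rho lam * D).
  rewrite /P /D derivB !mulrBr !scalerBr i2 j2.
  rewrite -!mul_polyC; ring.
have m0' : (m%:R : C) != 0 by rewrite pnatr_eq0 -lt0n.
have c1 n : (2 * n%:R - m%:R) * P`_n = m%:R * ((if n == 0 then 0 else D`_n.-1) + rho * D`_n).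
  have := congr1 (fun f : {poly C} => f`_n) e1.
  rewrite /= coefB !coefZ coefXder coefXaddM => <-; ring.
have c2 n : (forall j, (n < j)%N -> P`_j = 0) -> (forall j, (n <= j)%N -> D`_j = 0) -> (0 < n)%N ->
   m%:R * P`_n = (2 * n%:R - m%:R) * D`_n.-1.
  case: n => // n hP hD _; have := congr1 (fun f : {poly C} => f`_n.+2) e2.
  rewrite coefZ coefXaddM /= (hP n.+2) // mulr0 addr0 => ->.
  have -> : 'X * (quad rho lam)^`() * D = 'X * ((2 *: 'X - (rho * (lam + lam^-1))%:P) * D).
    rewrite mulrA quadE // derivD derivC derivB derivZ derivX derivXn /= addr0.
    by congr ('X * (_ - _) * _); rewrite ?alg_polyC // expr1 scaler_nat.
  have E f : (quad rho lam * f)`_n.+2 = f`_n - rho * (lam + lam^-1) * f`_n.+1 + rho ^+ 2 * f`_n.+2.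
    rewrite quadE // mulrDl mulrBl !coefD coefN coefCM -scalerAl coefZ coefXM /= coefXnM /=.
    by rewrite subSS subSS subn0.
  rewrite !coefD coefN !coefZ coefXM /= mulrBl coefB coefCM -scalerAl coefZ coefXM /=.
  have -> : 'X * quad rho lam * D^`() = quad rho lam * ('X * D^`()) by ring.
  rewrite !E !coefXder (hD n.+1) // (hD n.+2) // !mulr0 -[n.+1]addn1 natrD {1 2 3}/D !coefD; ring.
have main n : (0 < n)%N -> P`_n = 0 /\ D`_n.-1 = 0.
  have big j : (m <= j)%N -> P`_j = 0 /\ D`_j.-1 = 0.
    rewrite leq_eqVlt => /orP[/eqP <-|hj].
      have top (f : {poly C}) k : size f = k -> f \is monic -> f`_k.-1 = 1.
        by move=> <- /monicP; rewrite lead_coefE.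
      have pm := top _ _ sp mp; have pm2 := top _ _ sp2 mp2; rewrite /= in pm pm2.
      by rewrite !coefB pm pm2 (top _ _ sd md) (top _ _ sd2 md2) !subrr.
    split; first by rewrite coefB !nth_default ?subrr // ?sp ?sp2.
    by rewrite coefB !nth_default ?subrr // ?sd ?sd2 -ltnS prednK // (leq_trans _ hj).
  have [k hk] : exists k, (m <= n + k)%N by exists m; rewrite leq_addl.
  elim: k n hk => [|k IH] n hk n0; first by apply: big; rewrite addn0 in hk.
  have [hm|hm] := leqP m n; first exact: big.
  have up j : (n < j)%N -> P`_j = 0 /\ D`_j.-1 = 0.
    elim: j => // j IHj; rewrite ltnS leq_eqVlt => /orP[/eqP <-|hj].
      by apply: IH => //; rewrite addSnnS.
    have [h1|h1] := leqP m j.+1; first exact: big.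
    by apply: IH => //; apply: leq_trans hk _; rewrite addSnnS leq_add2r ltnW.
  have hP j : (n < j)%N -> P`_j = 0 by move/up => [].
  have hD j : (n <= j)%N -> D`_j = 0 by move=> hj; have [] := up j.+1 hj.
  have a1 := c2 n hP hD n0; have a2 := c1 n.
  rewrite (hD n) // mulr0 addr0 eqn0Ngt n0 /= in a2.
  have : (4 * n%:R * (m%:R - n%:R)) * P`_n = 0.
    have -> : 4 * n%:R * (m%:R - n%:R) * P`_n =
      m%:R * (m%:R * P`_n) - (2 * n%:R - m%:R) * ((2 * n%:R - m%:R) * P`_n) by ring.
    by rewrite a1 a2; ring.
  have nn : 4 * n%:R * (m%:R - n%:R) != 0 :> C.
    by rewrite !mulf_neq0 ?pnatr_eq0 -?lt0n // -natrB ?(ltnW hm) // pnatr_eq0 -lt0n subn_gt0.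
  move/eqP; rewrite mulf_eq0 (negbTE nn) /= => /eqP P0; split => //.
  by move: a2; rewrite P0 mulr0 => /esym/eqP; rewrite mulf_eq0 (negbTE m0') => /eqP.
apply/eqP; rewrite -subr_eq0 -/P; apply/eqP/polyP => -[|n]; rewrite coef0; last by have [] := main n.+1.
have D0 : D`_0 = 0 by have [] := main 1%N.
have := c1 0%N; rewrite /= D0 !mulr0 addr0 mulr0 sub0r => /eqP.
by rewrite mulf_eq0 oppr_eq0 (negbTE m0') => /eqP.
Qed.

Section Derive.
Variables (m : nat) (rp rd : seq C) (rho lam K : C).
Hypotheses (m_gt0 : (0 < m)%N) (sp : size rp = m) (sd : size rd = m.-1).
Hypotheses (cd : circle rd) (ud : uniq rd) (K0 : K != 0) (rho0 : rho != 0).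
Let p := rpoly rp.
Let d := rpoly rd.
Hypothesis H : p ^+ 2 - K *: 'X^m = quad rho lam * d ^+ 2.
Hypothesis Hp0 : p.[0] = - rho * d.[0].

Lemma pell_ode : cheb_ode m rho lam p d.
Proof.
pose S := 2 *: ('X * p^`()) - m%:R *: p.
have m0' : (m%:R : C) != 0 by rewrite pnatr_eq0 -lt0n.
have hX : 'X * ('X^m)^`() = m%:R *: 'X^m :> {poly C}.
  by rewrite derivXn mulrnAr -exprS prednK // scaler_nat.
have pS : p * S = d * ('X * (quad rho lam)^`() * d + 2 *: ('X * quad rho lam * d^`()) - m%:R *: (quad rho lam * d)).
  transitivity ('X * (p ^+ 2 - K *: 'X^m)^`() - m%:R *: (p ^+ 2 - K *: 'X^m)).
    rewrite derivB derivZ /S [p ^+ 2]expr2 derivM.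
    have E A B : 'X * (A - K *: B) = 'X * A - K *: ('X * B) :> {poly C}.
      by rewrite mulrBr scalerAr.
    rewrite E hX -!mul_polyC; ring.
  rewrite H derivM expr2 derivM /S -!mul_polyC; ring.
(* A common zero c of d and p would give K c^m = 0, although c lies on the circle. *)
have rt c : c \in rd -> root S c.
  move=> cs; have dc : d.[c] = 0 by apply/eqP; rewrite -/(root d c) root_rpoly.
  have := congr1 (fun f => f.[c]) pS; rewrite !hornerM dc mul0r => /eqP.
  rewrite mulf_eq0 => /orP[/eqP pc|//]; exfalso.
  have := congr1 (fun f => f.[c]) H; rewrite hornerM horner_exp dc expr0n mulr0 /=.
  rewrite hornerD hornerN hornerZ hornerXn horner_exp pc expr0n sub0r => /eqP.
  rewrite oppr_eq0 mulf_eq0 (negbTE K0) expf_eq0 /= => /andP[_ /eqP c0].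
  by have := allP cd _ cs; rewrite c0 normr0 eq_sym oner_eq0.
have dS : d %| S.
  rewrite /d /rpoly; apply: uniq_roots_dvdp; first by apply/allP.
  by rewrite uniq_rootsE.
have [g hg] : exists g, S = g * d by apply/dvdpP.
have Sm : S`_m = m%:R.
  by rewrite /S coefB !coefZ coefXder coef_rpoly_size //; ring.
have sS : size S = m.+1.
  apply/eqP; rewrite eqn_leq; apply/andP; split.
    apply/leq_sizeP => j hj; rewrite /S coefB !coefZ coefXder nth_default ?mulr0 ?subrr //.
    by rewrite size_rpoly sp.
  by rewrite ltnNge; apply/negP => /leq_sizeP /(_ m (leqnn _)); rewrite Sm => /eqP; rewrite (negbTE m0').
have S0 : S != 0 by rewrite -size_poly_eq0 sS.
have md : d \is monic by apply: monic_rpoly.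
have g0 : g != 0 by apply: contraNneq S0 => e; rewrite hg e mul0r.
have sg : size g = 2%N.
  have := sS; rewrite hg size_Mmonic // size_rpoly sd prednK // => /eqP.
  rewrite -subn1 => /eqP e; have : (size g + m = m.+2)%N by move: e; case: (size g + m)%N => // n; rewrite subn1 => /= ->.
  by move/eqP; rewrite -[m.+2]add2n eqn_add2r => /eqP.
have gE : g = (g`_0)%:P + g`_1 *: 'X.
  by apply/polyP => i; rewrite coefD coefC coefZ coefX; case: i => [|[|i]] /=;
    rewrite ?mulr0 ?addr0 ?add0r ?mulr1 // nth_default // sg.
have g1 : g`_1 = m%:R.
  have : lead_coef S = m%:R by rewrite lead_coefE sS.
  by rewrite hg lead_coef_Mmonic // lead_coefE sg.
have d00 : d.[0] != 0 by rewrite -normr_gt0 norm_rpoly0 // ltr01.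
(* The quotient g is linear; [Hp0] gives its constant term, since S(0) = - m p(0) = m rho d(0). *)
have g00 : g`_0 = m%:R * rho.
  have := congr1 (fun f => f.[0]) hg; rewrite /= hornerM -horner_coef0 /S.
  rewrite hornerD hornerN !hornerZ hornerM hornerX mul0r mulr0 sub0r Hp0 => e.
  by apply: (mulIf d00); rewrite -e; ring.
have SE : S = m%:R *: (('X + rho%:P) * d).
  by rewrite hg gE g00 g1 polyCM -!mul_polyC; ring.
split; first exact: SE.
have d0 : d != 0 by apply: monic_neq0.
by apply: (mulfI d0); rewrite -pS SE -!mul_polyC; ring.
Qed.
End Derive.
End Pell.

(** * The curve over the unit circle *)

Section Boundary.
Variable C : numClosedFieldType.

Lemma real_sqr_le0 (d y : C) : d ^+ 2 = y -> y <= 0 -> d^* = - d.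
Proof.
move=> e y0; have ry := ler0_real y0.
have : (d^* - d) * (d^* + d) = 0.
  have -> : (d^* - d) * (d^* + d) = d^* ^+ 2 - d ^+ 2 by ring.
  by rewrite -rmorphXn /= e (CrealP ry) subrr.
move/eqP; rewrite mulf_eq0 => /orP[]; rewrite ?subr_eq0 ?addr_eq0 => /eqP // e1.
have d0 : d = 0.
  apply/eqP; rewrite -sqrf_eq0 e eq_le y0 -e expr2 -{2}e1 -normCK.
  by rewrite exprn_ge0.
by rewrite d0 rmorph0 oppr0.
Qed.

(** After division by u everything except q is real, and d = q / u - f satisfies d^2 = al be. If al
    be <= 0, then d is imaginary or 0 and |q|^2 = f^2 - d^2 = h^2. If al be > 0, then d is real, the
    condition on the real part gives d al >= 0, and f al >= 0 makes f and d agree in sign; hence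
    |q|^2 = (f + d)^2 >= f^2 - d^2 = h^2. *)
Lemma level_boundary (h u f al be w q p a K : C) : 0 < h ->
  f \is Num.real -> al \is Num.real -> be \is Num.real -> `|u| = 1 -> `|w| = 1 ->
  p = u * f -> a = u * w^* * al -> K = u ^+ 2 ->
  f ^+ 2 - al * be = h ^+ 2 -> (al * be <= 0) || (0 <= f * al) ->
  q ^+ 2 - 2 * p * q + h ^+ 2 * K = 0 ->
  0 <= 'Re ((q - p) * a^* * w^*) -> 0 <= 'Im ((q - p) * a^* * w^*) ->
  h <= `|q|.
Proof.
move=> h0 rf ral rbe u1 w1 -> -> -> hh hor.
have uu := unitC_conj u1; have ww := unitC_conj w1.
have u0 := unitC_neq0 u1.
pose q' := u^* * q; have -> : q = u * q' by rewrite /q' mulrA uu mul1r.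
rewrite normrM u1 mul1r.
have -> : (u * q' - u * f) * (u * w^* * al)^* * w^* = (q' - f) * al.
  rewrite !rmorphM /= conjCK (CrealP ral).
  transitivity ((u * u^*) * (w * w^*) * ((q' - f) * al)); first by ring.
  by rewrite uu ww !mul1r.
move=> e re im.
have e1 : (q' - f) ^+ 2 = al * be.
  have u2 : u ^+ 2 != 0 by rewrite expf_neq0.
  apply: (mulfI u2); rewrite -[LHS]subr0 -e -hh; ring.
have rab : al * be \is Num.real by rewrite rpredM.
rewrite -(@ler_pXn2r _ 2) ?nnegrE ?(ltW h0) // normCK -hh.
move: (q' - f) (subrK f q') e1 re im => d <- e1 re im; rewrite rmorphD /= (CrealP rf).
case: (real_ge0P rab) hor => [ab0 /=|ab0 _]; last first.
  rewrite (real_sqr_le0 e1 (ltW ab0)) -e1.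
  by have -> : (d + f) * (- d + f) = f ^+ 2 - d ^+ 2 by ring.
case: (eqVneq (al * be) 0) => [ab00 _|abn /=].
  move/eqP: e1; rewrite ab00 expf_eq0 /= => /eqP ->.
  by rewrite rmorph0 !add0r subr0 expr2.
rewrite le_eqVlt (negbTE abn) (le_gtF ab0) /= => hfa.
have al0 : al != 0 by apply: contra abn => /eqP ->; rewrite mul0r.
have rd : d^* = d.
  have : (d^* - d) * (d^* + d) = 0.
    have -> : (d^* - d) * (d^* + d) = d^* ^+ 2 - d ^+ 2 by ring.
    by rewrite -rmorphXn /= e1 (CrealP rab) subrr.
  move/eqP; rewrite mulf_eq0 => /orP[]; rewrite ?subr_eq0 ?addr_eq0 => /eqP // e2.
  have : d ^+ 2 <= 0 by rewrite expr2 -[X in X * _]opprK -e2 mulNr oppr_le0 mulrC -normCK exprn_ge0.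
  rewrite e1 => H; have: al * be = 0 by apply/eqP; rewrite eq_le H ab0.
  by move/eqP; rewrite (negbTE abn).
have rd' : d \is Num.real by apply/CrealP.
have dal : 0 <= d * al.
  by move: re; rewrite (Creal_ReP _ _) // rpredM.
have fd : 0 <= f * d.
  have al2 : 0 < al ^+ 2 by rewrite real_exprn_even_gt0.
  rewrite -(pmulr_lge0 _ al2).
  have -> : f * d * al ^+ 2 = (f * al) * (d * al) by ring.
  by rewrite mulr_ge0.
rewrite rd -e1 -subr_ge0.
have -> : (d + f) * (d + f) - (f ^+ 2 - d ^+ 2) = 2 * d ^+ 2 + 2 * (f * d) by ring.
by rewrite addr_ge0 // mulr_ge0 // e1.
Qed.

End Boundary.

Local Open Scope complex_scope.
Import ComplexField.Normc.

(** * The minimum principle *)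

Local Notation re := (@complex.Re _).
Local Notation im := (@complex.Im _).

Section Cont.
Variables (R : realType) (T : topologicalType).
Implicit Types f g : T -> R[i].

(** Stated for the two parts separately, because the points of the curve are given by four real
    coordinates and all constraints on them are real. *)
Definition ccont f := continuous (fun v => re (f v)) /\ continuous (fun v => im (f v)).

Lemma ccont_cst (c : R[i]) : ccont (fun=> c).
Proof. by split; exact: cst_continuous. Qed.

Lemma ccontD f g : ccont f -> ccont g -> ccont (fun v => f v + g v).
Proof.
move=> [f1 f2] [g1 g2]; split => v.
- rewrite (_ : (fun v => re (f v + g v)) = (fun v => re (f v) + re (g v))).
    by apply: cvgD; [apply: f1 | apply: g1].
  by apply/funext => x; rewrite raddfD.
- rewrite (_ : (fun v => im (f v + g v)) = (fun v => im (f v) + im (g v))).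
    by apply: cvgD; [apply: f2 | apply: g2].
  by apply/funext => x; rewrite raddfD.
Qed.

Lemma ccontM f g : ccont f -> ccont g -> ccont (fun v => f v * g v).
Proof.
move=> [f1 f2] [g1 g2]; split => v.
- rewrite (_ : (fun v => re (f v * g v)) =
     (fun v => re (f v) * re (g v) - im (f v) * im (g v))).
    by apply: cvgB; apply: cvgM; [apply: f1 | apply: g1 | apply: f2 | apply: g2].
  by apply/funext => x /=; case: (f x) => a b; case: (g x) => c d.
- rewrite (_ : (fun v => im (f v * g v)) =
     (fun v => re (f v) * im (g v) + im (f v) * re (g v))).
    by apply: cvgD; apply: cvgM; [apply: f1 | apply: g2 | apply: f2 | apply: g1].
  by apply/funext => x /=; case: (f x) => a b; case: (g x) => c d.
Qed.

Lemma ccontC f : ccont f -> ccont (fun v => (f v)^*).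
Proof.
move=> [f1 f2]; split => v.
- rewrite (_ : (fun v => re (f v)^*) = (fun v => re (f v))); first exact: f1.
  by apply/funext => x; case: (f x).
- rewrite (_ : (fun v => im (f v)^*) = (fun v => - im (f v))).
    by apply: cvgN; exact: f2.
  by apply/funext => x; case: (f x).
Qed.

Lemma ccont_horner (p : {poly R[i]}) f : ccont f -> ccont (fun v => p.[f v]).
Proof.
move=> hf; elim/poly_ind: p => [|p c IH].
  rewrite (_ : (fun v => _) = (fun=> 0)); first exact: ccont_cst.
  by apply/funext => v; rewrite horner0.
rewrite (_ : (fun v => _) = (fun v => p.[f v] * f v + c)).
  by apply: ccontD; [apply: ccontM | apply: ccont_cst].
by apply/funext => v; rewrite hornerMXaddC.
Qed.

End Cont.

Section Nrm.
Variable R : realType.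
Local Notation C := R[i].
Definition nsq (z : C) : R := re z ^+ 2 + im z ^+ 2.

Lemma nsqE z : (nsq z)%:C = `|z| ^+ 2.
Proof. exact: add_Re2_Im2. Qed.

Lemma normCE (z : C) : `|z| = (normc z)%:C.
Proof. by case: z. Qed.

Lemma nsq_normc z : nsq z = normc z ^+ 2.
Proof. by apply: complexI; rewrite nsqE normCE rmorphXn. Qed.

Lemma normc_ge0 (z : C) : 0 <= normc z.
Proof. by case: z => x y; rewrite sqrtr_ge0. Qed.

Lemma Re_le_normc (z : C) : `|re z| <= normc z.
Proof. by rewrite -lecR -normCE normc_ge_Re. Qed.

Lemma Im_le_normc (z : C) : `|im z| <= normc z.
Proof.
case: z => x y /=; rewrite -[X in X <= _]sqrtr_sqr ler_wsqrtr // lerDr sqr_ge0 //.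
Qed.

Lemma root_near_normc (f : {poly C}) (z0 z1 : C) (r : R) m : f != 0 -> 0 < r ->
  (size f <= m.+1)%N ->
  (forall x, root f x -> r <= normc (x - z0)) ->
  normc f.[z1] <= normc f.[z0] * (1 + normc (z1 - z0) / r) ^+ m.
Proof.
move=> f0 r0 sf H; have := @root_near _ f z0 z1 r%:C f0; rewrite -[X in X < _]/(0%:C).
rewrite ltcR => /(_ r0) K.
have {}K : `|f.[z1]| <= `|f.[z0]| * (1 + `|z1 - z0| / r%:C) ^+ (size f).-1.
  by apply: K => x /H; rewrite normCE lecR.
rewrite !normCE -fmorphV -rmorphM -[1]/(1%:C) -rmorphD -rmorphXn -rmorphM lecR in K.
apply: le_trans K _; rewrite ler_wpM2l ?normc_ge0 // ler_weXn2l //.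
  by rewrite lerDl divr_ge0 ?normc_ge0 // ltW.
by case: (size f) sf => //= n; apply: leq_trans.
Qed.
End Nrm.

Section Min.
Variable R : realType.
Local Notation C := R[i].
Lemma conjE (z : C) : Num.conj z = z^*.
Proof. by []. Qed.
Lemma ReC (z : C) : 'Re z = (re z)%:C. Proof. by rewrite complexRe. Qed.
Lemma ImC (z : C) : 'Im z = (im z)%:C. Proof. by rewrite complexIm. Qed.

Local Notation T := ((R * R) * (R * R))%type.
Definition zc (v : T) : C := v.1.1 +i* v.1.2.
Definition qc (v : T) : C := v.2.1 +i* v.2.2.

Lemma ccont_zc : ccont zc.
Proof.
split => v; rewrite /zc /=.
  by apply: (@continuous_comp _ _ _ fst fst); [apply: cvg_fst | apply: cvg_fst].
by apply: (@continuous_comp _ _ _ fst snd); [apply: cvg_fst | apply: cvg_snd].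
Qed.

Lemma ccont_qc : ccont qc.
Proof.
split => v; rewrite /qc /=.
  by apply: (@continuous_comp _ _ _ snd fst); [apply: cvg_snd | apply: cvg_fst].
by apply: (@continuous_comp _ _ _ snd snd); [apply: cvg_snd | apply: cvg_snd].
Qed.

Lemma cont_pos_near (g : T -> R) (v0 : T) : continuous g -> 0 < g v0 ->
  exists2 r : R, 0 < r & forall v, normc (zc v - zc v0) < r ->
    normc (qc v - qc v0) < r -> 0 < g v.
Proof.
move=> cg g0.
have : nbhs v0 [set v | 0 < g v]%classic.
  by apply: (cg v0 [set x | 0 < x]%classic); apply: lt_nbhsr.
move/nbhs_ballP => [r r0 H]; exists r => [|v hz hq]; first exact: r0; apply: H.
have h1 := le_lt_trans (Re_le_normc _) hz; have h2 := le_lt_trans (Im_le_normc _) hz.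
have h3 := le_lt_trans (Re_le_normc _) hq; have h4 := le_lt_trans (Im_le_normc _) hq.
by split; split; rewrite /ball /= distrC.
Qed.

(** The set is cut out by continuous inequalities, hence closed, and the bound K makes it compact.
    An equation enters as two opposite inequalities. *)
Lemma compact_minimum (P : (T -> R) -> Prop) (g : T -> R) (K : R) v1 :
  (forall f, P f -> continuous f) -> continuous g ->
  (forall v, (forall f, P f -> 0 <= f v) -> normc (zc v) <= K /\ normc (qc v) <= K) ->
  (forall f, P f -> 0 <= f v1) ->
  exists2 v0, (forall f, P f -> 0 <= f v0) &
    forall v, (forall f, P f -> 0 <= f v) -> g v0 <= g v.
Proof.
move=> cP cg bK h1.
pose A := [set v : T | forall f, P f -> 0 <= f v]%classic.
have clA : closed A.
  rewrite (_ : A = \bigcap_(f in P) (f @^-1` [set x | 0 <= x]))%classic.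
    apply: closed_bigI => f Pf.
    apply: closed_comp; last exact: closed_ge.
    by move=> v _; apply: cP.
  by apply/seteqP; split.
pose I := `[(-K), K]%classic.
have cI : compact I by apply: segment_compact.
have cA : compact A.
  apply: (@subclosed_compact _ _ ((I `*` I) `*` (I `*` I))%classic) => //.
    by apply: compact_setX; apply: compact_setX.
  move=> v /bK[b1 b2].
  have a1 := le_trans (Re_le_normc _) b1; have a2 := le_trans (Im_le_normc _) b1.
  have a3 := le_trans (Re_le_normc _) b2; have a4 := le_trans (Im_le_normc _) b2.
  by split; split; rewrite /I /= in_itv /= -ler_norml.
have A0 : (A !=set0)%classic by exists v1.
have [|v0 v0A H] := @compact_EVT_min _ _ g A A0 cA.
- by apply: continuous_subspaceT.
- rewrite inE in v0A; exists v0 => // v vA; apply: H; exact/mem_set.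
Qed.
End Min.

Section MinP.
Variable R : realType.
Local Notation C := R[i].
Local Notation T := ((R * R) * (R * R))%type.
Variables (m : nat) (rp ra rb : seq C) (h : R) (w : C).
Hypotheses (m_gt0 : (0 < m)%N) (sp : size rp = m) (sa : size ra = m) (sb : size rb = m).
Hypotheses (cp : circle rp) (ca : circle ra) (cb : circle rb) (ua : uniq ra).
Hypotheses (h_gt0 : 0 < h) (w1 : `|w| = 1) (Rew : 0 < 'Re w) (Imw : 0 < 'Im w).
Let lam := w ^+ 2.
Let p := rpoly rp.
Let a := rpoly ra.
Let b := rpoly rb.
Let kap := p.[0].
Hypotheses (Hab : p ^+ 2 - (h%:C ^+ 2 * kap) *: 'X^m = a * b).
Hypotheses (Ha0 : kap = lam * a.[0]).
Hypothesis Hres : forall r, r \in ra ->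
  exists2 x : C, x <= 0 & b.[r] = 2 * 'i * x * lam * r * a^`().[r].
Hypothesis Hcirc : forall z : C, `|z| = 1 -> exists u f al be : C,
  [/\ [/\ f \is Num.real, al \is Num.real & be \is Num.real],
      [/\ `|u| = 1, p.[z] = u * f, a.[z] = u * w^* * al & kap * z ^+ m = u ^+ 2],
      f ^+ 2 - al * be = h%:C ^+ 2 & (al * be <= 0) || (0 <= f * al)].
Hypothesis h_lt2 : h < 2.

Let h_gt0' : 0 < h%:C. Proof. by rewrite -[0]/(0%:C) ltcR. Qed.
Let kap1' : normc kap = 1.
Proof. by apply: complexI; rewrite -normCE; apply: kap1. Qed.
Let lam1' : `|lam| = 1. Proof. exact: lam1 w1. Qed.

(* The curve PhiP q z = 0 over the disc; restricting nu to the first quadrant selects a branch of it,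
   along which |q| has no interior minimum other than q = 2 kap. *)
Let PhiP (q : C) : {poly C} := (q ^+ 2)%:P - (2 * q) *: p + (h%:C ^+ 2 * kap) *: 'X^m.
Let nu (v : T) : C := (qc v - p.[zc v]) * (a.[zc v])^* * w^*.
Let good v := [/\ normc (zc v) <= 1, (PhiP (qc v)).[zc v] = 0, 0 <= re (nu v) & 0 <= im (nu v)].

Lemma PhiPE q z : (PhiP q).[z] = q ^+ 2 - 2 * p.[z] * q + h%:C ^+ 2 * kap * z ^+ m.
Proof. rewrite /PhiP !hornerE; ring. Qed.

Lemma ccont_nu : ccont nu.
Proof.
have cz := @ccont_zc R; have cq := @ccont_qc R.
have cN f : ccont f -> ccont (fun v : T => - f v).
  move=> hf; rewrite (_ : (fun v => _) = (fun v => (-1) * f v)).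
    by apply: ccontM => //; apply: ccont_cst.
  by apply/funext => v; rewrite mulN1r.
apply: ccontM; last exact: ccont_cst.
apply: ccontM; last by apply: ccontC; apply: ccont_horner.
by apply: ccontD => //; apply: cN; apply: ccont_horner.
Qed.

Lemma ccont_Phi : ccont (fun v : T => (PhiP (qc v)).[zc v]).
Proof.
have cz := @ccont_zc R; have cq := @ccont_qc R.
rewrite (_ : (fun v => _) = (fun v => qc v * qc v + (-2) * (p.[zc v] * qc v)
   + (h%:C ^+ 2 * kap) *('X^m).[zc v])); last first.
  by apply/funext => v; rewrite PhiPE hornerXn; ring.
apply: ccontD; last by apply: ccontM; [apply: ccont_cst | apply: ccont_horner].
apply: ccontD; first by apply: ccontM.
apply: ccontM; first by apply: ccont_cst.
by apply: ccontM => //; apply: ccont_horner.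
Qed.

(* On the curve nu^2 = |a|^2 b a^* lam^*, so by ImR_gt0 nu^2 is never real and nu stays off the axes. *)
Lemma nu_pos v : good v -> normc (zc v) < 1 -> 0 < re (nu v) /\ 0 < im (nu v).
Proof.
move=> [_ hP hr hi] hz.
have hz' : `|zc v| < 1 by rewrite normCE -[1]/(1%:C) ltcR.
have := ImR_gt0 m_gt0 sa sb ca ua w1 Rew Imw Hab Ha0 Hres hz'.
have a0 : a.[zc v] != 0.
  have := @outside_circle C ra (zc v) ca; rewrite lt_eqF //; exact.
rewrite -/a -/b -/lam => H.
have E : nu v ^+ 2 = `|a.[zc v]| ^+ 4 * (lam^* * (b.[zc v] / a.[zc v])).
  have e1 : (qc v - p.[zc v]) ^+ 2 = a.[zc v] * b.[zc v].
    have := congr1 (fun f => f.[zc v]) Hab; rewrite /= hornerM => <-.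
    rewrite !hornerE; apply/eqP; rewrite -subr_eq0 -hP PhiPE; apply/eqP; ring.
  rewrite /nu !exprMn e1 /lam rmorphXn /= -[4%N]/(2 * 2)%N exprM normCK.
  move: (a.[zc v]^*) => a'; rewrite !conjE; move: (w^*) => w'.
  by field.
have : 0 < 'Im (nu v ^+ 2).
  rewrite E ImMl ?rpredX ?normr_real // mulr_gt0 // exprn_gt0 // normr_gt0 //.
rewrite ImC -[0]/(0%:C) ltcR.
have -> : im (nu v ^+ 2) = re (nu v) * im (nu v) * 2.
  by case: (nu v) => x y /=; ring.
rewrite pmulr_lgt0 // => H2.
have [r0 i0] : re (nu v) != 0 /\ im (nu v) != 0.
  by split; apply: contraTneq H2 => ->; rewrite ?mul0r ?mulr0 ltxx.
by rewrite !lt0r r0 i0.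
Qed.

Lemma size_PhiP q : (size (PhiP q) <= m.+1)%N.
Proof.
apply: leq_trans (size_polyD _ _) _; rewrite geq_max; apply/andP; split; last first.
  by apply: leq_trans (size_scale_leq _ _) _; rewrite size_polyXn.
apply: leq_trans (size_polyD _ _) _; rewrite geq_max size_polyN; apply/andP; split.
  by apply: leq_trans (size_polyC_leq1 _) _.
by apply: leq_trans (size_scale_leq _ _) _; rewrite size_rpoly sp.
Qed.

(** On the curve q = 0 forces z = 0, the other point over 0 being q = 2 kap. There nu = - w, which
    is not in the first quadrant. *)
Lemma qc_neq0 v : good v -> qc v != 0.
Proof.
move=> [hz hP hr hi]; apply/negP => /eqP q0.
move: hP; rewrite PhiPE q0 expr0n /= mulr0 subrr add0r => /eqP.
have k0 : kap != 0 by apply/negP => /eqP k0; move: kap1'; rewrite k0 normc0 => /eqP; rewrite eq_sym oner_eq0.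
have h0 : h%:C != 0 by rewrite gt_eqF.
have hk : h%:C ^+ 2 * kap != 0 by rewrite mulf_neq0 // expf_neq0.
rewrite mulf_eq0 (negbTE hk) /= expf_eq0 m_gt0 /= => /eqP z0.
move: hr; rewrite /nu q0 z0 sub0r -/kap.
have ww : w * w^* = 1 by have := unitC_conj w1; rewrite conjE.
have a00 : a.[0] * (a.[0])^* = 1.
  by have := normCK a.[0]; rewrite norm_rpoly0 // expr1n => ->.
have -> : - kap * (a.[0])^* * w^* = - w.
  rewrite Ha0 /lam; transitivity (- ((a.[0] * (a.[0])^*) * (w * w^*) * w)).
    by move: (a.[0]^*) (w^*) => ? ?; ring.
  by rewrite a00 ww !mul1r.
move: Rew; rewrite ReC -[0]/(0%:C) ltcR; case: (w) => x y /= hx; rewrite oppr_ge0.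
by rewrite leNgt hx.
Qed.

Lemma PhiP0 q : (PhiP q).[0] = q * (q - 2 * kap).
Proof. by rewrite PhiPE expr0n gtn_eqF // mulr0 addr0 -/kap; ring. Qed.

Lemma normcR (x : R) : normc x%:C = `|x|.
Proof. by rewrite /= expr0n addr0 sqrtr_sqr. Qed.

(** Shrink q to q' = (1 - d) q and look for a point of the curve over q' close to z0. The polynomial
    [PhiP q'] is of order d at z0, whereas its value q' (q' - 2 kap) at 0 stays away from 0 because
    q is neither 0 nor 2 kap; so [root_near_normc] yields a root near z0. The quadrant condition
    survives because it is strict over the open disc. *)
Lemma perturb v0 : good v0 -> normc (zc v0) < 1 -> qc v0 != 2 * kap ->
  exists2 v, good v & normc (qc v) < normc (qc v0).
Proof.
move=> g0 z1 qk; have [n1 n2] := nu_pos g0 z1; have q0 := qc_neq0 g0.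
have [c1 c2] := ccont_nu.
have [r1 r1p H1] := cont_pos_near c1 n1.
have [r2 r2p H2] := cont_pos_near c2 n2.
have z1p : 0 < 1 - normc (zc v0) by rewrite subr_gt0.
pose r3 := 1 - normc (zc v0); have r3p : 0 < r3 by [].
clear z1p.
pose r := Num.min r1 (Num.min r2 r3).
have rp0 : 0 < r by rewrite !lt_min r1p r2p r3p.
set z0 := zc v0 in g0 z1 r3 r3p r r1p r2p rp0 H1 H2 *; set q := qc v0 in qk q0 g0 H1 H2 *.
pose Q := normc q; have Qp : 0 < Q.
  by rewrite lt0r normc_ge0 andbT; apply: contra q0 => /eqP /eq0_normc ->.
pose D := normc (q - 2 * kap); have Dp : 0 < D.
  rewrite lt0r normc_ge0 andbT; apply: contra qk => /eqP /eq0_normc /eqP.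
  by rewrite subr_eq0.
pose M := (1 + normc (0 - z0) / r) ^+ m.
have Mp : 0 < M by rewrite exprn_gt0 // ltr_wpDr // divr_ge0 ?normc_ge0 // ltW.
pose K1 := normc (2 * p.[z0] * q - 2 * q ^+ 2) + Q ^+ 2.
have K1p : 0 < K1 by rewrite ltr_wpDl ?normc_ge0 // exprn_gt0.
(* Each summand of E secures one of the smallness conditions [d1] to [d4] on d = 1 / E. *)
pose E := 2 + 2 * Q / D + Q / r + 4 * K1 * M / (Q * D).
have [t1 t2 t3] : [/\ 0 < 2 * Q / D, 0 < Q / r & 0 < 4 * K1 * M / (Q * D)].
  by split; rewrite !(divr_gt0, mulr_gt0).
have Ep : 0 < E by rewrite /E !addr_gt0.
pose d := E^-1; have dp : 0 < d by rewrite invr_gt0.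
have d1 : d < 2^-1 by rewrite ltf_pV2 ?posrE // /E; lra.
have small x : x < E -> d * x < 1.
  by move=> hx; rewrite mulrC ltr_pdivrMr // mul1r.
have d2 : d * (2 * Q) < D.
  have : d * (2 * Q / D) < 1 by apply: small; rewrite /E; lra.
  by rewrite mulrA ltr_pdivrMr // mul1r.
have d3 : d * Q < r.
  have : d * (Q / r) < 1 by apply: small; rewrite /E; lra.
  by rewrite mulrA ltr_pdivrMr // mul1r.
have d4 : 4 * (d * K1 * M) < Q * D.
  have : d * (4 * K1 * M / (Q * D)) < 1 by apply: small; rewrite /E; lra.
  rewrite [d * _]mulrA ltr_pdivrMr ?mulr_gt0 // mul1r; apply: le_lt_trans.
  by rewrite le_eqVlt; apply/orP; left; apply/eqP; ring.
pose q' := (1 - d)%:C * q.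
have nq' : normc q' = (1 - d) * Q.
  by rewrite normcM normcR ger0_norm // subr_ge0; lra.
have P0 : (PhiP q').[0] != 0 /\ Q * D / 4 <= normc (PhiP q').[0].
  suff X : Q * D / 4 <= normc (PhiP q').[0].
    split => //; apply/eqP => e; move: X; rewrite e normc0.
    by rewrite leNgt divr_gt0 ?mulr_gt0.
  rewrite PhiP0 normcM nq'.
  have X1 : D / 2 <= normc (q' - 2 * kap).
    have : D <= normc (q' - 2 * kap) + normc (d%:C * q).
      rewrite /D; have -> : q - 2 * kap = (q' - 2 * kap) + d%:C * q.
        rewrite /q' rmorphB rmorph1; ring.
      exact: le_normcD.
    rewrite normcM normcR gtr0_norm // -/Q; lra.
  have -> : Q * D / 4 = (Q / 2) * (D / 2) by field.
  apply: ler_pM => //; first by rewrite divr_ge0 // ltW.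
  - by rewrite divr_ge0 // ltW.
  - by nra.
have [x rx xr] : exists2 x, root (PhiP q') x & normc (x - z0) < r.
  apply: contrapT => Hn.
  have F0 : PhiP q' != 0 by apply/eqP => e; move: P0.1; rewrite e horner0 eqxx.
  have HR x : root (PhiP q') x -> r <= normc (x - z0).
    by move=> rx; rewrite leNgt; apply/negP => hx; apply: Hn; exists x.
  have := root_near_normc 0 F0 rp0 (size_PhiP _) HR.
  - apply/negP; rewrite -ltNge; apply: lt_le_trans P0.2.
    rewrite ltr_pdivlMr //; apply: le_lt_trans d4; rewrite mulrC ler_pM2l // -/M.
    rewrite ler_wpM2r ?(ltW Mp) //.
    have -> : (PhiP q').[z0] = d%:C * (2 * p.[z0] * q - 2 * q ^+ 2 + d%:C * q ^+ 2).
      have [_ + _ _] := g0; rewrite -/q -/z0 !PhiPE => e.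
      apply/eqP; rewrite -subr_eq0 -[X in _ == X]e /q' rmorphB rmorph1; apply/eqP.
      ring.
    rewrite normcM normcR gtr0_norm // ler_pM2l // /K1.
    apply: le_trans (le_normcD _ _) _; rewrite lerD2l normcM normcR gtr0_norm // expr2 normcM -expr2 -/Q.
    by rewrite ler_piMl ?sqr_ge0 //; lra.
pose v : T := ((re x, im x), (re q', im q')).
have zv : zc v = x by rewrite /zc /v; case: (x).
have qv : qc v = q' by rewrite /qc /v; case: (q').
have dz : normc (zc v - z0) < r by rewrite zv.
have dq : normc (qc v - q) < r.
  rewrite qv; have -> : q' - q = (- d)%:C * q by rewrite /q' rmorphB rmorph1 rmorphN; ring.
  by rewrite normcM normcR normrN gtr0_norm.
move: dz dq; rewrite !lt_min => /and3P[z_1 z_2 z_3] /and3P[q_1 q_2 q_3].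
exists v; last by rewrite qv nq' -/Q gtr_pMl //; lra.
split.
- rewrite zv -[x](subrK z0); apply: le_trans (le_normcD _ _) _.
  by move: z_3; rewrite zv /r3; lra.
- by rewrite zv qv; apply/eqP.
- by apply: ltW; apply: H1.
- by apply: ltW; apply: H2.
Qed.

Lemma good_boundary v : good v -> normc (zc v) = 1 -> h <= normc (qc v).
Proof.
move=> [_ hP hr hi] hz.
have hz' : `|zc v| = 1 by rewrite normCE hz.
have [u [f [al [be [[rf ral rbe] [u1 pu au ku] e hor]]]]] := Hcirc hz'.
rewrite -lecR -normCE.
apply: (level_boundary (u := u) (f := f) (al := al) (be := be) (w := w) (p := p.[zc v])
  (a := a.[zc v]) (K := kap * zc v ^+ m)) => //.
- by rewrite mulrA -PhiPE.
- by rewrite ReC -[0]/(0%:C) lecR.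
- by rewrite ImC -[0]/(0%:C) lecR.
Qed.

Lemma normc_2kap : normc (2 * kap) = 2.
Proof. by rewrite normcM kap1' mulr1 -[2 : C](rmorph_nat (real_complex R) 2) normcR normr_nat. Qed.

(** By compactness |q| has a minimum over the good points where it does not exceed its value at v1.
    By [perturb] that minimum is attained over the circle, where |q| >= h, or at q = 2 kap, where
    |q| = 2 > h. *)
Lemma good_ge v1 : good v1 -> h <= normc (qc v1).
Proof.
move=> g1.
have [P1 P2] := ccont_Phi; have [N1 N2] := ccont_nu.
have [Z1 Z2] := @ccont_zc R; have [Q1 Q2] := @ccont_qc R.
have cZ : continuous (fun v : T => nsq (zc v)).
  by move=> v; apply: cvgD; rewrite !expr2; apply: cvgM; [apply: Z1|apply: Z1|apply: Z2|apply: Z2].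
have cQ : continuous (fun v : T => nsq (qc v)).
  by move=> v; apply: cvgD; rewrite !expr2; apply: cvgM; [apply: Q1|apply: Q1|apply: Q2|apply: Q2].
(* The two pairs of opposite signs encode the equation of the curve; the last function keeps |q|
   bounded. *)
pose fs : 'I_8 -> T -> R := fun i v => nth 0 [:: 1 - nsq (zc v); re (PhiP (qc v)).[zc v];
  - re (PhiP (qc v)).[zc v]; im (PhiP (qc v)).[zc v]; - im (PhiP (qc v)).[zc v];
  re (nu v); im (nu v); nsq (qc v1) - nsq (qc v)] i.
pose P f := exists i, f = fs i.
have sq1 (z : C) (x : R) : 0 <= x -> (nsq z <= x ^+ 2) = (normc z <= x).
  by move=> x0; rewrite nsq_normc ler_pXn2r // nnegrE normc_ge0.
have PP v : (forall f, P f -> 0 <= f v) <-> good v /\ normc (qc v) <= normc (qc v1).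
  split=> [H|[[g2 g3 g4 g5] g6] f [i ->]].
    have {}H i : 0 <= fs i v by apply: H; exists i.
    have := (H (inord 0), H (inord 1), H (inord 2), H (inord 3)).
    have := (H (inord 4), H (inord 5), H (inord 6), H (inord 7)).
    rewrite /fs !inordK //= => -[[[a4 a5] a6] a7] [[[a0 a1] a2] a3].
    split; [split|] => //.
    - by rewrite -(sq1 _ 1 ler01) expr1n -subr_ge0.
    - apply/eqP; rewrite eq_complex /= !eq_le a1 a3 -oppr_ge0 a2 -oppr_ge0 a4 //.
    - rewrite -[X in X <= _]/(normc (qc v)) -[X in _ <= X]/(normc (qc v1)).
      by rewrite -(sq1 _ _ (normc_ge0 _)) -nsq_normc -subr_ge0.
  case: i => -[|[|[|[|[|[|[|[|]]]]]]]] //= hi; rewrite /fs /= ?g3 /= ?oppr0 // subr_ge0.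
    by rewrite -(expr1n _ 2) sq1 ?ler01.
  by rewrite [X in _ <= X]nsq_normc sq1 // normc_ge0.
have [||v /PP[[zv _ _ _] qv]||v0 /PP[g0 q0] H] :=
    @compact_minimum R P (fun v => nsq (qc v)) (1 + normc (qc v1)) v1.
- move=> f [[i hi] ->] v.
  case: i hi => [|[|[|[|[|[|[|[|]]]]]]]] //= hi; rewrite /fs /=.
  + by apply: cvgB; [apply: cvg_cst | apply: cZ].
  + by apply: cvgN; apply: P1.
  + by apply: cvgN; apply: P2.
  + by apply: cvgB; [apply: cvg_cst | apply: cQ].
- exact: cQ.
- split; first by apply: le_trans zv _; rewrite lerDl normc_ge0.
  by apply: le_trans qv _; rewrite lerDr.
- by apply/PP.
apply: le_trans (q0).
have [z0 _ _ _] := g0.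
move: z0; rewrite le_eqVlt => /orP[/eqP z0|z0]; first exact: good_boundary.
have [e|qk] := eqVneq (qc v0) (2 * kap); first by rewrite e normc_2kap ltW.
have [v gv lv] := perturb g0 z0 qk.
have : nsq (qc v0) <= nsq (qc v).
  by apply: H; apply/PP; split => //; apply: le_trans (ltW lv) q0.
by rewrite [X in _ <= X]nsq_normc sq1 ?normc_ge0 // leNgt lv.
Qed.

(** Strictness over the open disc is what puts the roots of b1 on the circle in the case of
    equality. *)
Lemma good_gt v : good v -> normc (zc v) < 1 -> h < normc (qc v).
Proof.
move=> gv zv; have [e|qk] := eqVneq (qc v) (2 * kap); first by rewrite e normc_2kap.
have [v' gv' lv] := perturb gv zv qk.
exact: le_lt_trans (good_ge gv') lv.
Qed.

(** The point (c, p + lam a) lies on the curve because b = lam^2 a at c, and on the chosen branch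
    because nu = |a|^2 w there. *)
Lemma min_principle c : `|c| <= 1 -> b.[c] = lam ^+ 2 * a.[c] ->
  h%:C <= `|p.[c] + lam * a.[c]| /\ (`|c| < 1 -> h%:C < `|p.[c] + lam * a.[c]|).
Proof.
move=> c1 hb; pose q := p.[c] + lam * a.[c].
pose v : T := ((re c, im c), (re q, im q)).
have zv : zc v = c by rewrite /zc /v; case: (c).
have qv : qc v = q by rewrite /qc /v; case: (q).
have gv : good v.
  have nuE : nu v = `|a.[c]| ^+ 2 * w.
    rewrite /nu zv qv /q normCK.
    have := unitC_conj w1; rewrite conjE; move: (w^*) => w' hw.
    have -> : (p.[c] + lam * a.[c] - p.[c]) * (a.[c])^* * w' = (w * w') * (a.[c] * (a.[c])^* * w).
      by rewrite /lam; move: (a.[c]^*) => ?; ring.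
    by rewrite hw mul1r.
  have [r0 i0] : 0 <= re w /\ 0 <= im w.
    by move: Rew Imw; rewrite ReC ImC -[0]/(0%:C) !ltcR => /ltW ? /ltW.
  split.
  - by rewrite zv -lecR -normCE.
  - have e : p.[c] ^+ 2 - h%:C ^+ 2 * kap * c ^+ m = a.[c] * (lam ^+ 2 * a.[c]).
      by have := congr1 (fun f => f.[c]) Hab; rewrite [RHS]hornerM hb => <-; rewrite !hornerE.
    rewrite zv qv PhiPE /q; apply/eqP; rewrite -subr_eq0 subr0.
    have -> : h%:C ^+ 2 * kap * c ^+ m = p.[c] ^+ 2 - a.[c] * (lam ^+ 2 * a.[c]).
      by rewrite -e; ring.
    by apply/eqP; ring.
  - by rewrite nuE -nsqE; case: (w) r0 => x y /= ?; rewrite mul0r subr0 mulr_ge0 // addr_ge0 ?sqr_ge0.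
  - by rewrite nuE -nsqE; case: (w) i0 => x y /= ?; rewrite mul0r addr0 mulr_ge0 // addr_ge0 ?sqr_ge0.
split; first by rewrite -/q normCE lecR -qv good_ge.
by move=> c1'; rewrite -/q normCE ltcR -qv good_gt // zv -ltcR -normCE.
Qed.

End MinP.

(** * The inequality for the level and its case of equality *)

Lemma prodr_ge_exp (C : numDomainType) (s : seq C) (f : C -> C) (x : C) : 0 < x ->
  (forall c, c \in s -> x <= f c) -> x ^+ size s <= \prod_(c <- s) f c.
Proof.
move=> x0; elim: s => [|c s IH] H; first by rewrite big_nil.
rewrite big_cons exprS ler_pM ?exprn_ge0 ?(ltW x0) //; first by apply: H; rewrite mem_head.
by apply: IH => d ds; apply: H; rewrite in_cons ds orbT.
Qed.

Lemma prodr_eq_exp (C : numDomainType) (s : seq C) (f : C -> C) (x : C) : 0 < x ->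
  (forall c, c \in s -> x <= f c) -> \prod_(c <- s) f c = x ^+ size s ->
  forall c, c \in s -> f c = x.
Proof.
move=> x0 H e c cs.
have H' d : d \in rem c s -> x <= f d by move=> /mem_rem; apply: H.
have := prodr_ge_exp x0 H'; have xn : 0 < x ^+ size (rem c s) by rewrite exprn_gt0.
move=> le; have fc := H _ cs; apply/eqP; rewrite eq_le fc andbT.
move: e; rewrite (big_rem c) //= => e.
have s0 : (0 < size s)%N by rewrite -has_predT; apply/hasP; exists c.
rewrite -(ler_pM2r (lt_le_trans xn le)) e -[in X in X <= _](prednK s0) exprS.
by rewrite ler_pM2l // -(size_rem cs).
Qed.

Section Final.
Variable R : realType.
Local Notation C := R[i].
Variables (m : nat) (rp ra rb : seq C) (h : R) (w : C).
Hypotheses (m_gt0 : (0 < m)%N) (sp : size rp = m) (sa : size ra = m) (sb : size rb = m).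
Hypotheses (cp : circle rp) (ca : circle ra) (cb : circle rb) (ua : uniq ra).
Hypotheses (h_gt0 : 0 < h) (w1 : `|w| = 1) (Rew : 0 < 'Re w) (Imw : 0 < 'Im w).
Let lam := w ^+ 2.
Let p := rpoly rp.
Let a := rpoly ra.
Let b := rpoly rb.
Let kap := p.[0].
Hypotheses (Hab : p ^+ 2 - (h%:C ^+ 2 * kap) *: 'X^m = a * b).
Hypotheses (Ha0 : kap = lam * a.[0]).
Hypothesis Hres : forall r, r \in ra ->
  exists2 x : C, x <= 0 & b.[r] = 2 * 'i * x * lam * r * a^`().[r].
Hypothesis Hcirc : forall z : C, `|z| = 1 -> exists u f al be : C,
  [/\ [/\ f \is Num.real, al \is Num.real & be \is Num.real],
      [/\ `|u| = 1, p.[z] = u * f, a.[z] = u * w^* * al & kap * z ^+ m = u ^+ 2],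
      f ^+ 2 - al * be = h%:C ^+ 2 & (al * be <= 0) || (0 <= f * al)].
Hypothesis h_lt2 : h < 2.

Let h_gt0' : 0 < h%:C. Proof. by rewrite -[0]/(0%:C) ltcR. Qed.
Let b1 : {poly C} := (1 - lam ^+ 2)^-1 *: (b - lam ^+ 2 *: a).
Let lam2 : 1 - lam ^+ 2 != 0. Proof. exact: lam2_neq1. Qed.
Let lam1 : `|lam| = 1. Proof. exact: lam1 w1. Qed.

(** Self-reciprocity turns the hypotheses into b(c) = |lam|^4 a(c) = a(c), while b(c) = lam^2 a(c)
    and lam^2 is not 1. Arbitrary lists are allowed so that the argument can be repeated after a
    common root has been removed. *)
Lemma circle_common_root s1 s2 c : circle s1 -> circle s2 -> size s1 = size s2 ->
  (rpoly s2).[0] = lam ^+ 2 * (rpoly s1).[0] -> `|c| = 1 ->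
  (rpoly s2).[c] = lam ^+ 2 * (rpoly s1).[c] -> root (rpoly s1) c.
Proof.
move=> c1 c2 ss e0 hc e; have h1 := conj_rpoly c1 hc; have h2 := conj_rpoly c2 hc.
have ll := unitC_conj lam1.
have : (1 - lam ^+ 2) * (rpoly s1).[c] = 0.
  rewrite mulrBl mul1r -e -{1}h1 -h2 e e0 ss rmorphM rmorphXn /=.
  move: (Num.conj lam) ll (Num.conj (rpoly s1).[c]) => l' ll A.
  transitivity ((1 - (lam * l') ^+ 2) * (A * (c ^+ size s2 * (rpoly s1).[0]))); first ring.
  by rewrite ll expr1n subrr mul0r.
by move/eqP; rewrite mulf_eq0 (negbTE lam2).
Qed.

Let b00 : b.[0] = lam ^+ 2 * a.[0].
Proof. by rewrite /b (Hb0 m_gt0 ca Hab Ha0) -/p -/kap Ha0 mulrA expr2. Qed.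

Lemma core_roots : exists rc : seq C, [/\ b1 = 'X * rpoly rc, size rc = m.-1,
  2 * \prod_(c <- rc) `|p.[c] + lam * a.[c]| = (h%:C / 'Im w) ^+ m &
  forall c, c \in rc -> [/\ `|c| <= 1, b.[c] = lam ^+ 2 * a.[c],
     h%:C <= `|p.[c] + lam * a.[c]| & `|c| < 1 -> h%:C < `|p.[c] + lam * a.[c]|]].
Proof.
have [sb1 mb1] := b1_monic sa sb w1 Rew Imw.
rewrite -/lam -/a -/b -/b1 in sb1 mb1.
have [rc0 hrc0] := closed_field_poly_normal b1.
rewrite (monicP mb1) scale1r -/(rpoly rc0) in hrc0.
have b10 : b1.[0] = 0 := b1_0 m_gt0 ca Hab Ha0.
have zr : 0 \in rc0 by rewrite -root_rpoly -hrc0; apply/eqP.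
exists (rem 0 rc0).
have e1 : b1 = 'X * rpoly (rem 0 rc0) by rewrite hrc0 (rpoly_divX zr) subr0.
have id := prod_norm_q_roots_b1 sp sa sb cp ca h_gt0' w1 Rew Imw Hab Ha0 hrc0.
split => //.
- by rewrite size_rem // -[size rc0]/(size rc0).+1.-1 -size_rpoly -hrc0 sb1.
(* The factor 2 is the value of |q| at the root 0 of b1. *)
- rewrite -id [RHS](big_rem 0) //=; congr (_ * _).
    have -> : (p + lam *: a).[0] = 2 * kap by rewrite hornerD hornerZ -Ha0 -/kap; ring.
    by rewrite normrM normr_nat (kap1 cp) mulr1.
  by apply: eq_bigr => c _; rewrite hornerD hornerZ.
- move=> c /mem_rem cr.
  have bc : b.[c] = lam ^+ 2 * a.[c].
    have : (1 - lam ^+ 2) * b1.[c] = 0.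
      by rewrite hrc0; move: cr; rewrite -root_rpoly => /eqP ->; rewrite mulr0.
    rewrite /b1 hornerZ mulrA divff // mul1r !hornerE => /eqP.
    by rewrite subr_eq0 => /eqP.
  have c1 := root_b1_disc m_gt0 sa sb ca ua w1 Rew Imw Hab Ha0 Hres bc.
  have [] := min_principle m_gt0 sp sa sb cp ca ua h_gt0 w1 Rew Imw Hab Ha0 Hres Hcirc h_lt2 c1 bc.
  by [].
Qed.

Lemma core_le : 2 * 'Im w ^+ m <= h%:C.
Proof.
have [rc [_ sc e H]] := core_roots.
have : h%:C ^+ m.-1 <= \prod_(c <- rc) `|p.[c] + lam * a.[c]|.
  by rewrite -sc; apply: prodr_ge_exp => // c /H[].
move=> le; have : 2 * h%:C ^+ m.-1 <= (h%:C / 'Im w) ^+ m by rewrite -e ler_pM2l.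
rewrite exprMn exprVn ler_pdivlMr ?exprn_gt0 // mulrAC.
have -> : h%:C ^+ m = h%:C * h%:C ^+ m.-1 by rewrite -exprS prednK.
by rewrite ler_pM2r // exprn_gt0.
Qed.

Lemma core_eq : h%:C = 2 * 'Im w ^+ m -> exists (rd : seq C) (r1 : C),
  [/\ uniq rd, size rd = m.-1, circle rd, `|r1| = 1 &
   a = ('X - r1%:P) * rpoly rd /\ b = ('X - (lam ^+ 2 * r1)%:P) * rpoly rd].
Proof.
move=> he; have [rc [hb1 sc e H]] := core_roots.
have pe : \prod_(c <- rc) `|p.[c] + lam * a.[c]| = h%:C ^+ size rc.
  have I0 : 'Im w ^+ m != 0 by rewrite expf_neq0 // gt_eqF.
  have n2 : (2 : C) != 0 by rewrite pnatr_eq0.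
  apply: (mulfI n2); rewrite e sc exprMn exprVn.
  apply: (mulIf I0); rewrite divfK //.
  have -> : h%:C ^+ m = h%:C * h%:C ^+ m.-1 by rewrite -exprS prednK.
  by rewrite {1}he; ring.
have ch c : c \in rc -> `|c| = 1.
  move=> cs; have [c1 _ _ c2] := H c cs.
  have hc : `|p.[c] + lam * a.[c]| = h%:C.
    by apply: (prodr_eq_exp h_gt0' _ pe) => // d /H[].
  by move: c1; rewrite le_eqVlt => /orP[/eqP //|/c2]; rewrite hc ltxx.
have rta c : c \in rc -> c \in ra.
  move=> cs; have [_ bc _ _] := H c cs.
  by rewrite -root_rpoly; apply: (circle_common_root (s2 := rb)); rewrite ?sa ?sb ?ch.
have rtb c : c \in rc -> c \in rb.
  move=> cs; have [_ bc _ _] := H c cs.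
  rewrite -root_rpoly /root -/b bc; move: (rta c cs).
  by rewrite -root_rpoly -/a => /eqP ->; rewrite mulr0.
have hb1' : (1 - lam ^+ 2) *: ('X * rpoly rc) = b - lam ^+ 2 *: a.
  by rewrite -hb1 /b1 scalerA divff // scale1r.
(* A double root c could be divided out of a, b and b1 once; [circle_common_root], applied to the
   quotients, would make it a double root of a. *)
have urc : uniq rc.
  have: forall c, c \in rc -> c \notin rem c rc.
    move=> c cs; apply/negP => cs2.
    have c0 : c != 0 by apply: unitC_neq0; apply: ch.
    have da := rpoly_divX (rta c cs); have db := rpoly_divX (rtb c cs).
    have dc := rpoly_divX cs.
    have e3 : (1 - lam ^+ 2) *: ('X * rpoly (rem c rc)) =
        rpoly (rem c rb) - lam ^+ 2 *: rpoly (rem c ra).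
      have X0 : ('X - c%:P) != 0 by rewrite polyXsubC_eq0.
      apply: (mulfI X0); rewrite -scalerAr mulrCA -dc hb1' /a /b da db.
      by rewrite mulrBr scalerAr.
    have e4 : (rpoly (rem c rb)).[c] = lam ^+ 2 * (rpoly (rem c ra)).[c].
      have := congr1 (fun f => f.[c]) e3; rewrite /= hornerZ hornerM.
      have -> : (rpoly (rem c rc)).[c] = 0 by apply/eqP; rewrite -/(root _ c) root_rpoly.
      by rewrite !mulr0 hornerD hornerN hornerZ => /eqP; rewrite eq_sym subr_eq0 => /eqP.
    have e5 : (rpoly (rem c rb)).[0] = lam ^+ 2 * (rpoly (rem c ra)).[0].
      have := congr1 (fun f => f.[0]) e3; rewrite /= hornerZ hornerM hornerX mul0r mulr0.
      by rewrite hornerD hornerN hornerZ => /eqP; rewrite eq_sym subr_eq0 => /eqP.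
    have : root (rpoly (rem c ra)) c.
      have cr s : circle s -> circle (rem c s).
        by move=> /allP hs; apply/allP => x /mem_rem; apply: hs.
      apply: (circle_common_root (s2 := rem c rb)) => //; try exact: cr; last exact: ch.
      by rewrite !size_rem ?rta ?rtb // sa sb.
    by rewrite root_rpoly mem_rem_uniq // !inE eqxx.
  clear; elim: rc => [|x s IH] H //=; apply/andP; split.
    by have := H x (mem_head _ _); rewrite /= eqxx.
  apply: IH => c cs; have := H c; rewrite in_cons cs orbT => /(_ isT) /=.
  by case: eqP => _; [rewrite cs | rewrite in_cons negb_or => /andP[]].
pose rest := [seq x <- ra | x \notin rc].
have pa : perm_eq ra (rest ++ rc).
  apply: uniq_perm => //.
    rewrite cat_uniq filter_uniq // urc andbT /=; apply/hasPn => x xs.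
    by rewrite /rest mem_filter xs.
  move=> x; rewrite mem_cat mem_filter; have := rta x.
  by case: (x \in rc) => /= [->//|_]; rewrite ?orbF.
have : size rest = 1%N.
  have := perm_size pa; rewrite size_cat sa sc => s.
  by apply/eqP; rewrite -(eqn_add2r m.-1) -s add1n prednK.
case hr : rest => [|r1 [|//]] // _.
have aE : a = ('X - r1%:P) * rpoly rc.
  by rewrite /a /rpoly (perm_big _ pa) hr big_cat big_seq1.
exists rc, r1; split => //.
- by apply/allP => c /ch ->.
- have : r1 \in rest by rewrite hr mem_head.
  by rewrite mem_filter => /andP[_ /(allP ca) /eqP].
- split => //.
  (* With d the common factor, b = (1 - lam^2) X d + lam^2 (X - r1) d, so the remaining root of b is
     lam^2 r1. *)
  apply/eqP; rewrite -[b](subrK (lam ^+ 2 *: a)) -hb1' aE; apply/eqP.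
  rewrite polyCM -!mul_polyC polyCB; ring.
Qed.

End Final.

End CirclePolynomials.

Module Extremal.
Import all_boot all_order all_algebra complex.
Import boolp classical_sets reals Rstruct.
Import mathcomp.algebra_tactics.ring mathcomp.algebra_tactics.lra mathcomp.zify.zify.
Import RiemannLevel CirclePolynomials.
Set Implicit Arguments. Unset Strict Implicit. Unset Printing Implicit Defensive.
Import Order.TTheory GRing.Theory Num.Theory.
Import ComplexField.Normc.
Local Open Scope ring_scope.
Local Open Scope complex_scope.
Local Notation C := (R[i]).
Bind Scope ring_scope with R.
#[local] Arguments cos _%_ring_scope.
#[local] Arguments sin _%_ring_scope.
#[local] Arguments acos _%_ring_scope.

(** * Level arcs of a trigonometric product *)

Definition cis (t : R) : C := cos t +i* sin t.

Lemma cis0 : cis 0 = 1.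
Proof. by rewrite /cis cos_0 sin_0. Qed.

Lemma cisD x y : cis (x + y) = cis x * cis y.
Proof.
rewrite /cis sinD cosD; apply/eqP; rewrite eq_complex /=; apply/andP; split; apply/eqP => //.
by rewrite addrC.
Qed.

Lemma sin2cos2_ring t : sin t ^+ 2 + cos t ^+ 2 = 1.
Proof. have := sin2_cos2 t; by rewrite /Rsqr. Qed.

Lemma normc_cis t : `|cis t| = 1.
Proof.
by rewrite normc_def /= addrC sin2cos2_ring sqrtr1.
Qed.

Lemma cis_neq0 t : cis t != 0.
Proof. by apply: unitC_neq0; apply: normc_cis. Qed.

Lemma cisN t : cis (- t) = (cis t)^*.
Proof. by rewrite /cis /= cos_neg sin_neg. Qed.

Lemma cis2n t : cis (t + t) = cis t ^+ 2.
Proof. by rewrite cisD expr2. Qed.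

Lemma cisB_half x y : cis x - cis y = cis ((x + y) / 2) * ('i * (2 * sin ((x - y) / 2))%:C).
Proof.
pose u := (x + y) / 2; pose v := (x - y) / 2.
have hx : x = u + v by rewrite /u /v; field.
have hy : y = u - v by rewrite /u /v; field.
rewrite -/u -/v {1}hx {1}hy !cisD cisN.
rewrite /cis; apply/eqP; rewrite eq_complex /=; apply/andP; split; apply/eqP; ring.
Qed.

Lemma cisD_half x y : cis x + cis y = cis ((x + y) / 2) * (2 * cos ((x - y) / 2))%:C.
Proof.
pose u := (x + y) / 2; pose v := (x - y) / 2.
have hx : x = u + v by rewrite /u /v; field.
have hy : y = u - v by rewrite /u /v; field.
rewrite -/u -/v {1}hx {1}hy !cisD cisN.
rewrite /cis; apply/eqP; rewrite eq_complex /=; apply/andP; split; apply/eqP; ring.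
Qed.

Lemma cis2PI : cis (2 * PI) = 1.
Proof. by rewrite /cis cos_2PI sin_2PI. Qed.

Lemma cis_period t : cis (t + 2 * PI) = cis t.
Proof. by rewrite cisD cis2PI mulr1. Qed.

Lemma sin_gt0' (x : R) : 0 < x -> x < PI -> 0 < sin x.
Proof. by move=> /RltP h1 /RltP h2; apply/RltP; apply: sin_gt_0. Qed.

Lemma sin_ge0' (x : R) : 0 <= x -> x <= PI -> 0 <= sin x.
Proof. by move=> /RleP h1 /RleP h2; apply/RleP; apply: sin_ge_0. Qed.

Lemma PI_gt0 : 0 < PI.
Proof. by apply/RltP; apply: PI_RGT_0. Qed.

Lemma cis_inj_window x y : x < y -> y < x + 2 * PI -> cis x != cis y.
Proof.
move=> h1 h2; rewrite -subr_eq0 cisB_half !mulf_neq0 ?cis_neq0 //.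
  by rewrite neq0Ci.
rewrite -[0]/(0%:C) (inj_eq (@complexI _)) mulf_neq0 ?pnatr_eq0 //.
have : 0 < sin ((y - x) / 2) by apply: sin_gt0'; lra.
have -> : (x - y) / 2 = - ((y - x) / 2) by field.
by rewrite sin_neg oppr_eq0 => /gt_eqF ->.
Qed.

Lemma cis_surj (z : C) : `|z| = 1 -> exists2 t : R, z = cis t & - PI <= t <= PI.
Proof.
case: z => x y; rewrite normc_def /= => -[] /(congr1 (fun t => t ^+ 2)).
rewrite sqr_sqrtr ?addr_ge0 ?sqr_ge0 // expr1n => hxy.
have hx : -1 <= x <= 1.
  rewrite -ler_norml -(@ler_pXn2r _ 2) ?nnegrE // expr1n real_normK ?num_real // -hxy lerDl.
  exact: sqr_ge0.
have hx' : Rle (-1) x /\ Rle x 1 by case/andP: hx => /RleP ? /RleP ?.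
have c := cos_acos x hx'.
have [/RleP b1' /RleP b2'] := acos_bound x; have p0 := PI_gt0.
have b1 : 0 <= acos x := b1'; have b2 : acos x <= PI := b2'.
have s2 : sin (acos x) ^+ 2 = y ^+ 2.
  have := sin2cos2_ring (acos x); rewrite c -hxy => /eqP.
  by rewrite addrC (inj_eq (addrI _)) => /eqP.
move/eqP: s2; rewrite eqf_sqr => /orP[/eqP s|/eqP s].
  exists (acos x); first by rewrite /cis c s.
  by apply/andP; split; lra.
exists (- acos x); first by rewrite /cis cos_neg sin_neg c s RoppE opprK.
by apply/andP; split; lra.
Qed.

Section F.
Variables (m : nat) (x : nat -> R).
Definition Ft (t : R) : R := \prod_(0 <= i < m) (2 * sin ((t - x i) / 2)).
Definition Sx : R := \sum_(0 <= i < m) x i.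
Definition cseq : seq C := [seq cis (x i) | i <- index_iota 0 m].
(** The unimodular factor relating p(e^(it)) to [Ft]; its square is p(0) e^(imt). *)
Definition ut (t : R) : C := cis ((m%:R * t + Sx) / 2) * 'i ^+ m.
End F.

Lemma size_cseq m x : size (cseq m x) = m.
Proof. by rewrite size_map size_iota subn0. Qed.

Lemma circle_cseq m x : circle (cseq m x).
Proof. by apply/allP => z /mapP [i _ ->]; rewrite normc_cis. Qed.

Lemma rpoly_cseqS m x : rpoly (cseq m.+1 x) = rpoly (cseq m x) * ('X - (cis (x m))%:P).
Proof. by rewrite /rpoly /cseq !big_map big_nat_recr. Qed.

Lemma rpoly_cis m x t : (rpoly (cseq m x)).[cis t] = ut m x t * (Ft m x t)%:C.
Proof.
elim: m => [|m IH].
  rewrite /rpoly /cseq /= ?big_map /ut /Ft /Sx !big_nil hornerC mul0r add0r mul0r.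
  by rewrite cis0 expr0 !mulr1.
rewrite rpoly_cseqS hornerM IH hornerXsubC cisB_half /ut /Ft /Sx !big_nat_recr //= exprS.
have -> : (m.+1%:R * t + (\sum_(0 <= i < m) x i + x m)) / 2 =
  (m%:R * t + \sum_(0 <= i < m) x i) / 2 + (t + x m) / 2.
  by rewrite -addn1 natrD; field.
rewrite cisD rmorphM /=; ring.
Qed.

Lemma norm_ut m x t : `|ut m x t| = 1.
Proof. by rewrite normrM normrX normc_cis normCi expr1n mulr1. Qed.

Lemma rpoly_cis0 m x : (rpoly (cseq m x)).[0] = (-1) ^+ m * cis (Sx m x).
Proof.
elim: m => [|m IH].
  by rewrite /rpoly /cseq /= ?big_map /Sx !big_nil hornerC cis0 mulr1.
rewrite rpoly_cseqS hornerM IH hornerXsubC /Sx big_nat_recr //= cisD exprS; ring.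
Qed.

Lemma ut_sqr m x t : ut m x t ^+ 2 = (rpoly (cseq m x)).[0] * cis t ^+ m.
Proof.
rewrite rpoly_cis0 /ut exprMn -cis2n -exprM mulnC exprM sqrCi.
have -> : (m%:R * t + Sx m x) / 2 + (m%:R * t + Sx m x) / 2 = m%:R * t + Sx m x by field.
have -> : cis (m%:R * t + Sx m x) = cis t ^+ m * cis (Sx m x).
  rewrite cisD; congr (_ * _); elim: m => [|m IH]; first by rewrite mul0r cis0 expr0.
  by rewrite -addn1 natrD mulrDl mul1r cisD IH addn1 exprSr.
ring.
Qed.

(** The second clause is [rpoly_cis] differentiated in t, as the logarithmic derivative of [ut] is i
    m / 2. It carries critical points of F and signs of derivatives over to the polynomials. *)
Lemma derivable_Ft m x t : exists f' : R, derivable_pt_lim (Ft m x) t f' /\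
  2 * ut m x t * f'%:C = 'i * (2 * cis t * (rpoly (cseq m x))^`().[cis t]
     - m%:R * (rpoly (cseq m x)).[cis t]).
Proof.
elim: m => [|m [f' [IH1 IH2]]].
  exists 0; split.
    have -> : Ft 0 x = fct_cte 1 by apply/funext => y; rewrite /Ft big_geq.
    exact: derivable_pt_lim_const.
  by rewrite /rpoly /cseq /= ?big_map big_nil derivC hornerC !mulr0 mul0r subrr mulr0.
exists (f' * (2 * sin ((t - x m) / 2)) + Ft m x t * cos ((t - x m) / 2)); split.
  have -> : Ft m.+1 x = mult_fct (Ft m x) (fun t => 2 * sin ((t - x m) / 2)).
    by apply/funext => y; rewrite /Ft big_nat_recr.
  apply: derivable_pt_lim_mult => //.
  have -> : cos ((t - x m) / 2) = 2 * (cos ((t - x m) / 2) * (1 * (1 / 2))) by field.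
  apply: (derivable_pt_lim_scal (fun t => sin ((t - x m) / 2))).
  apply: (derivable_pt_lim_comp (fun t => (t - x m) / 2) sin).
    have -> : (1 * (1 / 2) : R) = 1 / 2 - 0 by field.
    have -> : (fun t => (t - x m) / 2) = minus_fct (fun t => t / 2) (fct_cte (x m / 2)).
      by apply/funext => y; rewrite /minus_fct /fct_cte mulrBl.
    apply: derivable_pt_lim_minus; last exact: derivable_pt_lim_const.
    have -> : (1 / 2 : R) = 2^-1 * 1 by field.
    have -> : (fun t : R => t / 2) = (mult_real_fct 2^-1 id).
      by apply/funext => y; rewrite /mult_real_fct mulrC.
    by apply: derivable_pt_lim_scal; exact: derivable_pt_lim_id.
  exact: derivable_pt_lim_sin.
rewrite rpoly_cseqS derivM derivXsubC mulr1 hornerD !hornerM hornerXsubC.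
have hs : cis t - cis (x m) = cis ((t + x m) / 2) * ('i * (2 * sin ((t - x m) / 2))%:C) := cisB_half _ _.
have hc := cisD_half t (x m).
have hu : ut m.+1 x t = ut m x t * (cis ((t + x m) / 2) * 'i).
  rewrite /ut /Sx big_nat_recr //= exprS.
  have -> : (m.+1%:R * t + (\sum_(0 <= i < m) x i + x m)) / 2 =
    (m%:R * t + \sum_(0 <= i < m) x i) / 2 + (t + x m) / 2.
    by rewrite -addn1 natrD; field.
  rewrite cisD; ring.
have hp := rpoly_cis m x t.
set P := (rpoly (cseq m x)).[cis t] in hp IH2 *.
set P' := ((rpoly (cseq m x))^`()).[cis t] in IH2 *.
have -> : 2 * cis t * (P' * (cis t - cis (x m)) + P) - m.+1%:R * (P * (cis t - cis (x m))) =
  (cis t - cis (x m)) * (2 * cis t * P' - m%:R * P) + (cis t + cis (x m)) * P.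
  by rewrite -addn1 natrD; ring.
have E (a b y q j : C) : j * (a * y + b * q) = a * (j * y) + b * (j * q) by ring.
rewrite E -IH2 hs hc hp hu.
rewrite !rmorphD !rmorphM /=.
by rewrite [2%:C](_ : _ = 2) //; ring.
Qed.

Definition hs (y : R) : R := 2 * sin (y / 2).

Lemma hs_ge0 y : 0 <= y -> y <= 2 * PI -> 0 <= hs y.
Proof. by move=> h1 h2; rewrite /hs mulr_ge0 // sin_ge0' //; lra. Qed.

Lemma hsN y : hs (- y) = - hs y.
Proof. by rewrite /hs mulNr sin_neg RoppE mulrN. Qed.

Lemma hs_gt0 y : 0 < y -> y < 2 * PI -> 0 < hs y.
Proof. by move=> h1 h2; rewrite /hs mulr_gt0 // sin_gt0' //; lra. Qed.

Lemma hs_le0 y : - (2 * PI) <= y -> y <= 0 -> hs y <= 0.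
Proof. by move=> h1 h2; rewrite -[y]opprK hsN oppr_le0 hs_ge0 //; lra. Qed.

Lemma hs_lt0 y : - (2 * PI) < y -> y < 0 -> hs y < 0.
Proof. by move=> h1 h2; rewrite -[y]opprK hsN oppr_lt0 hs_gt0 //; lra. Qed.

Lemma FtE m x t : Ft m x t = \prod_(0 <= i < m) hs (t - x i).
Proof. by []. Qed.

Lemma Ft_mul m x y t : Ft m x t * Ft m y t = \prod_(0 <= i < m) (hs (t - x i) * hs (t - y i)).
Proof. by rewrite !FtE -big_split. Qed.

Lemma sum_nat_gt0 n (f : nat -> R) : (0 < n)%N -> (forall i, (i < n)%N -> 0 < f i) ->
  0 < \sum_(0 <= i < n) f i.
Proof.
move=> n0 hf; rewrite big_ltn // ltr_pwDl ?hf // big_nat; apply: sumr_ge0 => i /= /andP[_ hi].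
by rewrite ltW ?hf.
Qed.

Section Band.
Variables (m : nat) (phi aa bb : nat -> R) (h : R).
Hypothesis m_gt0 : (0 < m)%N.
Hypothesis Ha : forall j, (j < m)%N -> aa j < phi j.
Hypothesis Hb : forall j, (j < m)%N -> phi j < bb j.
Hypothesis Hg : forall j, (j < m)%N -> bb j <= aa j.+1.
Hypothesis Hper : aa m = aa 0%N + 2 * PI.
Let F := Ft m phi.
Hypothesis HFa : forall j, (j < m)%N -> F (aa j) ^+ 2 = h ^+ 2.
Hypothesis HFb : forall j, (j < m)%N -> F (bb j) ^+ 2 = h ^+ 2.
Hypothesis Hdeg : forall j, (j < m)%N -> bb j = aa j.+1 -> derivable_pt_lim F (bb j) 0.
Hypothesis h_gt0 : 0 < h.

Lemma aabb j : (j < m)%N -> aa j < bb j.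
Proof. by move=> hj; apply: lt_trans (Ha hj) (Hb hj). Qed.

Lemma aaS j : (j < m)%N -> aa j < aa j.+1.
Proof. by move=> hj; apply: lt_le_trans (aabb hj) (Hg hj). Qed.

Lemma aa_le i j : (i <= j)%N -> (j <= m)%N -> aa i <= aa j.
Proof.
elim: j => [|j IH]; first by rewrite leqn0 => /eqP ->.
rewrite leq_eqVlt => /orP[/eqP ->//|hi hj].
by apply: le_trans (IH hi (ltnW hj)) (ltW (aaS hj)).
Qed.

Lemma aa_lt i j : (i < j)%N -> (j <= m)%N -> aa i < aa j.
Proof.
by move=> hi hj; apply: lt_le_trans (aaS (leq_trans hi hj)) (aa_le hi hj).
Qed.

Lemma bb_le_aa i j : (i < j)%N -> (j <= m)%N -> bb i <= aa j.
Proof. by move=> hi hj; apply: le_trans (Hg (leq_trans hi hj)) (aa_le hi hj). Qed.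

(** Either t comes after band i and before its next translate, or before band i and after the
    previous one. In both cases hs (t - x) keeps one sign while x runs through the band. *)
Lemma gap_pos i j t : (i < m)%N -> (j < m)%N -> bb j <= t -> t <= aa j.+1 ->
  (bb i <= t <= aa i + 2 * PI) || (bb i - 2 * PI <= t <= aa i).
Proof.
move=> hi hj h1 h2; have a0 := aa_le (leq0n i) (ltnW hi).
have am := aa_le hj (leqnn m); have b0 := aabb hj; have a0' := aa_le (leq0n j) (ltnW hj).
have bm := bb_le_aa hi (leqnn m); have hp := Hper.
have [hij|hij] := leqP i j.
  have : bb i <= bb j.
    move: hij; rewrite leq_eqVlt => /orP[/eqP ->//|hij].
    by apply: le_trans (bb_le_aa hij (ltnW hj)) (ltW b0).
  by move=> ?; apply/orP; left; lra.
have := aa_le hij (ltnW hi) => ?; apply/orP; right; lra.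
Qed.

Lemma band_pos i j t : (i < m)%N -> (j < m)%N -> aa j <= t -> t <= bb j -> i != j ->
  (bb i <= t <= aa i + 2 * PI) || (bb i - 2 * PI <= t <= aa i).
Proof.
move=> hi hj h1 h2 hij; have a0 := aa_le (leq0n i) (ltnW hi).
have am := Hg hj; have am2 := aa_le hj (leqnn m); have a0' := aa_le (leq0n j) (ltnW hj).
have bm := bb_le_aa hi (leqnn m); have hp := Hper.
move: hij; rewrite neq_ltn => /orP[hij|hij].
  have ? := bb_le_aa hij (ltnW hj); apply/orP; left; lra.
have ? := bb_le_aa hij (ltnW hi); apply/orP; right; lra.
Qed.

Lemma pair_ge0 i t x y : (i < m)%N -> aa i <= x <= bb i -> aa i <= y <= bb i ->
  (bb i <= t <= aa i + 2 * PI) || (bb i - 2 * PI <= t <= aa i) ->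
  0 <= hs (t - x) * hs (t - y).
Proof.
move=> hi hx hy /orP[ht|ht].
  by apply: mulr_ge0; apply: hs_ge0; lra.
by apply: mulr_le0; apply: hs_le0; lra.
Qed.

Let aib i : (i < m)%N -> aa i <= aa i <= bb i.
Proof. by move=> hi; rewrite lexx ltW // aabb. Qed.
Let bib i : (i < m)%N -> aa i <= bb i <= bb i.
Proof. by move=> hi; rewrite lexx ltW // aabb. Qed.
Let pib i : (i < m)%N -> aa i <= phi i <= bb i.
Proof. by move=> hi; rewrite !ltW ?Ha ?Hb. Qed.

Lemma gap_FA j t : (j < m)%N -> bb j <= t -> t <= aa j.+1 -> 0 <= F t * Ft m aa t.
Proof.
move=> hj h1 h2; rewrite Ft_mul big_nat; apply: prodr_ge0 => i /= hi.
by apply: (pair_ge0 hi (pib hi) (aib hi)); apply: (gap_pos hi hj).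
Qed.

Lemma gap_AB j t : (j < m)%N -> bb j <= t -> t <= aa j.+1 -> 0 <= Ft m aa t * Ft m bb t.
Proof.
move=> hj h1 h2; rewrite Ft_mul big_nat; apply: prodr_ge0 => i /= hi.
by apply: (pair_ge0 hi (aib hi) (bib hi)); apply: (gap_pos hi hj).
Qed.

Lemma band_AB j t : (j < m)%N -> aa j <= t -> t <= bb j -> Ft m aa t * Ft m bb t <= 0.
Proof.
move=> hj h1 h2; rewrite Ft_mul (bigD1_seq j) /= ?mem_index_iota ?iota_uniq //.
have hb := Hg hj; have am := aa_le hj (leqnn m); have a0 := aa_le (leq0n j) (ltnW hj).
have hp := Hper.
apply: mulr_le0_ge0.
  by apply: mulr_ge0_le0; [apply: hs_ge0 | apply: hs_le0]; lra.
rewrite big_nat_cond; apply: prodr_ge0 => i /andP[/= hi hij].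
by apply: (pair_ge0 hi (aib hi) (bib hi)); apply: (band_pos hi hj).
Qed.

Lemma locate t : aa 0%N <= t -> t < aa 0%N + 2 * PI -> exists2 j, (j < m)%N & aa j <= t < aa j.+1.
Proof.
rewrite -Hper => h0; elim: (m) => [|n IH] hn; first by have := le_lt_trans h0 hn; rewrite ltxx.
have [h1|h1] := ltP t (aa n).
  by have [j hj1 hj2] := IH h1; exists j => //; apply: ltnW.
by exists n => //; rewrite h1.
Qed.

Let ra := cseq m aa.
Let rb := cseq m bb.
Let rp := cseq m phi.
Let kap := (rpoly rp).[0].
Let Pi : {poly C} := rpoly rp ^+ 2 - (h%:C ^+ 2 * kap) *: 'X^m.

Lemma Pi_cis t : Pi.[cis t] = ut m phi t ^+ 2 * (F t ^+ 2 - h ^+ 2)%:C.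
Proof.
rewrite /Pi hornerD hornerN hornerZ hornerXn horner_exp rpoly_cis rmorphB !rmorphXn /=.
by rewrite mulrBr -exprMn ut_sqr -/rp -/kap; congr (_ - _); ring.
Qed.

Lemma mem_cseq n (x : nat -> R) c : (c \in cseq n x) -> exists2 i, (i < n)%N & c = cis (x i).
Proof.
move=> H; have [i hi ->] := mapP H; exists i => //.
by move: hi; rewrite mem_index_iota.
Qed.

Lemma cis_in_cseq n (x : nat -> R) i : (i < n)%N -> cis (x i) \in cseq n x.
Proof. by move=> hi; apply: map_f; rewrite mem_index_iota. Qed.

Lemma uniq_cseq n (x : nat -> R) : (forall i j, (i < j)%N -> (j < n)%N -> x i < x j /\ x j < x i + 2 * PI) ->
  uniq (cseq n x).
Proof.
move=> hx; rewrite map_inj_in_uniq ?iota_uniq // => i j; rewrite !mem_index_iota /= => hi hj e.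
apply/eqP; apply: contraT; rewrite neq_ltn => /orP[hij|hij].
  by have [h1 h2] := hx _ _ hij hj; have := cis_inj_window h1 h2; rewrite e eqxx.
by have [h1 h2] := hx _ _ hij hi; have := cis_inj_window h1 h2; rewrite e eqxx.
Qed.

Lemma ua : uniq ra.
Proof.
apply: uniq_cseq => i j hij hj; have hp := Hper; split; first exact: aa_lt (ltnW hj).
have := aa_lt hj (leqnn m); have := aa_le (leq0n i) (ltnW (ltn_trans hij hj)); lra.
Qed.

Lemma ub : uniq rb.
Proof.
apply: uniq_cseq => i j hij hj; have hp := Hper; split.
  exact: le_lt_trans (bb_le_aa hij (ltnW hj)) (aabb hj).
have := bb_le_aa hj (leqnn m); have := aa_le (leq0n i) (ltnW (ltn_trans hij hj)).
have := aabb (ltn_trans hij hj); lra.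
Qed.

Lemma rootPi_a c : c \in ra -> root Pi c.
Proof. by move=> /mem_cseq [j hj ->]; rewrite /root Pi_cis HFa // subrr mulr0. Qed.

Lemma rootPi_b c : c \in rb -> root Pi c.
Proof. by move=> /mem_cseq [j hj ->]; rewrite /root Pi_cis HFb // subrr mulr0. Qed.

(** F touches the level with F' = 0 where two bands meet, so their common end point is a double root
    of Pi. *)
Lemma derivPi_deg j : (j < m)%N -> bb j = aa j.+1 -> Pi^`().[cis (bb j)] = 0.
Proof.
move=> hj e; have [f' [d1 d2]] := derivable_Ft m phi (bb j).
have f0 : f' = 0 by apply: (uniqueness_limite _ _ _ _ d1); apply: Hdeg.
move: d2; rewrite f0 !mulr0 => /esym/eqP; rewrite mulf_eq0 (negbTE (neq0Ci _)) /= -/rp.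
set z := cis (bb j); set p := rpoly rp; move=> /eqP S0.
have P0 : Pi.[z] = 0 by apply/eqP/rootPi_b/cis_in_cseq.
apply: (mulfI (cis_neq0 (bb j))); rewrite mulr0 -/z.
have -> : z * Pi^`().[z] = p.[z] * (2 * z * p^`().[z] - m%:R * p.[z]) + m%:R * Pi.[z].
  rewrite /Pi derivB derivZ derivXn expr2 derivM -/p !hornerD !hornerN !hornerZ !hornerMn !hornerM !hornerXn.
  have -> : z ^+ m = z * z ^+ m.-1 by rewrite -exprS prednK.
  ring.
by rewrite S0 P0 !mulr0 addr0.
Qed.

Lemma cis_ab i j : (i < m)%N -> (j < m)%N -> bb j < aa j.+1 -> cis (aa i) != cis (bb j).
Proof.
move=> hi hj h2; have hp := Hper.
have hb := aabb hj; have am := aa_le hj (leqnn m); have a0 := aa_le (leq0n i) (ltnW hi).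
have a0' := aa_le (leq0n j) (ltnW hj); have am' := aa_lt hi (leqnn m).
have [hij|hij] := leqP i j.
  by have ? := aa_le hij (ltnW hj); apply: cis_inj_window; lra.
by have ? := aa_le hij (ltnW hi); rewrite eq_sym; apply: cis_inj_window; lra.
Qed.

(** The 2m end points, shared ones counted twice, exhaust the degree of the monic polynomial Pi. A
    root common to a and b can only come from a degenerate gap, where [derivPi_deg] provides the
    second factor. *)
Lemma Pi_factor : Pi = rpoly ra * rpoly rb.
Proof.
have /dvdpP [T hT] : rpoly ra %| Pi.
  by apply: uniq_roots_dvdp; [apply/allP; exact: rootPi_a | rewrite uniq_rootsE ua].
have /dvdpP [U hU] : rpoly rb %| T.
  apply: uniq_roots_dvdp; last by rewrite uniq_rootsE ub.
  apply/allP => c cb; have := rootPi_b cb; rewrite hT rootM => /orP[//|].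
  rewrite root_rpoly => /mem_cseq [i hi ei]; have /mem_cseq [j hj ej] := cb.
  have e : bb j = aa j.+1.
    have := Hg hj; rewrite le_eqVlt => /orP[/eqP //|h2].
    by have := cis_ab hi hj h2; rewrite -ei -ej eqxx.
  have := derivPi_deg hj e; rewrite hT derivM hornerD !hornerM -ej.
  have -> : (rpoly ra).[c] = 0 by apply/eqP; rewrite -/(root _ c) root_rpoly ei; apply: cis_in_cseq.
  rewrite mulr0 add0r => /eqP; rewrite mulf_eq0 => /orP[//|].
  have ca : c \in ra by rewrite ei; apply: cis_in_cseq.
  rewrite deriv_rpoly // -/(root _ c) root_rpoly mem_rem_uniq ?ua // !inE eqxx //.
have mP : rpoly rp ^+ 2 \is monic by rewrite rpredX // monic_rpoly.
have sP : size (rpoly rp ^+ 2) = (m + m).+1.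
  by rewrite expr2 size_Mmonic ?monic_rpoly ?monic_neq0 ?monic_rpoly // size_rpoly size_cseq addnS.
have lt : (size (- ((h%:C ^+ 2 * kap) *: 'X^m)) < size (rpoly rp ^+ 2))%N.
  rewrite size_polyN sP ltnS; apply: leq_trans (size_scale_leq _ _) _.
  by rewrite size_polyXn -addn1 leq_add2l.
have mPi : Pi \is monic by rewrite /Pi monicE lead_coefDl // -monicE.
have sPi : size Pi = (m + m).+1 by rewrite /Pi size_polyDl.
have mAB : rpoly rb * rpoly ra \is monic by rewrite rpredM ?monic_rpoly.
have sAB : size (rpoly rb * rpoly ra) = (m + m).+1.
  by rewrite size_Mmonic ?monic_rpoly ?monic_neq0 ?monic_rpoly // !size_rpoly !size_cseq addnS.
have E : Pi = U * (rpoly rb * rpoly ra) by rewrite hT hU mulrA.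
have mU : U \is monic by move: mPi; rewrite E monicMr.
have sU : size U = 1%N.
  have := sPi; rewrite E size_Mmonic ?monic_neq0 // sAB addnS /= => /eqP.
  by rewrite -[X in _ == X]add1n eqn_add2r => /eqP.
have U1 : U = 1.
  have [u0 hu] := size_poly1P _ (introT eqP sU); move=> e; move: mU; rewrite e monicE lead_coefC => /eqP ->.
  by rewrite polyC1.
by rewrite E U1 mul1r mulrC.
Qed.

Definition band_len : R := Sx m bb - Sx m aa.

Lemma band_lenE : band_len = \sum_(0 <= i < m) (bb i - aa i).
Proof. by rewrite /band_len /Sx -sumrB. Qed.

Lemma band_len_gt0 : 0 < band_len.
Proof.
by rewrite band_lenE; apply: sum_nat_gt0 => // i hi; rewrite subr_gt0 aabb.
Qed.

Lemma band_len_le : band_len <= 2 * PI.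
Proof.
have -> : 2 * PI = aa m - aa 0%N by rewrite Hper; ring.
rewrite band_lenE -telescope_sumr // !big_nat; apply: ler_sum => i /= hi.
by rewrite lerD2r Hg.
Qed.

Let sg := Sx m phi - (Sx m aa + Sx m bb) / 2.

(** Each zero lies strictly inside its band, so sg is smaller in modulus than half the total length
    of the bands. *)
Lemma sg_small : `|sg| < PI.
Proof.
have l := band_len_le; rewrite ltr_norml.
suff : - (band_len / 2) < sg < band_len / 2 by move=> /andP[? ?]; apply/andP; split; lra.
have e1 : sg + band_len / 2 = \sum_(0 <= i < m) (phi i - aa i).
  by rewrite sumrB -!/(Sx _ _) /sg /band_len; field.
have e2 : band_len / 2 - sg = \sum_(0 <= i < m) (bb i - phi i).
  by rewrite sumrB -!/(Sx _ _) /sg /band_len; field.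
have p1 : 0 < \sum_(0 <= i < m) (phi i - aa i).
  by apply: sum_nat_gt0 => // i hi; rewrite subr_gt0 Ha.
have p2 : 0 < \sum_(0 <= i < m) (bb i - phi i).
  by apply: sum_nat_gt0 => // i hi; rewrite subr_gt0 Hb.
by rewrite -e1 in p1; rewrite -e2 in p2; lra.
Qed.

Lemma level_AB_sg t : (F t ^+ 2 - h ^+ 2)%:C = cis (- sg) * (Ft m aa t * Ft m bb t)%:C.
Proof.
have := congr1 (fun f => f.[cis t]) Pi_factor; rewrite /= Pi_cis hornerM !rpoly_cis.
have u0 : ut m phi t ^+ 2 != 0 by rewrite expf_neq0 // -normr_gt0 norm_ut ltr01.
have -> : ut m aa t * (Ft m aa t)%:C * (ut m bb t * (Ft m bb t)%:C) =
   ut m phi t ^+ 2 * (cis (- sg) * (Ft m aa t * Ft m bb t)%:C).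
  have e : ut m aa t * ut m bb t = ut m phi t ^+ 2 * cis (- sg).
    rewrite /ut exprMn -cis2n mulrACA -cisD [RHS]mulrAC -cisD -expr2; congr (cis _ * _).
    by rewrite /sg; field.
  by rewrite mulrACA e rmorphM -!mulrA.
by move/(mulfI u0).
Qed.

(** Comparing constant terms would give sg only modulo PI. At a zero of F the factorisation says -
    h^2 = cos(sg) A B and sin(sg) A B = 0 with A B < 0, so sin(sg) = 0 and cos(sg) > 0; the bound
    |sg| < PI does the rest. *)
Lemma sg0 : sg = 0.
Proof.
have F0 : F (phi 0%N) = 0.
  by rewrite /F FtE big_ltn // subrr /hs mul0r sin_0 mulr0 mul0r.
have AB0 : Ft m aa (phi 0%N) * Ft m bb (phi 0%N) < 0.
  have le : Ft m aa (phi 0%N) * Ft m bb (phi 0%N) <= 0.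
    by apply: (band_AB m_gt0); rewrite ltW ?Ha ?Hb.
  rewrite lt_neqAle le andbT; apply/negP => /eqP e.
  have := level_AB_sg (phi 0%N); rewrite e mulr0 F0 expr0n sub0r => /complexI /eqP.
  by rewrite oppr_eq0 expf_eq0 /= gt_eqF.
have := level_AB_sg (phi 0%N); rewrite F0 expr0n sub0r.
move: (_ * _) AB0 => y y0 e.
have e' : (- h ^+ 2) = cos sg * y /\ 0 = - sin sg * y.
  move: e => /eqP; rewrite /cis cos_neg sin_neg RoppE eq_complex /= => /andP[/eqP e1 /eqP e2].
  by split; [rewrite e1 | rewrite e2]; ring.
have sn : sin sg = 0.
  by apply/eqP; have [_ /esym/eqP] := e'; rewrite mulf_eq0 oppr_eq0 (lt_eqF y0) orbF.
have cs : 0 < cos sg.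
  have := sqr_ge0 h; rewrite -oppr_le0 e'.1 => h1.
  have h2 : cos sg != 0.
    apply/eqP => c0; have := e'.1; rewrite c0 mul0r => /eqP; rewrite oppr_eq0 expf_eq0 /= gt_eqF //.
  rewrite lt_neqAle eq_sym h2 /=; rewrite -(@ler_nM2r _ y) // mul0r //.
have := sg_small; rewrite ltr_norml => /andP[s1 s2].
case: (ltgtP sg 0) => [h1|h1|->] //.
  have : 0 < sin (- sg) by apply: sin_gt0'; lra.
  by rewrite sin_neg sn RoppE oppr0 ltxx.
by have : 0 < sin sg; [apply: sin_gt0'; lra | rewrite sn ltxx].
Qed.

Lemma level_AB t : F t ^+ 2 - h ^+ 2 = Ft m aa t * Ft m bb t.
Proof. by apply: complexI; rewrite level_AB_sg sg0 oppr0 cis0 mul1r. Qed.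

End Band.

(** * The total length of the bands *)

Section Band.
Variables (m : nat) (phi aa bb : nat -> R) (h : R).
Hypothesis m_gt0 : (0 < m)%N.
Hypothesis Ha : forall j, (j < m)%N -> aa j < phi j.
Hypothesis Hb : forall j, (j < m)%N -> phi j < bb j.
Hypothesis Hg : forall j, (j < m)%N -> bb j <= aa j.+1.
Hypothesis Hper : aa m = aa 0%N + 2 * PI.
Let F := Ft m phi.
Hypothesis HFa : forall j, (j < m)%N -> F (aa j) ^+ 2 = h ^+ 2.
Hypothesis HFb : forall j, (j < m)%N -> F (bb j) ^+ 2 = h ^+ 2.
Hypothesis Hdeg : forall j, (j < m)%N -> bb j = aa j.+1 -> derivable_pt_lim F (bb j) 0.
Hypothesis h_gt0 : 0 < h.
Hypothesis h_lt2 : h < 2.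

Let ra := cseq m aa.
Let rb := cseq m bb.
Let rp := cseq m phi.
Let P := rpoly rp.
Let A := rpoly ra.
Let B := rpoly rb.
Let kap := P.[0].
Let len := band_len m aa bb.
Let eps := len / 4.
Let w := cis eps.
Let lam := w ^+ 2.

Let Hab : P ^+ 2 - (h%:C ^+ 2 * kap) *: 'X^m = A * B.
Proof. exact: Pi_factor. Qed.

Let SE : Sx m phi = (Sx m aa + Sx m bb) / 2.
Proof. by have := sg0 m_gt0 Ha Hb Hg Hper HFa HFb Hdeg h_gt0 => /eqP; rewrite subr_eq0 => /eqP. Qed.

Let Ha0 : kap = lam * A.[0].
Proof.
rewrite /kap /P /A !rpoly_cis0 /lam /w -cis2n mulrCA -cisD; congr (_ * cis _).
by rewrite SE /eps /len /band_len; field.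
Qed.

Let len_gt0 : 0 < len. Proof. exact: (band_len_gt0 m_gt0 Ha Hb). Qed.
Let len_le : len <= 2 * PI. Proof. exact: (band_len_le Hg Hper). Qed.

Let AB t : F t ^+ 2 - h ^+ 2 = Ft m aa t * Ft m bb t.
Proof. exact: level_AB. Qed.

(** If the bands filled the circle, then a = b and lam = -1, hence (p - a)(p + a) = h^2 p(0) X^m. As
    p - a takes the nonzero value 2 p(0) at 0, X^m divides p + a, so p + a = 2 X^m and p - a is
    constant. This gives h^2 = 4, against h < 2. *)
Lemma band_len_lt : len < 2 * PI.
Proof.
rewrite lt_neqAle len_le andbT; apply/negP => /eqP e.
have all_deg j : (j < m)%N -> bb j = aa j.+1.
  have : \sum_(0 <= i < m) (aa i.+1 - bb i) = 0.
    have -> : \sum_(0 <= i < m) (aa i.+1 - bb i) =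
       \sum_(0 <= i < m) (aa i.+1 - aa i) - \sum_(0 <= i < m) (bb i - aa i).
      by rewrite -sumrB; apply: eq_bigr => i _; ring.
    rewrite telescope_sumr // -band_lenE -/len e Hper; ring.
  move/eqP; rewrite big_nat psumr_eq0; last by move=> i hi; rewrite subr_ge0 Hg.
  move/allP => H hj; apply/eqP; rewrite eq_sym -subr_eq0.
  by have := H j; rewrite mem_index_iota hj /=; apply.
have AeqB : A = B.
  rewrite /A /B /rpoly /ra /rb /cseq !big_map big_nat.
  rewrite -[in LHS]big_nat -[in LHS](prednK m_gt0) big_nat_recl // -[in RHS](prednK m_gt0) big_nat_recr //=.
  rewrite mulrC; congr (_ * _).
    by rewrite !big_nat; apply: eq_bigr => i /= hi; rewrite (all_deg i (leq_trans hi (leq_pred m))).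
  by rewrite all_deg ?prednK // Hper cis_period.
have lamN1 : lam = -1.
  rewrite /lam /w -cis2n /eps e; have -> : 2 * PI / 4 + 2 * PI / 4 = PI by field.
  by rewrite /cis cos_PI sin_PI; apply/eqP; rewrite eq_complex /= oppr0 !eqxx.
have k1 : kap != 0 by rewrite -normr_gt0 norm_rpoly0 ?circle_cseq // ltr01.
have A0 : A.[0] = - kap by rewrite Ha0 lamN1 mulN1r opprK.
have E : (P - A) * (P + A) = (h%:C ^+ 2 * kap) *: 'X^m.
  have -> : (P - A) * (P + A) = P ^+ 2 - A * A by ring.
  by rewrite {2}AeqB -Hab; ring.
have n2 : (2 : C) != 0 by rewrite pnatr_eq0.
have cop : coprimep 'X^m (P - A).
  apply: coprimep_expl; rewrite coprimep_sym coprimepX /root hornerD hornerN A0 -/kap.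
  have -> : kap - - kap = 2 * kap by ring.
  by rewrite mulf_neq0.
have dv : 'X^m %| P + A.
  by rewrite -(Gauss_dvdpr _ cop) E dvdpZr // mulf_neq0 ?expf_neq0 // gt_eqF // -[0]/(0%:C) ltcR.
have [Q hQ] := dvdpP _ _ dv.
have [sPA lPA] : size (P + A) = m.+1 /\ lead_coef (P + A) = 2.
  have := @size_lead_comb _ m 1 1 rp ra; rewrite !scale1r -/P -/A => H.
  by apply: H; rewrite ?size_cseq.
have Q0 : Q != 0 by apply: contraTneq (eqxx (size (P + A))) => q0; rewrite {1}hQ q0 mul0r size_poly0 sPA.
have sQ : size Q = 1%N.
  by have := sPA; rewrite hQ size_Mmonic ?monicXn // size_polyXn addnS /= -add1n => /eqP; rewrite eqn_add2r => /eqP.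
have [c c0 hc] := size_poly1P _ (introT eqP sQ).
have c2 : c = 2.
  by move: lPA; rewrite hQ lead_coef_Mmonic ?monicXn // hc lead_coefC.
have X0 : 'X^m != 0 :> {poly C} by rewrite monic_neq0 ?monicXn.
have : (P - A) * 2%:P = (h%:C ^+ 2 * kap)%:P.
  by apply: (mulIf X0); rewrite -mulrA -c2 -hc -hQ E mul_polyC.
move/(congr1 (fun f => f.[0])); rewrite hornerM hornerD hornerN A0 -/kap !hornerC => e4.
have : h%:C ^+ 2 = 4 by apply: (mulIf k1); rewrite -e4; ring.
have -> : (4 : C) = (2%:R ^+ 2)%:C by rewrite rmorphXn rmorph_nat; ring.
rewrite -rmorphXn => /complexI /eqP; rewrite eqf_sqr => /orP[/eqP h2|/eqP h2].
  by move: h_lt2; rewrite h2 ltxx.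
by move: h_gt0; rewrite h2; lra.
Qed.

Let p0 : 0 < PI. Proof. exact: PI_gt0. Qed.
Let w1 : `|w| = 1. Proof. exact: normc_cis. Qed.
Let sin_eps : 0 < sin eps.
Proof. by apply: sin_gt0'; rewrite /eps; have := band_len_lt; have := len_gt0; lra. Qed.
Let cos_eps : 0 < cos eps.
Proof.
have e : Rdiv PI (IZR 2) = PI / 2 by rewrite RdivE.
have h1 := len_gt0; have h2 := band_len_lt.
by apply/RltP; apply: cos_gt_0; apply/RltP; rewrite e ?RoppE /eps; lra.
Qed.
Let Rew : 0 < 'Re w. Proof. by rewrite ReC -[0]/(0%:C) ltcR. Qed.
Let Imw : 0 < 'Im w. Proof. by rewrite ImC -[0]/(0%:C) ltcR. Qed.

Lemma ut_ab t : ut m bb t = lam * ut m aa t.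
Proof.
rewrite /lam /w -cis2n /ut mulrA -cisD; congr (cis _ * _).
by rewrite /eps /len /band_len; field.
Qed.

Lemma ut_pa t : ut m aa t = ut m phi t * w^*.
Proof.
rewrite /w (_ : Num.conj (cis eps) = cis (- eps)); last by rewrite cisN.
rewrite /ut mulrAC -cisD; congr (cis _ * _).
by rewrite SE /eps /len /band_len; field.
Qed.

Lemma der_nonpos (G : R -> R) (x y l : R) : x < y -> G x = 0 ->
  (forall t, x <= t -> t <= y -> G t <= 0) -> derivable_pt_lim G x l -> l <= 0.
Proof.
move=> xy Gx H d; rewrite leNgt; apply/negP => /RltP l0.
have [[dl dl0] hd] := d l l0.
have dlp : 0 < dl by apply/RltP.
pose k := Num.min (dl / 2) (y - x).
have k0 : 0 < k by rewrite lt_min divr_gt0 // subr_gt0.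
have kd : k < dl by rewrite gt_min; apply/orP; left; lra.
have ky : k <= y - x by rewrite ge_min lexx orbT.
have kn : k <> 0 by apply/eqP; rewrite gt_eqF.
have kd' : Rlt (Rabs k) dl by apply/RltP; rewrite RabsE gtr0_norm.
have /RltP := hd k kn kd'; rewrite RabsE RdivE !RminusE Gx subr0.
rewrite ltr_norml => /andP[h1 _].
have : 0 < G (x + k) / k by lra.
rewrite pmulr_lgt0 ?invr_gt0 // ltNge H //; lra.
Qed.

(** The product of [Ft m aa] and [Ft m bb] vanishes at the left end of a band and is nonpositive
    along it, so its derivative at that end is <= 0. This derivative is l times [Ft m bb], which
    fixes the sign of the residue of b / a. *)
Lemma band_res r : r \in ra ->
  exists2 x : C, x <= 0 & B.[r] = 2 * 'i * x * lam * r * A^`().[r].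
Proof.
move=> hr; have [j hj ej] := mem_cseq hr.
have [l [d1 d2]] := derivable_Ft m aa (aa j).
have [l2 [d3 _]] := derivable_Ft m bb (aa j).
have Ar : A.[r] = 0 by apply/eqP; rewrite -/(root A r) root_rpoly.
rewrite -ej -/ra -/A Ar mulr0 subr0 in d2.
have A'r : A^`().[r] != 0.
  rewrite deriv_rpoly // -/(root _ r) root_rpoly mem_rem_uniq ?inE ?eqxx //.
  exact: (ua Ha Hb Hg Hper).
have r0 : r != 0 by rewrite ej cis_neq0.
have u0 : ut m aa (aa j) != 0 by rewrite -normr_gt0 norm_ut ltr01.
have n2 : (2 : C) != 0 by rewrite pnatr_eq0.
have l0 : l != 0.
  apply/eqP => l0; move: d2; rewrite l0 mulr0 => /esym/eqP.
  by rewrite !mulf_eq0 (negbTE (neq0Ci _)) (negbTE n2) (negbTE r0) (negbTE A'r).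
have Aaj : Ft m aa (aa j) = 0.
  by apply: complexI; apply: (mulfI u0); rewrite -rpoly_cis -/ra -/A -ej Ar mulr0.
have le : l * Ft m bb (aa j) <= 0.
  have -> : l * Ft m bb (aa j) = l * Ft m bb (aa j) + Ft m aa (aa j) * l2.
    by rewrite Aaj mul0r addr0.
  apply: (@der_nonpos (mult_fct (Ft m aa) (Ft m bb)) (aa j) (bb j)).
  - exact: (aabb Ha Hb).
  - by rewrite /mult_fct Aaj Rmult_0_l.
  - by move=> t t1 t2; apply: (band_AB Ha Hb Hg Hper hj).
  - exact: derivable_pt_lim_mult.
exists (Ft m bb (aa j) / (2 * l))%:C.
  rewrite -[0]/(0%:C) lecR.
  have -> : Ft m bb (aa j) / (2 * l) = (l * Ft m bb (aa j)) / (2 * l ^+ 2) by field.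
  by rewrite mulr_le0_ge0 // invr_ge0 mulr_ge0 // sqr_ge0.
have lC : l%:C != 0 by rewrite -[0]/(0%:C) (inj_eq (@complexI _)).
apply: (mulIf lC); rewrite {1}ej /B /rb rpoly_cis ut_ab.
have E : (Ft m bb (aa j) / (2 * l))%:C * (2 * l%:C) = (Ft m bb (aa j))%:C.
  rewrite -[2 : C]/(2%:R) -(rmorph_nat (real_complex R)) -!rmorphM; congr (_%:C).
  by field.
have -> : 2 * 'i * (Ft m bb (aa j) / (2 * l))%:C * lam * r * A^`().[r] * l%:C =
  (Ft m bb (aa j) / (2 * l))%:C * l%:C * lam * ('i * (2 * r * A^`().[r])) by ring.
by rewrite -d2 -E; ring.
Qed.

Lemma band_circ (z : C) : `|z| = 1 -> exists u f al be : C,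
  [/\ [/\ f \is Num.real, al \is Num.real & be \is Num.real],
      [/\ `|u| = 1, P.[z] = u * f, A.[z] = u * w^* * al & kap * z ^+ m = u ^+ 2],
      f ^+ 2 - al * be = h%:C ^+ 2 & (al * be <= 0) || (0 <= f * al)].
Proof.
move=> z1; have [t [zt t0 t1]] : exists t, [/\ z = cis t, aa 0%N <= t & t < aa 0%N + 2 * PI].
  have [|s hs0 /andP[s1 s2]] := @cis_surj (z * cis (- (aa 0%N + PI))).
    by rewrite normrM z1 normc_cis mulr1.
  have zE : z = cis (s + (aa 0%N + PI)) by rewrite cisD -hs0 -mulrA -cisD addNr cis0 mulr1.
  move: s2; rewrite le_eqVlt => /orP[/eqP s2|s2].
    exists (aa 0%N); rewrite lexx; split=> //; last by have := p0; lra.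
    by rewrite zE s2 -[RHS]cis_period; congr cis; ring.
  by exists (s + (aa 0%N + PI)); split => //; have := p0; lra.
have [j hj /andP[j1 j2]] := locate Hper t0 t1.
exists (ut m phi t), (F t)%:C, (Ft m aa t)%:C, (Ft m bb t)%:C; split.
- by split; rewrite complex_real.
- by split; rewrite ?norm_ut // ?zt ?rpoly_cis ?ut_pa // ut_sqr.
- by rewrite -!rmorphXn -rmorphM -rmorphB -AB; congr (_%:C); ring.
- rewrite -!rmorphM -[0]/(0%:C) !lecR; have [tb|tb] := leP t (bb j).
    by rewrite (band_AB Ha Hb Hg Hper hj).
  by rewrite (gap_FA Ha Hb Hg Hper hj) ?orbT // ltW.
Qed.

Lemma band_le : 2 * sin eps ^+ m <= h.
Proof.
have := core_le m_gt0 (size_cseq _ _) (size_cseq _ _) (size_cseq _ _) (circle_cseq _ _)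
  (circle_cseq _ _) (ua Ha Hb Hg Hper) h_gt0 w1 Rew Imw Hab Ha0 band_res band_circ h_lt2.
rewrite ImC /= -[2 : C]/(2%:R) -(rmorph_nat (real_complex R)) -rmorphXn -rmorphM lecR //.
Qed.

Lemma band_eq : h = 2 * sin eps ^+ m -> exists (rd : seq C) (rho : C),
  [/\ uniq rd, size rd = m.-1, circle rd, `|rho| = 1 &
   P ^+ 2 - (h%:C ^+ 2 * P.[0]) *: 'X^m = quad rho lam * rpoly rd ^+ 2 /\
   P.[0] = - rho * (rpoly rd).[0]].
Proof.
move=> he.
have he' : h%:C = 2 * 'Im w ^+ m.
  by rewrite ImC /= -[2 : C]/(2%:R) -(rmorph_nat (real_complex R)) -rmorphXn -rmorphM -he.
have [rd [r1 [u1 s1 c1 n1 [hA hB]]]] := core_eq m_gt0 (size_cseq _ _) (size_cseq _ _) (size_cseq _ _) (circle_cseq _ _)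
  (circle_cseq _ _) (circle_cseq _ _) (ua Ha Hb Hg Hper) h_gt0 w1 Rew Imw Hab Ha0 band_res band_circ h_lt2 he'.
have lam0 : lam != 0 by rewrite expf_neq0 // cis_neq0.
(* The point halfway between r1 and lam^2 r1 on the circle, which makes the roots of [quad]
   symmetric about it. *)
exists rd, (lam * r1); split => //.
  by rewrite normrM n1 mulr1 normrX w1 expr1n.
split.
  rewrite Hab; have -> : A = _ := hA; have -> : B = _ := hB; rewrite /quad -/lam.
  have -> : lam * r1 / lam = r1 by field.
  have -> : lam * r1 * lam = lam ^+ 2 * r1 by ring.
  ring.
rewrite -/kap Ha0; have -> : A = _ := hA; rewrite hornerM hornerXsubC; ring.
Qed.

End Band.

(** * Minimizing configurations *)

Lemma sin_le_abs (x : R) : `|sin x| <= `|x|.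
Proof.
have pos (y : R) : 0 <= y -> `|sin y| <= y.
  move=> y0; have [->|yn] := eqVneq y 0; first by rewrite sin_0 normr0.
  have yp : 0 < y by rewrite lt0r yn.
  have s1 : sin y < y by apply/RltP; apply: sin_lt_x; apply/RltP.
  have [yP|yP] := leP y PI; first by rewrite ger0_norm ?sin_ge0' // ltW.
  have [/RleP b1' /RleP b2'] := SIN_bound y.
  have b1 : -1 <= sin y := b1'; have b2 : sin y <= 1 := b2'.
  have /RltP P1' := PI2_1; have P1 : 1 < PI / 2 by move: P1'; rewrite RdivE.
  by apply: le_trans (_ : 1 <= _); [rewrite ler_norml b1 b2 | lra].
have [x0|x0] := leP 0 x; first by rewrite [X in _ <= X]ger0_norm // pos.
by have := pos (- x); rewrite sin_neg RoppE normrN [`|x|]ltr0_norm // oppr_ge0 ltW // => ->.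
Qed.

Lemma abs_sin_le1 (x : R) : `|sin x| <= 1.
Proof.
have [/RleP b1' /RleP b2'] := SIN_bound x.
have b1 : -1 <= sin x := b1'; have b2 : sin x <= 1 := b2'.
by rewrite ler_norml b1 b2.
Qed.

Lemma abs_cos_le1 (x : R) : `|cos x| <= 1.
Proof.
have [/RleP b1' /RleP b2'] := COS_bound x.
have b1 : -1 <= cos x := b1'; have b2 : cos x <= 1 := b2'.
by rewrite ler_norml b1 b2.
Qed.

Lemma sinB_half (x y : R) : sin x - sin y = 2 * cos ((x + y) / 2) * sin ((x - y) / 2).
Proof.
pose u := (x + y) / 2; pose v := (x - y) / 2.
have hx : x = u + v by rewrite /u /v; field.
have hy : y = u + (- v) by rewrite /u /v; field.
by rewrite -/u -/v {1}hx {1}hy !sinD cos_neg sin_neg RoppE; ring.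
Qed.

Lemma cosB_half (x y : R) : cos x - cos y = - 2 * sin ((x + y) / 2) * sin ((x - y) / 2).
Proof.
pose u := (x + y) / 2; pose v := (x - y) / 2.
have hx : x = u + v by rewrite /u /v; field.
have hy : y = u + (- v) by rewrite /u /v; field.
by rewrite -/u -/v {1}hx {1}hy !cosD cos_neg sin_neg RoppE; ring.
Qed.

Lemma half_le (x : R) : 2 * `|sin (x / 2)| <= `|x|.
Proof.
have := sin_le_abs (x / 2); rewrite [X in _ <= X]normrM [`|2^-1|]ger0_norm ?invr_ge0 //.
by lra.
Qed.

Lemma sin_lip (x y : R) : `|sin x - sin y| <= `|x - y|.
Proof.
rewrite sinB_half !normrM normr_nat mulrAC; apply: le_trans (half_le (x - y)).
by rewrite ler_piMr ?abs_cos_le1 // mulr_ge0.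
Qed.

Lemma cos_lip (x y : R) : `|cos x - cos y| <= `|x - y|.
Proof.
rewrite cosB_half !normrM normrN normr_nat mulrAC; apply: le_trans (half_le (x - y)).
by rewrite ler_piMr ?abs_sin_le1 // mulr_ge0.
Qed.

Lemma hs_lip x y : `|hs x - hs y| <= `|x - y|.
Proof.
rewrite /hs -mulrBr normrM normr_nat; have := sin_lip (x / 2) (y / 2).
by rewrite -mulrBl [X in _ <= X]normrM [`|2^-1|]ger0_norm ?invr_ge0 //; lra.
Qed.

Lemma abs_hs x : `|hs x| <= 2.
Proof. by rewrite /hs normrM normr_nat ler_piMr // abs_sin_le1. Qed.

Definition Fs (s : seq R) (t : R) : R := \prod_(x <- s) hs (t - x).

Lemma Fs_cons x s t : Fs (x :: s) t = hs (t - x) * Fs s t.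
Proof. by rewrite /Fs big_cons. Qed.

Lemma abs_Fs s t : `|Fs s t| <= 2 ^+ size s.
Proof.
elim: s => [|x s IH]; first by rewrite /Fs big_nil normr1 expr0.
by rewrite Fs_cons normrM exprS ler_pM ?abs_hs.
Qed.

Fixpoint dist (s s' : seq R) : R :=
  match s, s' with x :: s, y :: s' => `|x - y| + dist s s' | _, _ => 0 end.

Lemma Fs_lip s s' t : size s = size s' -> `|Fs s t - Fs s' t| <= 2 ^+ size s * dist s s'.
Proof.
elim: s s' => [|x s IH] [|y s'] //= e; first by rewrite subrr normr0 mulr0.
case: e => e; rewrite !Fs_cons.
have -> : hs (t - x) * Fs s t - hs (t - y) * Fs s' t =
  (hs (t - x) - hs (t - y)) * Fs s t + hs (t - y) * (Fs s t - Fs s' t) by ring.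
apply: le_trans (ler_normD _ _) _; rewrite normrM [X in _ + X]normrM mulrDr; apply: lerD.
  rewrite mulrC; apply: ler_pM => //.
    by apply: le_trans (abs_Fs _ _) _; rewrite exprS ler_peMl // ?exprn_ge0 // ler1n.
  apply: le_trans (hs_lip _ _) _; have -> : t - x - (t - y) = - (x - y) by ring.
  by rewrite normrN.
rewrite exprS -mulrA; apply: ler_pM => //; [exact: abs_hs | exact: IH].
Qed.

Lemma norm_C (x : R) : `|x%:C| = `|x|%:C.
Proof. by rewrite normc_def /= expr0n addr0 sqrtr_sqr. Qed.

Lemma abs_hs_cis t x : `|cis t - cis x| = `|hs (t - x)|%:C.
Proof. by rewrite cisB_half normrM normc_cis mul1r normrM normCi mul1r norm_C. Qed.

Lemma abs_Fs_cis s t : `|\prod_(x <- s) (cis t - cis x)| = `|Fs s t|%:C.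
Proof.
elim: s => [|x s IH]; first by rewrite /Fs !big_nil !normr1.
by rewrite big_cons normrM IH abs_hs_cis Fs_cons [in RHS]normrM rmorphM.
Qed.

Lemma abs_Fs_mod s s' t t' : map cis s = map cis s' -> cis t = cis t' -> `|Fs s t| = `|Fs s' t'|.
Proof.
move=> e et; apply: complexI; rewrite -!abs_Fs_cis et.
by rewrite -(big_map cis predT (fun z => cis t' - z)) e big_map.
Qed.

Lemma abs_Fs_perm s s' t : perm_eq (map cis s) (map cis s') -> `|Fs s t| = `|Fs s' t|.
Proof.
move=> e; apply: complexI; rewrite -!abs_Fs_cis.
rewrite -(big_map cis predT (fun z => cis t - z)) (perm_big _ e) big_map //.
Qed.

Lemma cis_window (x c : R) : exists y : R, [/\ cis y = cis x, c <= y & y < c + 2 * PI].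
Proof.
have p0 := PI_gt0.
have [|s hs0 /andP[s1 s2]] := @cis_surj (cis x * cis (- (c + PI))).
  by rewrite normrM !normc_cis mulr1.
have zE : cis x = cis (s + (c + PI)) by rewrite cisD -hs0 -mulrA -cisD addNr cis0 mulr1.
move: s2; rewrite le_eqVlt => /orP[/eqP s2|s2].
  exists c; rewrite lexx; split=> //; last by lra.
  by rewrite zE s2 -[LHS]cis_period; congr cis; ring.
by exists (s + (c + PI)); split => //; lra.
Qed.

Lemma seq_window (s : seq R) (c : R) : exists s' : seq R, [/\ size s' = size s, map cis s' = map cis s &
  forall x, x \in s' -> c <= x /\ x < c + 2 * PI].
Proof.
elim: s => [|x s [s' [h1 h2 h3]]]; first by exists [::].
have [y [y1 y2 y3]] := cis_window x c.
exists (y :: s'); split; rewrite /= ?h1 ?h2 ?y1 // => z.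
by rewrite in_cons => /orP[/eqP ->|/h3].
Qed.

(* Minimisation coordinate by coordinate. *)
Lemma lipschitz_min m (g : seq R -> R) (K c d : R) : 0 <= K -> c <= d ->
  (forall s s', size s = m -> size s' = m -> `|g s - g s'| <= K * dist s s') ->
  exists s, [/\ size s = m, forall x, x \in s -> c <= x <= d &
    forall s', size s' = m -> (forall x, x \in s' -> c <= x <= d) -> g s <= g s'].
Proof.
move=> K0 cd; elim: m g => [|m IH] g hg.
  exists [::]; split => // s' /size0nil -> //.
have dist_refl s : dist s s = 0 by elim: s => //= x s ->; rewrite subrr normr0 addr0.
have H x : exists s, [/\ size s = m, forall y, y \in s -> c <= y <= d &
    forall s', size s' = m -> (forall y, y \in s' -> c <= y <= d) -> g (x :: s) <= g (x :: s')].
  apply: (IH (fun s => g (x :: s))) => s s' e e'.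
  by apply: le_trans (hg _ _ _ _) _; rewrite /= ?e ?e' // subrr normr0 add0r.
have [S hS] := choice H.
pose G x := g (x :: S x).
have GL x y : G x <= G y + K * `|x - y|.
  have [sx ex mx] := hS x; have [sy ey _] := hS y.
  have h1 : G x <= g (x :: S y) by apply: mx.
  have h2 : `|g (x :: S y) - g (y :: S y)| <= K * `|x - y|.
    by apply: le_trans (hg _ _ _ _) _; rewrite /= ?sy // dist_refl addr0.
  apply: le_trans h1 _; rewrite -lerBlDl; apply: le_trans (ler_norm _) h2.
have cont x : continuity_pt G x.
  move=> e /RltP e0; have K1 : 0 < K + 1 by rewrite ltr_wpDl.
  exists (e / (K + 1)); split; first by apply/RltP; rewrite divr_gt0.
  move=> y [_ /RltP hy]; apply/RltP; move: hy; rewrite /= /Rdist !RabsE !RminusE => hy.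
  have h3 : K * `|y - x| < e.
    apply: le_lt_trans (_ : (K + 1) * `|y - x| < e); first by rewrite ler_wpM2r // lerDl.
    by rewrite mulrC -ltr_pdivlMr.
  have g1 := GL y x; have g2 := GL x y; rewrite distrC in g2.
  by rewrite ltr_norml; apply/andP; split; lra.
have [x [hx [/RleP x1 /RleP x2]]] :=
  continuity_ab_min G c d (elimT RleP cd) (fun x _ => cont x).
exists (x :: S x); have [sx ex mx] := hS x; split.
- by rewrite /= sx.
- by move=> y; rewrite in_cons => /orP[/eqP ->|/ex //]; rewrite x1 x2.
- move=> [|y s'] //= [e] hy.
  have hy' z : z \in s' -> c <= z <= d by move=> zs; apply: hy; rewrite in_cons zs orbT.
  have [sy ey my] := hS y.
  apply: le_trans (_ : G y <= _); last exact: my.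
  have /andP[c1 c2] := hy y (mem_head _ _).
  by apply/RleP; apply: hx; split; apply/RleP.
Qed.

Section Minimizer.
Variable E : R -> Prop.

Definition bounded_on s (c : R) := forall t, E t -> `|Fs s t| <= c.

Definition minimal m s c := [/\ size s = m, bounded_on s c &
  forall s' c', size s' = m -> bounded_on s' c' -> c <= c'].

(** The supremum of |F| over E is Lipschitz in the zeros, and zeros matter only modulo 2 PI, so
    minimizing over a cube suffices. *)
Lemma minimal_exists m t0 : E t0 -> exists s c, minimal m s c.
Proof.
move=> E0.
pose V s := [set y | exists2 t, E t & y = `|Fs s t|]%classic.
have hV s : has_sup (V s).
  split; first by exists `|Fs s t0|, t0.
  by exists (2 ^+ size s) => y [t _ ->]; apply: abs_Fs.
pose g s := sup (V s).
have gb s : bounded_on s (g s) by move=> t Et; apply: sup_upper_bound => //; exists t.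
have gl s c : bounded_on s c -> g s <= c.
  by move=> hc; apply: ge_sup; [case: (hV s) | move=> y [t Et ->]; apply: hc].
have gle s s' : size s = m -> size s' = m -> g s <= g s' + 2 ^+ m * dist s s'.
  move=> e e'; apply: gl => t Et.
  have h1 := gb s' t Et; have := @Fs_lip s s' t; rewrite e e' => /(_ erefl) h2.
  have -> : Fs s t = Fs s' t + (Fs s t - Fs s' t) by ring.
  by apply: le_trans (ler_normD _ _) _; apply: lerD.
have dC s s' : dist s s' = dist s' s.
  by elim: s s' => [|x s IH] [|y s'] //=; rewrite IH distrC.
have [|||s [ss _ hm]] := @lipschitz_min m g (2 ^+ m) 0 (2 * PI).
- by rewrite exprn_ge0.
- by have := PI_gt0; lra.
- move=> s s' e e'; have h1 := gle s s' e e'; have h2 := gle s' s e' e; rewrite dC in h2.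
  by rewrite ler_norml; apply/andP; split; lra.
exists s, (g s); split => // s' c' e hc.
have [s2 [e2 h2 h3]] := seq_window s' 0.
apply: le_trans (_ : g s2 <= _).
  apply: hm; first by rewrite e2.
  by move=> x /h3[? ?]; apply/andP; split; lra.
apply: gl => t Et; rewrite (@abs_Fs_mod s2 s' t t) //; exact: hc.
Qed.

End Minimizer.

Lemma Ft_nth s t x0 : Ft (size s) (fun i => nth x0 s i) t = Fs s t.
Proof. by rewrite /Fs (big_nth x0) FtE. Qed.

Lemma continuity_Ft m x : continuity (Ft m x).
Proof.
by move=> t; have [l [d _]] := derivable_Ft m x t; apply: derivable_continuous_pt; exists l.
Qed.

Lemma hs_pair (t u v : R) :
  hs (t - u) * hs (t - v) = 2 * (cos ((v - u) / 2) - cos (t - (u + v) / 2)).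
Proof.
rewrite /hs cosB_half.
have -> : ((v - u) / 2 + (t - (u + v) / 2)) / 2 = (t - u) / 2 by field.
have -> : ((v - u) / 2 - (t - (u + v) / 2)) / 2 = - ((t - v) / 2) by field.
rewrite sin_neg RoppE; ring.
Qed.

Lemma cos_lt (x y : R) : 0 <= x -> x < y -> y <= PI -> cos y < cos x.
Proof.
move=> x0 xy yP; have y0 := le_trans x0 (ltW xy); have xP := le_trans (ltW xy) yP.
by apply/RltP; apply: cos_decreasing_1; try (by apply/RleP); apply/RltP.
Qed.

Lemma abs_even_cos (t : R) : cos `|t| = cos t.
Proof. by have [h|h] := ger0P t; rewrite ?cos_neg. Qed.

(* If |F| stays below c between two adjacent zeros u and v, pushing them apart lowers the
   maximum of |F| on every set where |F| <= c. *)
Lemma spread_zeros (E : R -> Prop) m u v rest c : 0 < c -> u <= v -> v < u + 2 * PI ->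
  (forall t, u <= t <= v -> `|Fs (u :: v :: rest) t| < c) -> ~ minimal E m (u :: v :: rest) c.
Proof.
move=> c0 uv vu H [sz bd mn].
set s := u :: v :: rest in H sz bd.
have [M Mc hM] : exists2 M, M < c & forall t, u <= t <= v -> `|Fs s t| <= M.
  have cs : forall t, continuity_pt (fun t => Rabs (Fs s t)) t.
    move=> t; apply: (continuity_pt_comp (Fs s) Rabs); last exact: Rcontinuity_abs.
    have -> : Fs s = Ft (size s) (fun i => nth 0 s i) by apply/funext => y; rewrite Ft_nth.
    exact: continuity_Ft.
  have [x [hx [/RleP x1 /RleP x2]]] :=
    continuity_ab_maj _ u v (elimT RleP uv) (fun x _ => cs x).
  exists `|Fs s x|; first by apply: H; rewrite x1 x2.
  by move=> t /andP[/RleP t1 /RleP t2]; have := hx t (conj t1 t2); rewrite !RabsE => /RleP.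
have M0 : 0 <= M by apply: le_trans (hM u _); rewrite ?lexx ?uv.
pose d := (v - u) / 2; have d0 : 0 <= d by rewrite /d; lra.
have dP : d < PI by rewrite /d; lra.
pose K : R := 2 ^+ size rest; have K0 : 0 < K by rewrite exprn_gt0.
(* Moving both zeros by de changes hs (t - u) hs (t - v) by - 2 eta, by [hs_pair] the same amount
   for every t. The two bounds on de keep the moved zeros within one turn and 2 eta K below c -
   M. *)
pose de := Num.min (PI - d) ((c - M) / (4 * K)).
have de0 : 0 < de by rewrite lt_min subr_gt0 dP divr_gt0 ?subr_gt0 ?mulr_gt0.
have de1 : d + de <= PI by rewrite -lerBrDl ge_min lexx.
have de2 : 4 * de * K <= c - M.
  have : de <= (c - M) / (4 * K) by rewrite ge_min lexx orbT.
  by rewrite ler_pdivlMr ?mulr_gt0 // => ?; lra.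
pose eta := cos d - cos (d + de).
have eta0 : 0 < eta by rewrite subr_gt0 cos_lt //; lra.
have eta1 : eta <= de.
  have := cos_lip d (d + de); have -> : d - (d + de) = - de by ring.
  by rewrite normrN [`|de|]gtr0_norm // => hh; apply: le_trans hh; exact: ler_norm.
have eta2 : eta <= 2.
  have := abs_cos_le1 d; have := abs_cos_le1 (d + de); rewrite !ler_norml => /andP[? ?] /andP[? ?].
  by rewrite /eta; lra.
pose s' := (u - de) :: (v + de) :: rest.
(* The first bound serves the points t between the moved zeros; the second, which rests on P <= 4,
   serves the rest of the circle. *)
pose c' := Num.max (M + 2 * eta * K) ((1 - eta / 2) * c).
have c'c : c' < c.
  rewrite gt_max; apply/andP; split.
    have : eta * K <= de * K by rewrite ler_pM2r.
    have : 0 < de * K by rewrite mulr_gt0.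
    lra.
  have : 0 < eta * c by rewrite mulr_gt0.
  lra.
suff : c <= c' by rewrite leNgt c'c.
apply: (mn s') => // t Et.
pose P := hs (t - u) * hs (t - v); pose r := Fs rest t.
have FE : Fs s t = P * r by rewrite /s !Fs_cons mulrA.
have PE : P = 2 * (cos d - cos (t - (u + v) / 2)) by rewrite /P hs_pair.
have F'E : Fs s' t = (P - 2 * eta) * r.
  rewrite /s' !Fs_cons mulrA hs_pair; congr (_ * _); rewrite PE /eta.
  have -> : (v + de - (u - de)) / 2 = d + de by rewrite /d; field.
  have -> : (u - de + (v + de)) / 2 = (u + v) / 2 by field.
  ring.
have rK : `|r| <= K := abs_Fs _ _.
have cb := abs_cos_le1 (t - (u + v) / 2); rewrite ler_norml in cb; case/andP: cb => cb1 cb2.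
set ct := cos (t - (u + v) / 2) in PE cb1 cb2.
have cd := abs_cos_le1 d; rewrite ler_norml in cd; case/andP: cd => cd1 cd2.
have eK : 0 <= eta * K by rewrite mulr_ge0 // ltW.
rewrite F'E; have [h1|h1] := leP (cos d) ct.
  have PM : `|P * r| <= M.
    rewrite -FE; have [y [y1 y2 y3]] := cis_window (t - (u + v) / 2) (- PI).
    have cy : cos y = ct by case: y1.
    have yd : `|y| <= d.
      rewrite leNgt; apply/negP => hy; move: h1; rewrite -cy -(abs_even_cos y).
      have yP : `|y| <= PI by rewrite ler_norml; apply/andP; split; lra.
      by rewrite leNgt cos_lt.
    rewrite (@abs_Fs_mod s s t ((u + v) / 2 + y)) //; last first.
      by rewrite cisD y1 -cisD; congr cis; ring.
    by apply: hM; move: yd; rewrite ler_norml /d => /andP[? ?]; apply/andP; split; lra.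
  rewrite le_max; apply/orP; left; rewrite mulrBl.
  apply: le_trans (ler_normB _ _) _; apply: lerD => //.
  rewrite normrM ger0_norm ?mulr_ge0 ?(ltW eta0) //.
  by rewrite ler_wpM2l // mulr_ge0 // ltW.
have Pp : 0 < P by rewrite PE; lra.
have [h2|h2] := leP (cos (d + de)) ct.
  rewrite le_max; apply/orP; left.
  have : `|P - 2 * eta| <= 2 * eta.
    by rewrite ler_norml PE /eta; apply/andP; split; rewrite /eta in eta0; lra.
  move=> h3; rewrite normrM; apply: le_trans (_ : 2 * eta * K <= _); last by rewrite lerDr.
  by apply: ler_pM.
rewrite le_max; apply/orP; right.
have Fc : P * `|r| <= c by have := bd t Et; rewrite FE normrM gtr0_norm.
have P' : 0 <= P - 2 * eta by rewrite PE /eta; lra.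
rewrite normrM ger0_norm //.
apply: le_trans (_ : (1 - eta / 2) * (P * `|r|) <= _); last by rewrite ler_wpM2l //; lra.
rewrite mulrA ler_wpM2r //.
have : 0 <= eta * (4 - P) by rewrite mulr_ge0 ?(ltW eta0) //; lra.
lra.
Qed.

Lemma minimal_ext (E : R -> Prop) m s s' c : size s = size s' ->
  (forall t, `|Fs s t| = `|Fs s' t|) -> minimal E m s c -> minimal E m s' c.
Proof. by move=> e h [h1 h2 h3]; split; rewrite -?e // => t /h2; rewrite h. Qed.

Section Gap.
Variables (m : nat) (x : nat -> R) (c u v : R).
Let F := Ft m x.
Hypotheses (c_gt0 : 0 < c) (Fu : F u = 0) (Fv : F v = 0).

(** Let z maximize F^2 - c^2 between u and v. If the maximum is positive, the intermediate value
    theorem gives a crossing on each side of z; if it is 0, both ends are z and F' vanishes there.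
    The crossings need not be chosen nearest to u and v, since the degree count in [Pi_factor]
    leaves no others. *)
Lemma gap_edges xi : u <= xi <= v -> c <= `|F xi| -> exists b a, [/\ u < b, b <= a, a < v,
  F b ^+ 2 = c ^+ 2 /\ F a ^+ 2 = c ^+ 2 & b = a -> derivable_pt_lim F b 0].
Proof.
move=> /andP[ux xv] Fxi; have uv := le_trans ux xv.
pose G t := F t * F t - c * c.
have cF t : continuity_pt F t by apply: continuity_Ft.
have cG : continuity G.
  move=> t; apply: continuity_pt_minus; first exact: continuity_pt_mult.
  by apply: continuity_pt_const => y z.
have [z [hz [/RleP z1 /RleP z2]]] := continuity_ab_maj G u v (elimT RleP uv) (fun x _ => cG x).
have Gxi : 0 <= G xi.
  by rewrite /G subr_ge0 -!expr2 -[F xi ^+ 2]real_normK ?num_real // ler_pXn2r // nnegrE // ltW.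
have Gz : 0 <= G z by apply: le_trans Gxi _; apply/RleP; apply: hz; split; apply/RleP.
have c2 : 0 < c * c by rewrite mulr_gt0.
have Gu : G u < 0 by rewrite /G Fu mul0r sub0r oppr_lt0.
have Gv : G v < 0 by rewrite /G Fv mul0r sub0r oppr_lt0.
have uz : u < z by rewrite lt_neqAle z1 andbT; apply: contraTneq Gz => <-; rewrite -ltNge.
have zv : z < v by rewrite lt_neqAle z2 andbT; apply: contraTneq Gz => ->; rewrite -ltNge.
have sq t : G t = 0 -> F t ^+ 2 = c ^+ 2 by move/eqP; rewrite subr_eq0 -!expr2 => /eqP.
move: Gz; rewrite le_eqVlt => /orP[/eqP Gz|Gz]; last first.
  have [b [[/RleP b1 /RleP b2] b3]] := IVT G u z cG (elimT RltP uz) (elimT RltP Gu) (elimT RltP Gz).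
  have cG' : continuity (opp_fct G) by apply: continuity_opp.
  have Gz' : opp_fct G z < 0 by rewrite /opp_fct RoppE oppr_lt0.
  have Gv' : 0 < opp_fct G v by rewrite /opp_fct RoppE oppr_gt0.
  have [a [[/RleP a1 /RleP a2] a3]] := IVT _ z v cG' (elimT RltP zv) (elimT RltP Gz') (elimT RltP Gv').
  have Ga : G a = 0 by move: a3; rewrite /opp_fct RoppE => /eqP; rewrite oppr_eq0 => /eqP.
  have bz : b < z by rewrite lt_neqAle b2 andbT; apply: contraTneq Gz => <-; rewrite b3 ltxx.
  have za : z < a by rewrite lt_neqAle a1 andbT; apply: contraTneq Gz => ->; rewrite Ga ltxx.
  have ub : u < b by rewrite lt_neqAle b1 andbT; apply: contraTneq Gu => ->; rewrite b3 ltxx.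
  have av : a < v by rewrite lt_neqAle a2 andbT; apply: contraTneq Gv => <-; rewrite Ga ltxx.
  exists b, a; split => //; first by apply: ltW; apply: lt_trans za.
    by split; apply: sq.
  by move=> e; have := lt_trans bz za; rewrite e ltxx.
exists z, z; split => //; first by split; apply: sq.
move=> _; have [l [dl _]] := derivable_Ft m x z.
have dG : derivable_pt_lim G z (l * F z + F z * l - 0).
  apply: derivable_pt_lim_minus; first exact: derivable_pt_lim_mult.
  exact: derivable_pt_lim_const.
have := deriv_maximum G u v z (exist _ _ dG) (elimT RltP uz) (elimT RltP zv) _.
rewrite /=; have -> : l * F z + F z * l - 0 = 2 * (F z * l) by ring.
move=> H; have : 2 * (F z * l) = 0.
  by apply: H => y /RltP y1 /RltP y2; apply: hz; split; apply/RleP; apply: ltW.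
have Fz : F z != 0.
  by apply: contraTneq c2 => F0; have := sq _ (esym Gz); rewrite F0 expr0n /= -expr2 => <-; rewrite ltxx.
by move/eqP; rewrite !mulf_eq0 pnatr_eq0 (negbTE Fz) /= => /eqP l0; rewrite -l0.
Qed.
End Gap.

Lemma eq_Ft m x y t : (forall i, (i < m)%N -> x i = y i) -> Ft m x t = Ft m y t.
Proof. by move=> e; rewrite !FtE !big_nat; apply: eq_bigr => i /= hi; rewrite e. Qed.

Lemma Fs_root s t : t \in s -> Fs s t = 0.
Proof. by move=> ts; rewrite /Fs (big_rem t) //= subrr /hs mul0r sin_0 mulr0 mul0r. Qed.

(* bb j = aa j.+1 is allowed when the level is only touched from below there. *)
Record bands m (phi aa bb : nat -> R) (c : R) : Prop := Bands {
  band_aphi : forall j, (j < m)%N -> aa j < phi j;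
  band_phib : forall j, (j < m)%N -> phi j < bb j;
  band_gap : forall j, (j < m)%N -> bb j <= aa j.+1;
  band_per : aa m = aa 0%N + 2 * PI;
  band_Fa : forall j, (j < m)%N -> Ft m phi (aa j) ^+ 2 = c ^+ 2;
  band_Fb : forall j, (j < m)%N -> Ft m phi (bb j) ^+ 2 = c ^+ 2;
  band_deg : forall j, (j < m)%N -> bb j = aa j.+1 -> derivable_pt_lim (Ft m phi) (bb j) 0 }.

Section Full.
Variables (E : R -> Prop) (m : nat) (c : R).
Hypotheses (m_gt0 : (0 < m)%N) (c_gt0 : 0 < c).

(** The contrapositive of [spread_zeros]. The permutation concerns points of the circle, so that it
    also covers the pair of the last zero and the first one a period later. *)
Lemma spread_xi s u v rest : minimal E m s c -> u <= v -> v < u + 2 * PI ->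
  perm_eq (map cis s) (map cis [:: u, v & rest]) ->
  u < v /\ exists2 xi, u <= xi <= v & c <= `|Fs s xi|.
Proof.
move=> mn uv vu pe.
have sz : size s = size [:: u, v & rest] by have := perm_size pe; rewrite !size_map.
have ab t : `|Fs s t| = `|Fs [:: u, v & rest] t| by apply: abs_Fs_perm.
have [xi hxi hc] : exists2 xi, u <= xi <= v & c <= `|Fs s xi|.
  apply: contrapT => H; apply: (@spread_zeros E m u v rest c) => //.
    move=> t ht; rewrite ltNge; apply/negP => h; apply: H; exists t => //; by rewrite ab.
  exact: minimal_ext mn.
split; last by exists xi.
rewrite lt_neqAle uv andbT; apply: contraTneq hc => e.
have -> : xi = u by apply/eqP; move: hxi; rewrite -e eq_le andbC.
by rewrite ab Fs_root ?mem_head // normr0 -ltNge.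
Qed.

Lemma full_bands s : (exists t0, E t0) -> minimal E m s c -> exists phi aa bb,
  [/\ bands m phi aa bb c, forall t, `|Ft m phi t| = `|Fs s t| &
      rpoly (cseq m phi) = rpoly (map cis s)].
Proof.
move=> [t0 Et0] mn0.
have [s1 [e1 c1 w1]] := seq_window s 0.
pose s2 := sort <=%R s1.
have p12 : perm_eq s1 s2 by rewrite perm_sym perm_sort.
have pc : perm_eq (map cis s) (map cis s2) by rewrite -c1 perm_map.
have mn : minimal E m s2 c.
  by apply: minimal_ext mn0; [rewrite size_sort e1 | move=> t; apply: abs_Fs_perm].
have sz : size s2 = m by have [] := mn.
have w2 x : x \in s2 -> 0 <= x /\ x < 2 * PI.
  by rewrite mem_sort => /w1[? ?]; split=> //; lra.
have so : sorted <=%R s2 by apply: sort_sorted; apply: le_total.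
pose n j := nth 0 s2 j.
have nw j : (j < m)%N -> 0 <= n j /\ n j < 2 * PI by move=> hj; apply: w2; apply: mem_nth; rewrite sz.
have nle i j : (i <= j)%N -> (j < m)%N -> n i <= n j.
  move=> ij hj; apply: (sorted_leq_nth le_trans le_refl) => //; rewrite inE ?sz //.
  exact: leq_ltn_trans ij hj.
have adj j : (j.+1 < m)%N -> n j < n j.+1 /\ exists2 xi, n j <= xi <= n j.+1 & c <= `|Fs s2 xi|.
  move=> hj; have hj' := ltnW hj.
  apply: (@spread_xi s2 _ _ (take j s2 ++ drop j.+2 s2)) => //.
  - exact: nle.
  - by have := nw _ hj; have := nw _ hj'; lra.
  have d1 : drop j s2 = n j :: drop j.+1 s2 by apply: drop_nth; rewrite sz.
  have d2 : drop j.+1 s2 = n j.+1 :: drop j.+2 s2 by apply: drop_nth; rewrite sz.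
  apply: perm_map; rewrite -{1}(cat_take_drop j s2) d1 d2.
  by rewrite -[X in perm_eq _ X]/([:: n j; n j.+1] ++ _) -[X in perm_eq (_ ++ X)]/([:: n j; n j.+1] ++ _) perm_catCA.
have nlt i j : (i < j)%N -> (j < m)%N -> n i < n j.
  move=> ij hj; apply: lt_le_trans (nle _ _ ij hj); apply: (adj i _).1.
  exact: leq_ltn_trans ij hj.
(* The value at m is the first zero one period later; it closes the cycle of gaps. *)
pose phi j := if (j < m)%N then n j else n 0%N + 2 * PI.
have FE t : Ft m phi t = Fs s2 t.
  by rewrite -(Ft_nth s2 t 0) sz; apply: eq_Ft => i hi; rewrite /phi hi.
have all j : (j < m)%N -> phi j < phi j.+1 /\ exists2 xi, phi j <= xi <= phi j.+1 & c <= `|Fs s2 xi|.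
  move=> hj; have [hj1|hj1] := ltnP j.+1 m; first by rewrite /phi hj hj1; apply: adj.
  have jE : j = m.-1 by apply/eqP; rewrite -eqSS prednK // eqn_leq hj hj1.
  have pS : phi j.+1 = n 0%N + 2 * PI by rewrite /phi ltnNge hj1.
  have pj : phi j = n j by rewrite /phi hj.
  rewrite pS pj; have p0 := PI_gt0.
  (* A single zero leaves no pair to spread; at the opposite point |F| = 2, and c <= 2 because one
     factor never exceeds 2. *)
  have [m1|m1] := leqP m 1.
    have j0 : j = 0%N by apply/eqP; rewrite -leqn0 -ltnS (leq_trans hj).
    rewrite j0; split; first by lra.
    exists (n 0%N + PI); first by apply/andP; split; lra.
    have : s2 = [:: n 0%N].
      by move: sz; rewrite /n; case: (s2) => [|y [|z q]] /= e; move: m_gt0 m1; rewrite -e.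
    move=> s2E; have -> : `|Fs s2 (n 0%N + PI)| = 2.
      rewrite s2E /Fs big_seq1 /hs; have -> : (n 0%N + PI - n 0%N) / 2 = PI / 2 by field.
      have -> : sin (PI / 2) = 1 by have := sin_PI2; rewrite RdivE.
      by rewrite mulr1 normr_nat.
    have [_ _ H] := mn; apply: (H s2 2) => // t _; apply: le_trans (abs_Fs _ _) _.
    by rewrite s2E expr1.
  have nn : n 0%N < n j by apply: nlt => //; rewrite jE -ltnS prednK.
  have [q qE] : exists q, s2 = n 0%N :: rcons q (n j).
    move: sz jE; rewrite /n; case/lastP: (s2) => [|s3 l] /= sz; first by move: m1; rewrite -sz.
    move: sz; rewrite size_rcons => sz ->; rewrite -sz /=.
    have -> : nth 0 (rcons s3 l) (size s3) = l by rewrite nth_rcons ltnn eqxx.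
    case: s3 sz => [|f s3] sz; first by move: m1; rewrite -sz.
    by exists s3.
  apply: (@spread_xi s2 _ _ q) => //.
  - by have := nw _ hj; have := nw _ m_gt0; lra.
  - by lra.
  rewrite {1}qE /= map_rcons cis_period -cats1 -cat_cons.
  by rewrite perm_catC.
have F0 j : (j <= m)%N -> Ft m phi (phi j) = 0.
  rewrite leq_eqVlt => /orP[/eqP ->|hj].
    apply/eqP; rewrite -normr_eq0 FE (@abs_Fs_mod s2 s2 _ (n 0%N)) //.
      by rewrite Fs_root ?normr0 // mem_nth // sz.
    by rewrite /phi ltnn cis_period.
  by rewrite FE /phi hj Fs_root // mem_nth // sz.
have edges j : exists ba : R * R, (j < m)%N -> [/\ phi j < ba.1, ba.1 <= ba.2, ba.2 < phi j.+1,
   Ft m phi ba.1 ^+ 2 = c ^+ 2 /\ Ft m phi ba.2 ^+ 2 = c ^+ 2 &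
   ba.1 = ba.2 -> derivable_pt_lim (Ft m phi) ba.1 0].
  have [hj|hj] := ltnP j m; last by exists (0, 0).
  have [_ [xi hxi hc]] := all _ hj.
  rewrite -FE in hc.
  have [b [a H]] := gap_edges c_gt0 (F0 _ (ltnW hj)) (F0 _ hj) hxi hc.
  by exists (b, a).
have [ba hba] := choice edges.
(* The band around the first zero starts in the gap that follows the last zero, one period
   earlier. *)
pose aa j := if j is j'.+1 then (ba j').2 else (ba m.-1).2 - 2 * PI.
pose bb j := (ba j).1.
have lastm : (m.-1 < m)%N by rewrite prednK.
have Fper t : Ft m phi (t - 2 * PI) ^+ 2 = Ft m phi t ^+ 2.
  rewrite -[LHS]real_normK ?num_real // -[RHS]real_normK ?num_real // !FE.
  by rewrite (@abs_Fs_mod s2 s2 _ t) // -[LHS]cis_period subrK.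
exists phi, aa, bb; split; last first.
- rewrite /rpoly; apply: perm_big; rewrite perm_sym; apply: perm_trans pc _.
  have -> : cseq m phi = map cis s2; last by [].
  rewrite /cseq -[in RHS](mkseq_nth 0 s2) /mkseq -map_comp sz /index_iota subn0.
  by apply/eq_in_map => i; rewrite mem_iota /= add0n => hi; rewrite /phi hi.
- by move=> t; rewrite FE; apply/esym/abs_Fs_perm.
split.
- case=> [|j] hj; rewrite /aa.
    have [_ _ h _ _] := hba _ lastm; rewrite prednK // /phi ltnn in h.
    by rewrite {1}/phi m_gt0; lra.
  by have [_ _ h _ _] := hba j (ltnW hj).
- by move=> j hj; have [] := hba j hj.
- by move=> j hj; have [] := hba j hj.
- by rewrite /aa; case: (m) m_gt0 => //= k _; rewrite subrK.
- case=> [|j] hj; rewrite /aa.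
    by rewrite Fper; have [_ _ _ [_ ->]] := hba _ lastm.
  by have [_ _ _ [_ ->]] := hba _ (ltnW hj).
- by move=> j hj; have [_ _ _ [->]] := hba _ hj.
- by move=> j hj; rewrite /aa; have [_ _ _ _] := hba _ hj.
Qed.
End Full.

(** F^2 - c^2 is the product of [Ft m aa] and [Ft m bb], which is nonnegative in a gap and has no
    zero in its interior. The strict inequality keeps E out of the open gaps. *)
Lemma gap_level m phi aa bb c j t : (0 < m)%N -> bands m phi aa bb c -> 0 < c -> (j < m)%N ->
  bb j < t -> t < aa j.+1 -> c < `|Ft m phi t|.
Proof.
move=> m0 [Ha Hb Hg Hp Fa Fb Hd] c0 hj h1 h2.
have nz x : (forall i, (i < m)%N -> aa i <= x i <= bb i) -> Ft m x t != 0.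
  move=> hx; rewrite FtE big_nat_cond prodf_seq_neq0; apply/allP => i _; apply/implyP.
  rewrite andbT /= => hi; have /andP[x1 x2] := hx i hi.
  have a0 := aa_le Ha Hb Hg (leq0n i) (ltnW hi).
  have am := aa_le Ha Hb Hg hj (leqnn m); have b0 := aabb Ha Hb hj.
  have a0' := aa_le Ha Hb Hg (leq0n j) (ltnW hj).
  have bm := bb_le_aa Ha Hb Hg hi (leqnn m).
  have [hij|hij] := leqP i j.
    have bij : bb i <= bb j.
      move: hij; rewrite leq_eqVlt => /orP[/eqP ->//|hij].
      by apply: le_trans (bb_le_aa Ha Hb Hg hij (ltnW hj)) (ltW b0).
    by rewrite gt_eqF // hs_gt0 //; lra.
  have ? := aa_le Ha Hb Hg hij (ltnW hi); by rewrite lt_eqF // hs_lt0 //; lra.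
have A0 : Ft m aa t != 0 by apply: nz => i hi; rewrite lexx ltW // (aabb Ha Hb).
have B0 : Ft m bb t != 0 by apply: nz => i hi; rewrite lexx ltW // (aabb Ha Hb).
have := gap_AB Ha Hb Hg Hp hj (ltW h1) (ltW h2).
rewrite -(level_AB m0 Ha Hb Hg Hp Fa Fb Hd c0) le_eqVlt => /orP[/eqP e|].
  have := mulf_neq0 A0 B0; rewrite -(level_AB m0 Ha Hb Hg Hp Fa Fb Hd c0) -e eqxx //.
by rewrite subr_gt0 => lt; rewrite -(@ltr_pXn2r _ 2) ?nnegrE ?(ltW c0) // real_normK ?num_real.
Qed.

(* rd lists the points where two arcs of the level set touch; the two roots of quad are the end
   points of the remaining gap. *)
Definition pell (s : seq R) (h : R) (lam rho : C) := exists rd : seq C,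
  [/\ uniq rd, size rd = (size s).-1, circle rd, `|rho| = 1 &
   rpoly (map cis s) ^+ 2 - (h%:C ^+ 2 * (rpoly (map cis s)).[0]) *: 'X^(size s) =
     quad rho lam * rpoly rd ^+ 2 /\ (rpoly (map cis s)).[0] = - rho * (rpoly rd).[0]].

Lemma cos_gt0' (x : R) : - (PI / 2) < x -> x < PI / 2 -> 0 < cos x.
Proof.
have e : Rdiv PI (IZR 2) = PI / 2 by rewrite RdivE.
by move=> h1 h2; apply/RltP; apply: cos_gt_0; apply/RltP; rewrite e ?RoppE.
Qed.

Definition gaps (m : nat) (aa bb : nat -> R) (Q : R -> Prop) :=
  [/\ forall j, (j < m)%N -> aa j <= bb j <= aa j.+1, aa m = aa 0%N + 2 * PI &
   forall j t, (j < m)%N -> bb j < t -> t < aa j.+1 -> Q t].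

Lemma minimal_gaps E m s c : (0 < m)%N -> (exists t, E t) -> minimal E m s c -> 0 < c -> c < 2 ->
  exists aa bb, [/\ gaps m aa bb (fun t => ~ E t), 0 < band_len m aa bb < 2 * PI,
    2 * sin (band_len m aa bb / 4) ^+ m <= c &
    c = 2 * sin (band_len m aa bb / 4) ^+ m ->
      exists rho, pell s c (cis (band_len m aa bb / 4) ^+ 2) rho].
Proof.
move=> m0 E0 mn c0 c2; have [phi [aa [bb [B FE PE]]]] := full_bands m0 c0 E0 mn.
have [Ha Hb Hg Hp Fa Fb Hd] := B.
exists aa, bb; split.
- split=> //; first by move=> j hj; rewrite Hg // andbT ltW // (aabb Ha Hb).
  move=> j t hj h1 h2 Et; have := gap_level m0 B c0 hj h1 h2.
  by have [_ bd _] := mn; rewrite FE ltNge bd.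
- by rewrite (band_len_gt0 m0 Ha Hb) (band_len_lt m0 Ha Hb Hg Hp Fa Fb Hd c0 c2).
- exact: (band_le m0 Ha Hb Hg Hp Fa Fb Hd c0 c2).
move=> e; have [rd [rho [u sz cr r1 [h1 h2]]]] := band_eq m0 Ha Hb Hg Hp Fa Fb Hd c0 c2 e.
have sm : size s = m by have [] := mn.
exists rho, rd; split; rewrite ?sm //.
by rewrite -PE.
Qed.

Lemma continuity_Fs s : continuity (Fs s).
Proof.
have -> : Fs s = Ft (size s) (fun i => nth 0 s i) by apply/funext => y; rewrite Ft_nth.
exact: continuity_Ft.
Qed.

Lemma Fs_zero s t : (Fs s t == 0) = root (rpoly (map cis s)) (cis t).
Proof.
rewrite /root hornerrpoly big_map -normr_eq0 -[RHS]normr_eq0 abs_Fs_cis.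
by rewrite -[0 in RHS]/(0%:C) (inj_eq (@complexI _)).
Qed.

(** E contains a neighbourhood of a zero of [Fs s0], hence m + 1 points that are distinct on the
    circle; a polynomial of degree m cannot vanish at all of them. *)
Lemma minimal_gt0 m s0 s h c : size s0 = m -> (0 < m)%N -> 0 < h ->
  minimal (fun t => `|Fs s0 t| < h) m s c -> 0 < c.
Proof.
move=> sz m0 h0 [szs bd _]; rewrite ltNge; apply/negP => c0.
pose t0 := nth 0 s0 0.
have z0 : Fs s0 t0 = 0 by apply: Fs_root; apply: mem_nth; rewrite sz.
have [d [/RltP d0' hd]] := continuity_Fs s0 t0 (elimT RltP h0).
have d0 : 0 < d := d0'.
have near t : `|t - t0| < d -> `|Fs s0 t| < h.
  move=> ht; have [->|tn] := eqVneq t t0; first by rewrite z0 normr0.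
  have := hd t; rewrite /= /Rdist !RabsE !RminusE z0 subr0 => H.
  apply/RltP; apply: H; split; last by apply/RltP.
  by split => //; apply/eqP; rewrite eq_sym.
pose dd := Num.min d PI / (m.+1%:R); have p0 := PI_gt0.
have mp : 0 < m.+1%:R :> R by rewrite ltr0n.
have dd0 : 0 < dd by rewrite divr_gt0 // lt_min d0.
have ddm : dd * m.+1%:R = Num.min d PI by rewrite /dd divfK // gt_eqF.
have kb k : (k < m.+1)%N -> 0 <= dd * k%:R /\ dd * k%:R < Num.min d PI.
  by move=> hk; rewrite mulr_ge0 ?(ltW dd0) // -ddm ltr_pM2l // ltr_nat.
pose x k := t0 + dd * k%:R.
have u : uniq (cseq m.+1 x).
  apply: uniq_cseq => i j ij hj; have [_ a2] := kb j hj; have [a1 _] := kb i (ltn_trans ij hj).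
  have a3 : Num.min d PI <= PI by rewrite ge_min lexx orbT.
  split; first by rewrite /x ltrD2l ltr_pM2l // ltr_nat.
  by rewrite /x; lra.
have r : all (root (rpoly (map cis s))) (cseq m.+1 x).
  apply/allP => z hz; have [i hi ->] := mem_cseq hz.
  rewrite -Fs_zero -normr_eq0 eq_le normr_ge0 andbT; apply: le_trans c0.
  apply: bd; apply: near; have [a1 a2] := kb i hi.
  rewrite /x addrC addKr ger0_norm //; apply: lt_le_trans a2 _.
  by rewrite ge_min lexx.
have := max_poly_roots (monic_neq0 (monic_rpoly _)) r u.
by rewrite size_cseq size_rpoly size_map szs ltnn.
Qed.

Lemma level_gaps m s0 h : size s0 = m -> (0 < m)%N -> 0 < h -> h < 2 ->
  exists aa bb, [/\ gaps m aa bb (fun t => h <= `|Fs s0 t|), 0 < band_len m aa bb < 2 * PI &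
    2 * sin (band_len m aa bb / 4) ^+ m <= h].
Proof.
move=> sz m0 h0 h2; pose E t := `|Fs s0 t| < h.
have E0 : E (nth 0 s0 0) by rewrite /E Fs_root ?normr0 // mem_nth // sz.
have Ex : exists t, E t by exists (nth 0 s0 0).
have [s [c mn]] := @minimal_exists E m _ E0.
have c0 := minimal_gt0 sz m0 h0 mn.
have ch : c <= h.
  by have [_ _ H] := mn; apply: (H s0) => // t /ltW.
have [aa [bb [[g1 g2 g3] l le _]]] := minimal_gaps m0 Ex mn c0 (le_lt_trans ch h2).
exists aa, bb; split => //; last exact: le_trans le ch.
by split=> // j t hj t1 t2; rewrite leNgt; apply/negP; apply: g3 hj t1 t2.
Qed.

(* The hypotheses force c = h for the minimizer, so that s0 is itself one. *)
Lemma level_gaps_eq m s0 h al : size s0 = m -> (0 < m)%N -> h < 2 ->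
  0 < al -> al < PI -> h = 2 * sin (al / 2) ^+ m ->
  (forall aa bb, gaps m aa bb (fun t => h <= `|Fs s0 t|) -> 2 * al <= band_len m aa bb) ->
  exists rho, pell s0 h (cis al) rho.
Proof.
move=> sz m0 h2 a0 aP he H; pose E t := `|Fs s0 t| < h.
have sa : 0 < sin (al / 2) by apply: sin_gt0'; lra.
have h0 : 0 < h by rewrite he mulr_gt0 // exprn_gt0.
have E0 : E (nth 0 s0 0) by rewrite /E Fs_root ?normr0 // mem_nth // sz.
have Ex : exists t, E t by exists (nth 0 s0 0).
have [s [c mn]] := @minimal_exists E m _ E0.
have c0 := minimal_gt0 sz m0 h0 mn.
have ch : c <= h.
  by have [_ _ H'] := mn; apply: (H' s0) => // t /ltW.
have toQ aa bb : gaps m aa bb (fun t => ~ E t) -> gaps m aa bb (fun t => h <= `|Fs s0 t|).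
  by case=> g1 g2 g3; split=> // j t hj t1 t2; rewrite leNgt; apply/negP; apply: g3 hj t1 t2.
have mono x y : 0 < x -> x < y -> y < PI / 2 -> sin x < sin y.
  move=> x0 xy yP; rewrite -subr_gt0 sinB_half !mulr_gt0 //.
    by apply: cos_gt0'; lra.
  by apply: sin_gt0'; lra.
(* This closes the chain h = 2 sin(al/2)^m <= 2 sin(len/4)^m <= c' <= h. *)
have key len c' : 2 * al <= len -> len < 2 * PI -> 2 * sin (len / 4) ^+ m <= c' -> c' <= h ->
    c' = h /\ len = 2 * al.
  move=> l1 l2 l3 l4.
  have sl : sin (al / 2) <= sin (len / 4).
    move: l1; rewrite le_eqVlt => /orP[/eqP <-|l1].
      by rewrite le_eqVlt; apply/orP; left; apply/eqP; congr sin; field.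
    by apply/ltW/mono; lra.
  have pw : sin (al / 2) ^+ m <= sin (len / 4) ^+ m.
    by rewrite ler_pXn2r ?nnegrE ?(ltW sa) // (le_trans (ltW sa) sl).
  have e : c' = h by apply/eqP; rewrite eq_le l4 he; apply: le_trans l3; rewrite ler_pM2l.
  split=> //; apply/eqP; rewrite eq_le l1 andbT leNgt; apply/negP => l5.
  have : sin (al / 2) < sin (len / 4) by apply: mono; lra.
  rewrite -(@ltr_pXn2r _ m) ?nnegrE ?(ltW sa) ?(le_trans (ltW sa) sl) // => pl.
  by move: l3; rewrite e he ler_pM2l // leNgt pl.
have [aa [bb [g /andP[_ l2] le _]]] := minimal_gaps m0 Ex mn c0 (le_lt_trans ch h2).
have [cE _] := key _ _ (H _ _ (toQ _ _ g)) l2 le ch.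
have mn0 : minimal E m s0 h.
  by have [m1 m2 m3] := mn; split=> //; [move=> t /ltW | rewrite -cE].
have [aa' [bb' [g' /andP[_ l2'] le' eq']]] := minimal_gaps m0 Ex mn0 h0 h2.
have [_ lE] := key _ _ (H _ _ (toQ _ _ g')) l2' le' (lexx h).
have l4 : band_len m aa' bb' / 4 = al / 2 by rewrite lE; field.
have [rho hr] := eq' (eq_trans he (congr1 (fun x => 2 * sin x ^+ m) (esym l4))).
exists rho; move: hr; rewrite l4 -cis2n; have -> : al / 2 + al / 2 = al by field.
by [].
Qed.

(** * The extremal polynomial *)

Lemma fold_prod n (G : nat -> R) :
  \prod_(0 <= j < n + n) G j = \prod_(0 <= j < n) (G j * G (n + n - j.+1)%N).
Proof.
rewrite (@big_cat_nat _ _ _ n) ?leq_addr //= big_split /=; congr (_ * _).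
rewrite big_nat_rev -{1}[n]add0n big_addn addnK big_nat [RHS]big_nat.
by apply: eq_bigr => j /= hj; congr G; lia.
Qed.

Lemma fold_prod_odd n (G : nat -> R) :
  \prod_(0 <= j < (n + n).+1) G j = G n * \prod_(0 <= j < n) (G j * G (n + n - j)%N).
Proof.
rewrite (@big_cat_nat _ _ _ n) ?leqW ?leq_addr //= big_split /= mulrCA; congr (_ * _).
rewrite big_ltn ?ltnS ?leq_addr //; congr (_ * _).
rewrite big_nat_rev -{1}[n.+1]add0n big_addn.
have -> : ((n + n).+1 - n.+1 = n)%N by rewrite subSS addnK.
by rewrite big_nat [RHS]big_nat; apply: eq_bigr => j /= hj; congr G; lia.
Qed.

Section Cheb.
Variable m : nat.
Hypothesis m_gt0 : (0 < m)%N.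
(** Counted from 0, so that [x_km] at k = j + 1 is its cosine. For j < 2m the points e^(i y_j) are
    the roots of X^(2m) + 1. *)
Definition cheb_angle (j : nat) : R := PI * (2 * j%:R + 1) / (2 * m%:R).
Let y := cheb_angle.

Let mp : 0 < m%:R :> R. Proof. by rewrite ltr0n. Qed.
Let m0 : m%:R != 0 :> R. Proof. by rewrite gt_eqF. Qed.

Lemma cisMn t n : cis (n%:R * t) = cis t ^+ n.
Proof.
elim: n => [|n IH]; first by rewrite mul0r cis0 expr0.
by rewrite -addn1 natrD mulrDl mul1r cisD IH addn1 exprSr.
Qed.

Lemma rpoly_roots_of_m1 : rpoly (cseq (m + m) y) = 'X^(m + m) + 1.
Proof.
have sz : size ('X^(m + m) + 1 : {poly C}) = (m + m).+1.
  by rewrite size_polyDl size_polyXn // size_poly1 ltnS addn_gt0 m_gt0.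
have mon : lead_coef ('X^(m + m) + 1 : {poly C}) = 1.
  by rewrite lead_coefDl ?lead_coefXn // size_polyXn size_poly1 ltnS addn_gt0 m_gt0.
rewrite [RHS](@all_roots_prod_XsubC _ _ (cseq (m + m) y)) ?mon ?scale1r //.
- by rewrite sz size_cseq.
- apply/allP => z hz; have [j hj ->] := mem_cseq hz.
  rewrite /root hornerD hornerXn hornerC -cisMn.
  have -> : (m + m)%:R * y j = PI + j%:R * (2 * PI).
    by rewrite /y /cheb_angle natrD; field.
  rewrite cisD cisMn cis2PI expr1n mulr1 /cis cos_PI sin_PI.
  by rewrite eq_complex /= addr0 addNr !eqxx.
- rewrite uniq_rootsE; apply: uniq_cseq => i j ij hj; have p0 := PI_gt0.
  have e k : y k = (PI / (2 * m%:R)) * (2 * k%:R + 1) by rewrite /y /cheb_angle; field.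
  have q0 : 0 < PI / (2 * m%:R) by rewrite divr_gt0 // mulr_gt0.
  split; first by rewrite !e ltr_pM2l // ltrD2r ltr_pM2l // ltr_nat.
  have -> : 2 * PI = (PI / (2 * m%:R)) * (4 * m%:R) by field.
  rewrite !e -mulrDr ltr_pM2l //.
  have : (j%:R : R) < (m + m)%:R by rewrite ltr_nat.
  have : 0 <= (i%:R : R) by rewrite ler0n.
  by rewrite natrD; lra.
Qed.

(** |2 cos(m psi)| = |e^(2 i m psi) + 1| is a product over 2m roots, and the conjugate roots j and
    2m - 1 - j combine to 2 |cos(y_j) - cos(psi)|. This is the factorisation of 2 T_m at
    cos(psi). *)
Lemma cheb_prod psi : `|2 * cos (m%:R * psi)| =
  \prod_(0 <= j < m) (2 * `|cos (y j) - cos psi|).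
Proof.
have H : `|Ft (m + m) y psi| = `|2 * cos (m%:R * psi)|.
  apply: complexI; rewrite -!norm_C.
  have := congr1 (fun f => `|f.[cis psi]|) rpoly_roots_of_m1.
  rewrite /= rpoly_cis normrM norm_ut mul1r => ->.
  rewrite hornerD hornerXn hornerC -cisMn.
  have -> : cis ((m + m)%:R * psi) + 1 = cis (m%:R * psi) * (2 * cos (m%:R * psi))%:C.
    have -> : (m + m)%:R * psi = m%:R * psi + m%:R * psi by rewrite natrD; ring.
    by rewrite -cis0 cisD_half; congr (cis _ * (2 * cos _)%:C); field.
  by rewrite normrM normc_cis mul1r.
rewrite -H FtE fold_prod normr_prod; apply: eq_big_nat => j /= hj.
have -> : `|hs (psi - y j) * hs (psi - y (m + m - j.+1)%N)| = `|hs (psi - y j) * hs (psi + y j)|.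
  rewrite normrM [RHS]normrM; congr (_ * _); apply: complexI.
  have -> : psi + y j = psi - (- y j) by ring.
  rewrite -!abs_hs_cis; congr (`|_ - _|).
  rewrite -[RHS]cis_period; congr cis; rewrite /y /cheb_angle natrB; last by lia.
  by rewrite -addn1 !natrD; field.
have -> : psi + y j = psi - (- y j) by ring.
rewrite hs_pair normrM normr_nat.
have -> : (- y j - y j) / 2 = - y j by field.
have -> : psi - (y j + - y j) / 2 = psi by field.
by rewrite cos_neg.
Qed.

(** The nodes j and m - 1 - j have opposite cosines, and for odd m the middle node has cosine 0. The
    resulting shape matches the quadratic factors of S_n. *)
Lemma cheb_fold psi : `|2 * cos (m%:R * psi)| =
  (if odd m then 2 * `|cos psi| else 1) *
  \prod_(0 <= j < m./2) (4 * `|cos psi ^+ 2 - cos (y j) ^+ 2|).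
Proof.
have pr j k : (j + k.+1 = m)%N -> 2 * `|cos (y j) - cos psi| * (2 * `|cos (y k) - cos psi|) =
   4 * `|cos psi ^+ 2 - cos (y j) ^+ 2|.
  move=> e; have -> : y k = PI - y j.
    have ek : (k%:R : R) = m%:R - j%:R - 1 by rewrite -e natrD -[k.+1]addn1 natrD; ring.
    by rewrite /y /cheb_angle ek; field.
  have -> : cos (PI - y j) = - cos (y j).
    by rewrite cosD cos_PI sin_PI cos_neg mul0r subr0 mulN1r.
  have -> : 2 * `|cos (y j) - cos psi| * (2 * `|- cos (y j) - cos psi|) =
    4 * (`|cos (y j) - cos psi| * `|- cos (y j) - cos psi|) by ring.
  by rewrite -normrM; congr (4 * `|_|); ring.
rewrite cheb_prod; have := odd_double_half m; case: (odd m) => /= e.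
  rewrite -{1}e add1n -addnn fold_prod_odd; congr (_ * _).
    have -> : cos (y m./2) = 0.
      have -> : y m./2 = PI / 2.
        have em : (m%:R : R) = 1 + 2 * (m./2)%:R by rewrite -{1}e natrD -muln2 natrM mulrC.
        by rewrite /y /cheb_angle em; field; rewrite -em.
      by have := cos_PI2; rewrite RdivE.
    by rewrite sub0r normrN.
  by apply: eq_big_nat => j /= hj; apply: pr; rewrite -[RHS]e -addnn; lia.
rewrite -{1}e add0n -addnn fold_prod mul1r.
by apply: eq_big_nat => j /= hj; apply: pr; rewrite -[RHS]e -addnn; lia.
Qed.
End Cheb.

Definition toC (z : Cx) : C := Cre z +i* Cim z.

Lemma toC_mul z w : toC (Cmul z w) = toC z * toC w.
Proof. by []. Qed.

Lemma toC_cexp t : toC (cexp_i t) = cis t.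
Proof. by []. Qed.

Lemma toC_sub z w : toC (Csub z w) = toC z - toC w.
Proof. by []. Qed.

Lemma toC_add z w : toC (Cadd z w) = toC z + toC w.
Proof. by []. Qed.

Lemma toC_inj z w : toC z = toC w -> z = w.
Proof. by case: z w => [a b] [c d] [/= -> ->]. Qed.

Lemma toC_Ppoly s z : toC (Ppoly s z) = (rpoly (map cis s)).[toC z].
Proof.
rewrite hornerrpoly big_map; elim: s => [|x s IH]; first by rewrite big_nil.
by rewrite big_cons -IH.
Qed.

Lemma Cmod_toC z : (Cmod z)%:C = `|toC z|.
Proof. by rewrite normc_def /toC /= /Cmod RsqrtE !RpowE. Qed.

Lemma Cmod_Ppoly s t : Cmod (Ppoly s (cexp_i t)) = `|Fs s t|.
Proof.
apply: complexI; rewrite Cmod_toC toC_Ppoly toC_cexp hornerrpoly big_map.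
exact: abs_Fs_cis.
Qed.

Lemma level_indP s h t : level_ind s h t = if h <= `|Fs s t| then 1 else 0.
Proof.
rewrite /level_ind Cmod_Ppoly; case: Rle_dec => [/RleP ->//|].
by move=> H; case: ifP => // /RleP.
Qed.

Section Star.
Variables (m : nat) (al : R).
Hypotheses (m_gt0 : (0 < m)%N) (al_gt0 : 0 < al) (al_ltP : al < PI).
Let s := sin (al / 2).
Let s_gt0 : 0 < s.
Proof. by have h1 := al_gt0; have h2 := al_ltP; apply: sin_gt0'; lra. Qed.
Let s_le1 : s <= 1.
Proof. by have := abs_sin_le1 (al / 2); rewrite ler_norml => /andP[]. Qed.

Lemma x_kmE j : x_km j.+1 m = cos (cheb_angle m j).
Proof.
rewrite /x_km /cheb_angle !INRE !RealsE; congr cos; rewrite -[nat_of_pos 2]/2%N.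
by rewrite -addn1 natrD; congr (_ / _); ring.
Qed.

(** The angle with cosine [a_km]: the k-th quadratic factor of S_n has the roots e^(i theta) and
    e^(- i theta). *)
Definition theta k : R := 2 * asin (x_km k m * s).

Fixpoint zpairs n : seq R :=
  if n is n'.+1 then theta n'.+1 :: - theta n'.+1 :: zpairs n' else [::].

Definition star_zeros : seq R :=
  if Nat.even m then zpairs (Nat.div2 m) else 0 :: zpairs (Nat.div2 m).

Lemma div2E n : Nat.div2 n = n./2.
Proof.
suff : Nat.div2 n = n./2 /\ Nat.div2 n.+1 = n.+1./2 by case.
elim: n => [|n [h1 h2]] //; split=> //; rewrite /= h1 //.
Qed.

Lemma evenE n : Nat.even n = ~~ odd n.
Proof.
suff : Nat.even n = ~~ odd n /\ Nat.even n.+1 = ~~ odd n.+1 by case.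
elim: n => [|n [h1 h2]] //; split=> //; by rewrite /= h1 !negbK.
Qed.

Lemma size_zpairs n : size (zpairs n) = n.*2.
Proof. by elim: n => //= n ->. Qed.

Lemma size_star : size star_zeros = m.
Proof.
rewrite /star_zeros evenE div2E -[RHS]odd_double_half.
by case: (odd m) => /=; rewrite size_zpairs.
Qed.

Lemma sin_theta k : sin (theta k / 2) = x_km k m * s.
Proof.
have -> : theta k / 2 = asin (x_km k m * s) by rewrite /theta; field.
have : `|x_km k m * s| <= 1.
  rewrite normrM mulr_ile1 // ?(ger0_norm (ltW s_gt0)) //.
  exact: abs_cos_le1.
rewrite ler_norml => /andP[/RleP h1 /RleP h2]; apply: sin_asin; split => //.
Qed.

Lemma cos_half (t : R) : cos t = 1 - 2 * sin (t / 2) ^+ 2.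
Proof.
have {1}-> : t = t / 2 + t / 2 by field.
rewrite cosD -!expr2; have := sin2cos2_ring (t / 2); lra.
Qed.

Lemma cos_theta k : cos (theta k) = a_km k m al.
Proof.
rewrite cos_half sin_theta /a_km !RealsE -[nat_of_pos 2]/2%N.
rewrite -/s; rewrite exprMn mulrA //.
Qed.

Lemma hs_pm t k : hs (t - theta k) * hs (t - - theta k) =
  4 * (sin (t / 2) ^+ 2 - x_km k m ^+ 2 * s ^+ 2).
Proof.
rewrite hs_pair.
have -> : (- theta k - theta k) / 2 = - theta k by field.
have -> : t - (theta k + - theta k) / 2 = t by field.
by rewrite cos_neg [cos t]cos_half cos_half sin_theta exprMn; ring.
Qed.

Lemma abs_zpairs n t : `|Fs (zpairs n) t| =
  \prod_(0 <= j < n) (4 * `|sin (t / 2) ^+ 2 - cos (cheb_angle m j) ^+ 2 * s ^+ 2|).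
Proof.
elim: n => [|n IH]; first by rewrite /Fs big_nil big_geq // normr1.
rewrite big_nat_recr //= -IH !Fs_cons mulrA hs_pm normrM mulrC; congr (_ * _).
by rewrite normrM normr_nat x_kmE.
Qed.

Lemma abs_star t : `|Fs star_zeros t| = (if odd m then 2 * `|sin (t / 2)| else 1) *
  \prod_(0 <= j < m./2) (4 * `|sin (t / 2) ^+ 2 - cos (cheb_angle m j) ^+ 2 * s ^+ 2|).
Proof.
rewrite /star_zeros evenE div2E; case: (odd m) => /=; last by rewrite abs_zpairs mul1r.
by rewrite Fs_cons [LHS]normrM abs_zpairs subr0 /hs normrM normr_nat.
Qed.

Lemma pow_fold (x : R) : x ^+ m = (if odd m then x else 1) * \prod_(0 <= j < m./2) x ^+ 2.
Proof.
have {1}<- := odd_double_half m; rewrite exprD -mul2n exprM prodr_const_nat subn0.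
by case: (odd m); rewrite ?expr1 ?expr0.
Qed.

Lemma star_inside t psi : sin (t / 2) = s * cos psi ->
  `|Fs star_zeros t| = s ^+ m * `|2 * cos (m%:R * psi)|.
Proof.
move=> e; rewrite abs_star cheb_fold // pow_fold mulrACA -big_split /= e; congr (_ * _).
  by case: ifP; rewrite ?mul1r // normrM (ger0_norm (ltW s_gt0)) => _; ring.
apply: eq_bigr => j _; rewrite [RHS]mulrCA; congr (4 * _).
have -> : s ^+ 2 * `|cos psi ^+ 2 - cos (cheb_angle m j) ^+ 2| =
   `|s ^+ 2 * (cos psi ^+ 2 - cos (cheb_angle m j) ^+ 2)|.
  by rewrite normrM ger0_norm // sqr_ge0.
by congr (`|_|); ring.
Qed.

(** Once sin(t/2) exceeds s, every factor of the modulus grows with sin(t/2)^2, and at t = al the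
    product equals 2 s^m. *)
Lemma star_outside t : s < sin (t / 2) -> 2 * s ^+ m < `|Fs star_zeros t|.
Proof.
move=> lt.
have -> : 2 * s ^+ m = `|Fs star_zeros al|.
  rewrite (@star_inside al 0); last by rewrite cos_0 mulr1.
  by rewrite mulr0 cos_0 mulr1 normr_nat mulrC.
rewrite !abs_star -/s.
have sq : s ^+ 2 < sin (t / 2) ^+ 2.
  by rewrite ltr_pXn2r // nnegrE ?(ltW s_gt0) // (le_trans (ltW s_gt0)) // ltW.
have fac j : 0 <= 4 * `|s ^+ 2 - cos (cheb_angle m j) ^+ 2 * s ^+ 2| <
   4 * `|sin (t / 2) ^+ 2 - cos (cheb_angle m j) ^+ 2 * s ^+ 2|.
  have c1 : cos (cheb_angle m j) ^+ 2 <= 1.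
    by have := sin2cos2_ring (cheb_angle m j); have := sqr_ge0 (sin (cheb_angle m j)); lra.
  have h1 : 0 <= s ^+ 2 - cos (cheb_angle m j) ^+ 2 * s ^+ 2.
    by rewrite subr_ge0 -[X in _ <= X]mul1r ler_wpM2r // sqr_ge0.
  rewrite mulr_ge0 //= ltr_pM2l // !ger0_norm ?ltrD2r //.
  by apply: le_trans h1 _; rewrite lerD2r ltW.
have odd1 : 2 * `|s| < 2 * `|sin (t / 2)|.
  by rewrite ltr_pM2l // !ger0_norm ?(ltW s_gt0) // (le_trans (ltW s_gt0)) // ltW.
have prod n : \prod_(0 <= j < n) (4 * `|s ^+ 2 - cos (cheb_angle m j) ^+ 2 * s ^+ 2|) <=
   \prod_(0 <= j < n) (4 * `|sin (t / 2) ^+ 2 - cos (cheb_angle m j) ^+ 2 * s ^+ 2|).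
  by apply: ler_prod => j _; have /andP[-> /ltW ->] := fac j.
have prod0 n : 0 < \prod_(0 <= j < n) (4 * `|sin (t / 2) ^+ 2 - cos (cheb_angle m j) ^+ 2 * s ^+ 2|).
  by apply: prodr_gt0 => j _; have /andP[h1 h2] := fac j; apply: le_lt_trans h1 h2.
case: ifP => om.
  apply: le_lt_trans (_ : 2 * `|s| * \prod_(0 <= j < m./2)
    (4 * `|sin (t / 2) ^+ 2 - cos (cheb_angle m j) ^+ 2 * s ^+ 2|) < _).
    by rewrite ler_wpM2l // mulr_ge0.
  by rewrite ltr_pM2r.
rewrite !mul1r.
(* Here m is even and positive, so there is at least one quadratic factor to make the inequality
   strict. *)
have : (0 < m./2)%N by rewrite half_gt0 ltn_neqAle m_gt0 andbT; apply: contraFneq om => <-.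
case: (m./2) => // n _; rewrite !big_nat_recr //=.
have /andP[h1 h2] := fac n.
apply: le_lt_trans (_ : \prod_(0 <= j < n) (4 * `|sin (t / 2) ^+ 2 - cos (cheb_angle m j) ^+ 2 * s ^+ 2|) *
  (4 * `|s ^+ 2 - cos (cheb_angle m n) ^+ 2 * s ^+ 2|) < _).
  by rewrite ler_wpM2r.
by rewrite ltr_pM2l.
Qed.

(** With psi = acos(sin(t/2) / s) the modulus is 2 s^m |cos(m psi)|, which reaches 2 s^m only where
    m psi = k PI with 0 <= k <= m. These finitely many points do not affect the integral of the
    indicator. *)
Lemma star_level t : - al < t -> t < al -> `|Fs star_zeros t| <= 2 * s ^+ m /\
  (`|Fs star_zeros t| = 2 * s ^+ m -> In t (List.map (fun k : nat => 2 * asin (s * cos (k%:R * PI / m%:R))) (List.seq 0 m.+1))).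
Proof.
have h1 := al_gt0; have h2 := al_ltP => lo hi.
have m0 : 0 < m%:R :> R by rewrite ltr0n.
have b1 : sin (t / 2) <= s.
  by apply/RleP; apply: sin_incr_1; apply/RleP; rewrite ?RealsE -?[nat_of_pos 2]/2%N; lra.
have b2 : - s <= sin (t / 2).
  have <- : sin (- (al / 2)) = - s by exact: sin_neg.
  apply/RleP; apply: sin_incr_1; apply/RleP; rewrite ?RealsE -?[nat_of_pos 2]/2%N; lra.
pose c := sin (t / 2) / s.
have sc : sin (t / 2) = s * c by rewrite /c [RHS]mulrC divfK // gt_eqF.
have c1 : - 1 <= c <= 1.
  by rewrite /c ler_pdivlMr // ler_pdivrMr // mulN1r mul1r b1 b2.
have [/RleP c2 /RleP c3] := andP c1.
have cpsi : cos (acos c) = c by apply: cos_acos; split.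
have e := @star_inside t (acos c); rewrite cpsi in e; rewrite e //; split.
  rewrite [X in _ <= X]mulrC ler_pM2l ?exprn_gt0 //.
  by rewrite normrM normr_nat; have := abs_cos_le1 (m%:R * acos c); lra.
move=> /eqP; rewrite [X in _ == X]mulrC => /eqP e2.
have {}e2 := mulfI (lt0r_neq0 (exprn_gt0 m s_gt0)) e2.
have s0 : sin (m%:R * acos c) = 0.
  have := sin2cos2_ring (m%:R * acos c).
  have -> : cos (m%:R * acos c) ^+ 2 = 1.
    rewrite normrM normr_nat in e2; rewrite -real_normK ?num_real //.
    have -> : `|cos (m%:R * acos c)| = 1 by lra.
    by rewrite expr1n.
  by move=> e3; apply/eqP; rewrite -sqrf_eq0; apply/eqP; lra.
have [k ek] := sin_eq_0_0 _ s0.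
have [/RleP p1 /RleP p2] := acos_bound c.
have P0 := PI_gt0.
have k0 : BinInt.Z.le BinNums.Z0 k.
  apply: le_IZR; apply/RleP.
  have : 0 <= IZR k * PI by rewrite -[IZR k * PI]/(Rmult (IZR k) PI) -ek mulr_ge0 // ltW.
  by rewrite pmulr_lge0.
have [n en] : exists n, k = BinInt.Z.of_nat n by exists (BinInt.Z.to_nat k); rewrite Znat.Z2Nat.id.
have {}ek : m%:R * acos c = n%:R * PI by rewrite ek en -INR_IZR_INZ INRE.
have nm : (n <= m)%N.
  rewrite -(ler_nat R) -(ler_pM2r P0) -ek ler_pM2l //.
apply: (proj2 (List.in_map_iff (fun k : nat => 2 * asin (s * cos (k%:R * PI / m%:R))) (List.seq 0 m.+1) t)).
exists n; split; last first.
  by apply: (proj2 (List.in_seq m.+1 0 n)); split; apply/ssrnat.leP.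
have -> : n%:R * PI / m%:R = acos c by rewrite -ek mulrC mulKf // gt_eqF.
rewrite cpsi -sc asin_sin; first by field.
rewrite ?RdivE ?RoppE; split; apply/RleP.
  by rewrite !RealsE -[nat_of_pos 2]/2%N; lra.
by rewrite !RealsE -[nat_of_pos 2]/2%N; lra.
Qed.

End Star.

(** * Rotations and the measure of the extremal level set *)

Lemma level_period l h t : level_ind l h (t + 2 * PI) = level_ind l h t.
Proof. by rewrite !level_indP (@abs_Fs_mod l l _ t) ?cis_period. Qed.

Definition rot_list (th : R) (l : seq R) := [seq x + th | x <- l].

Lemma Fs_rot th l t : Fs (rot_list th l) t = Fs l (t - th).
Proof. by rewrite /Fs big_map; apply: eq_bigr => x _; congr hs; ring. Qed.

Lemma toC_rotate m th Q z :
  toC (rotate m th Q z) = cis th ^+ m * toC (Q (Cmul z (cexp_i (- th)))).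
Proof. by rewrite /rotate toC_mul toC_cexp INRE -cisMn. Qed.

Lemma Ppoly_rot th l z : Ppoly (rot_list th l) z = rotate (size l) th (Ppoly l) z.
Proof.
apply: toC_inj; rewrite toC_rotate !toC_Ppoly !hornerrpoly !big_map toC_mul toC_cexp.
elim: l => [|x l IH]; first by rewrite !big_nil mulr1.
rewrite !big_cons IH /= exprS mulrACA; congr (_ * _).
by rewrite cisD mulrBr mulrCA -!cisD subrr cis0 mulr1 [th + x]addrC.
Qed.

Section Star.
Variables (m : nat) (al : R).
Hypotheses (m_gt0 : (0 < m)%N) (al_gt0 : 0 < al) (al_ltP : al < PI).

Lemma toC_S_poly n z : toC (S_poly n m al z) = (rpoly (map cis (zpairs m al n))).[toC z].
Proof.
rewrite hornerrpoly big_map; elim: n => [|n IH]; first by rewrite big_nil.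
rewrite !big_cons /= toC_mul IH mulrC mulrA; congr (_ * _).
rewrite toC_add toC_sub !toC_mul -cos_theta //.
set th := theta m al n.+1.
have e1 : cis th * cis (- th) = 1 by rewrite -cisD subrr cis0.
have e2 : cis th + cis (- th) = toC (RtoC (2 * cos th)).
  by rewrite cisD_half subrr mul0r cis0 mul1r; congr (_ +i* _); congr (2 * cos _); field.
by rewrite -e2 -[toC (RtoC 1)]/(1 : C) -e1; ring.
Qed.

Lemma Ppoly_star z : Ppoly (star_zeros m al) z = Pstar m al z.
Proof.
apply: toC_inj; rewrite toC_Ppoly /star_zeros /Pstar; case: Nat.even; rewrite -?toC_S_poly //.
rewrite toC_mul toC_S_poly !hornerrpoly /= big_cons cis0.
by rewrite toC_sub.
Qed.

Lemma level_star l th : (forall t, `|Fs l t| = `|Fs (star_zeros m al) (t - th)|) ->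
  level_mes l (2 * sin (al / 2) ^+ m) (2 * PI - 2 * al).
Proof.
have h1 := al_gt0; have h2 := al_ltP => Fl.
have P0 := PI_gt0.
have e : Rplus (th - al) (Rmult 2 PI) = th - al + 2 * PI by rewrite RplusE RmultE.
have -> : 2 * PI - 2 * al = Rminus (Rplus (th - al) (Rmult 2 PI)) (th + al).
  by rewrite e RminusE; ring.
apply: (level_mes_two_arcs _ _ _ _ (List.map (fun x : R => x + th)
  (List.map (fun k : nat => 2 * asin (sin (al / 2) * cos (k%:R * PI / m%:R))) (List.seq 0 m.+1)))).
- by move=> t; rewrite -[RHS]level_period.
- by rewrite e; split; apply/RleP; lra.
- move=> t [/RltP lo /RltP hi] nin; rewrite level_indP Fl.
  have [a1 a2] : `|Fs (star_zeros m al) (t - th)| <= 2 * sin (al / 2) ^+ m /\ _ :=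
    @star_level m al m_gt0 al_gt0 al_ltP (t - th) ltac:(lra) ltac:(lra).
  rewrite leNgt lt_neqAle a1 andbT; case: eqP => // /a2 i; case: nin.
  apply: (proj2 (List.in_map_iff (fun x : R => x + th) _ t)).
  by exists (t - th); split=> //; ring.
- move=> t []; rewrite e => /RltP lo /RltP hi; rewrite level_indP Fl ltW //.
  apply: star_outside => //; rewrite -subr_gt0 sinB_half.
  apply: mulr_gt0; first apply: mulr_gt0 => //.
    by apply: cos_gt0'; lra.
  by apply: sin_gt0'; lra.
Qed.

End Star.

(** * Lower bound and uniqueness *)

Section LowerBound.
Variables (m : nat) (al : R) (l : seq R).
Hypotheses (m_gt0 : (0 < m)%N) (al_gt0 : 0 < al) (al_ltP : al < PI) (sl : size l = m).
Let h := 2 * sin (al / 2) ^+ m.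

Lemma sin_half_gt0 : 0 < sin (al / 2).
Proof. by have h1 := al_gt0; have h2 := al_ltP; apply: sin_gt0'; lra. Qed.

Lemma sin_half_lt1 : sin (al / 2) < 1.
Proof.
have h1 := al_gt0; have h2 := al_ltP.
have := sin2cos2_ring (al / 2); have s0 := sin_half_gt0.
have c0 : 0 < cos (al / 2) by apply: cos_gt0'; lra.
by move=> e; nra.
Qed.

Lemma level_gt0 : 0 < h.
Proof. by rewrite /h mulr_gt0 // exprn_gt0 // sin_half_gt0. Qed.

Lemma level_lt2 : h < 2.
Proof.
rewrite /h -[X in _ < X]mulr1 ltr_pM2l // exprn_ilt1 ?sin_half_lt1 //.
  by rewrite -lt0n.
by rewrite ltW ?sin_half_gt0.
Qed.

Lemma band_len_le_al b : 0 < b -> b < 2 * PI -> 2 * sin (b / 4) ^+ m <= h -> b <= 2 * al.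
Proof.
have h1 := al_gt0; have h2 := al_ltP.
move=> b0 b2; rewrite /h ler_pM2l // => le.
have s0 : 0 <= sin (b / 4) by apply: sin_ge0'; lra.
rewrite ler_pXn2r ?nnegrE // ?(ltW sin_half_gt0) // in le.
rewrite leNgt; apply/negP => lt; move: le; apply/negP; rewrite -ltNge -subr_gt0 sinB_half.
apply: mulr_gt0; first apply: mulr_gt0 => //.
  by apply: cos_gt0'; lra.
by apply: sin_gt0'; lra.
Qed.

Lemma gap_sumE aa bb n : gap_sum aa bb n = aa n - aa 0%N - \sum_(0 <= i < n) (bb i - aa i).
Proof.
elim: n => [|n /= ->]; first by rewrite big_geq //= subrr subr0.
by rewrite big_nat_recr //= RplusE RminusE; ring.
Qed.

Lemma gaps_le_mes aa bb L : gaps m aa bb (fun t => h <= `|Fs l t|) ->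
  level_mes l h L -> 2 * PI - band_len m aa bb <= L.
Proof.
move=> [ord per lev] mes.
have -> : 2 * PI - band_len m aa bb = gap_sum aa bb m.
  by rewrite gap_sumE band_lenE per; ring.
apply/RleP; apply: (level_mes_gap_sum l h L aa bb m) => //.
- by move=> t; rewrite -[RHS]level_period.
- by move=> j /ssrnat.ltP jm; have /andP[/RleP ? /RleP ?] := ord j jm; split.
- move=> j t /ssrnat.ltP jm [/RltP lo /RltP hi]; rewrite level_indP.
  by have -> : h <= `|Fs l t| by apply: lev jm _ _.
Qed.

Lemma level_mes_ge L : level_mes l h L -> 2 * PI - 2 * al <= L.
Proof.
move=> mes.
have [aa [bb [G /andP[b0 b2] le]]] := level_gaps sl m_gt0 level_gt0 level_lt2.
by have := gaps_le_mes G mes; have := band_len_le_al b0 b2 le; lra.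
Qed.

Lemma level_mes_pell : level_mes l h (2 * PI - 2 * al) -> exists rho, pell l h (cis al) rho.
Proof.
move=> mes; apply: (level_gaps_eq sl m_gt0 level_lt2 al_gt0 al_ltP) => // aa bb G.
by have := gaps_le_mes G mes; lra.
Qed.

End LowerBound.

Lemma rpoly_scale (w : C) s : w != 0 ->
  rpoly [seq w * x | x <- s] = w ^+ size s *: (rpoly s \Po (w^-1 *: 'X)).
Proof.
move=> w0; rewrite /rpoly big_map; elim: s => [|x s IH].
  by rewrite !big_nil comp_polyC scale1r.
rewrite !big_cons comp_polyM /= exprS IH -scalerA -!mul_polyC comp_polyB comp_polyX comp_polyC.
have e : (w%:P * (w^-1)%:P = 1 :> {poly C}) by rewrite -polyCM divff.
move: (\prod_(j <- s) _ \Po _) => Q; rewrite polyCM.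
transitivity ((w%:P * (w^-1)%:P * 'X - w%:P * x%:P) * ((w ^+ size s)%:P * Q)); last by ring.
by rewrite e mul1r.

Qed.

Lemma cis_rot th s : map cis (rot_list th s) = [seq cis th * x | x <- map cis s].
Proof. by rewrite /rot_list -!map_comp; apply: eq_map => x /=; rewrite addrC cisD. Qed.

(** The system [cheb_ode] contains rho. Since a rotation multiplies rho by a unimodular number, two
    solutions can be brought to the same rho before they are compared. *)
Lemma pell_rot s h lam rho th : (0 < size s)%N -> pell s h lam rho ->
  pell (rot_list th s) h lam (cis th * rho).
Proof.
move=> s0 [rd [ud sd cd r1 [H H0]]]; set w := cis th; have w0 : w != 0 by exact: cis_neq0.
have w1 : `|w| = 1 by exact: normc_cis.
have sm : size (map cis s) = size s by rewrite size_map.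
exists [seq w * x | x <- rd]; split.
- by rewrite map_inj_uniq //; apply: mulfI.
- by rewrite !size_map.
- by rewrite /circle all_map; apply: sub_all cd => x /= /eqP e; rewrite normrM w1 e mulr1.
- by rewrite normrM w1 r1 mulr1.
have sc (p : {poly C}) : (p \Po (w^-1 *: 'X)).[0] = p.[0].
  by rewrite horner_comp hornerZ hornerX mulr0.
have ws : w ^+ size s = w ^+ (size s).-1 * w by rewrite -exprSr prednK.
rewrite cis_rot !rpoly_scale // size_map sd !hornerZ !sc ?size_map -/w; split; last first.
  by rewrite H0 ws; ring.
have Hc := congr1 (fun p => p \Po (w^-1 *: 'X)) H.
rewrite /= comp_polyB comp_polyZ [_ ^+ 2]expr2 comp_polyM -expr2 rmorphXn /= comp_polyX in Hc.
rewrite (comp_polyM (quad rho lam)) [rpoly rd ^+ 2]expr2 (comp_polyM (rpoly rd)) -expr2 in Hc.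
have Q : quad (w * rho) lam = w ^+ 2 *: (quad rho lam \Po (w^-1 *: 'X)).
  rewrite -[w ^+ 2]/(w ^+ size [:: rho / lam; rho * lam]).
  have -> : quad rho lam = rpoly [:: rho / lam; rho * lam] by rewrite /rpoly !big_cons big_nil mulr1.
  by rewrite -rpoly_scale // /rpoly /= !big_cons big_nil mulr1 /quad !mulrA.
rewrite Q; set P := rpoly _ \Po _ in Hc *; set D := rpoly _ \Po _ in Hc *.
transitivity (w ^+ size s ^+ 2 *: ((quad rho lam \Po (w^-1 *: 'X)) * D ^+ 2)).
  transitivity (w ^+ size s ^+ 2 *: (P ^+ 2 -
    (h%:C ^+ 2 * (rpoly (map cis s)).[0]) *: (w^-1 *: 'X) ^+ size s)); last first.
  by congr (_ *: _); exact: Hc.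
  rewrite scalerBr exprZn; congr (_ - _).
  rewrite exprZn !scalerA; congr (_ *: _).
  have e : w ^+ size s * w^-1 ^+ size s = 1 by rewrite -exprMn divff // expr1n.
  set K := (rpoly (map cis s)).[0]; set u := h%:C; move: e.
  move: (w ^+ size s) (w^-1 ^+ size s) => x y e.
  transitivity (x * (u ^+ 2 * K)); first by ring.
  by transitivity ((x * (u ^+ 2 * K)) * (x * y)); [rewrite e mulr1 | ring].
rewrite exprZn -scalerAl -scalerAr !scalerA; congr (_ *: _).
by rewrite ws; ring.
Qed.

Lemma pell_cheb_ode s h lam rho : (0 < size s)%N -> 0 < h -> pell s h lam rho ->
  exists d : seq C, size d = (size s).-1 /\ cheb_ode (size s) rho lam (rpoly (map cis s)) (rpoly d).
Proof.
move=> s0 h0 [rd [ud sd cd r1 [H H0]]]; exists rd; split=> //.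
have c : circle (map cis s).
  by rewrite /circle all_map; apply/allP => x _ /=; rewrite normc_cis.
apply: pell_ode H H0 => //.
- by rewrite size_map.
- rewrite mulf_neq0 // ?expf_neq0 //; first by apply: contra_neq (lt0r_neq0 h0) => /complexI.
  by rewrite -normr_gt0 norm_rpoly0 // ltr01.
Qed.

Lemma pell_uniq s1 s2 h lam rho1 rho2 : (0 < size s1)%N -> size s1 = size s2 -> 0 < h ->
  lam != 0 -> pell s1 h lam rho1 -> pell s2 h lam rho2 ->
  exists th, rpoly (map cis s1) = rpoly (map cis (rot_list th s2)).
Proof.
move=> s0 s12 h0 l0 H1 H2.
have r1 : `|rho1| = 1 by case: H1 => ? [].
have r2 : `|rho2| = 1 by case: H2 => ? [].
have [th eth _] := @cis_surj (rho1 / rho2) ltac:(by rewrite normf_div r1 r2 divr1).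
exists th; have s2' : (0 < size s2)%N by rewrite -s12.
have := pell_rot th s2' H2; rewrite -eth divfK ?unitC_neq0 // => H2'.
have sr : size (rot_list th s2) = size s2 by rewrite size_map.
have s3 : (0 < size (rot_list th s2))%N by rewrite sr.
have [d1 [sd1 o1]] := pell_cheb_ode s0 h0 H1.
have [d2 [sd2 o2]] := pell_cheb_ode s3 h0 H2'.
rewrite sr -s12 in sd2 o2.
apply: (cheb_ode_uniq s0 l0 o1 o2); rewrite ?monic_rpoly // size_rpoly ?size_map ?sd1 ?sd2 ?prednK //.
by rewrite s12.
Qed.

Section Equality.
Variables (m : nat) (al : R).
Hypotheses (m_gt0 : (0 < m)%N) (al_gt0 : 0 < al) (al_ltP : al < PI).
Let h := 2 * sin (al / 2) ^+ m.

Lemma Ppoly_rot_star th z :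
  Ppoly (rot_list th (star_zeros m al)) z = rotate m th (Pstar m al) z.
Proof. by rewrite Ppoly_rot size_star // /rotate Ppoly_star. Qed.

Lemma level_mes_rotated l th : (forall z, Ppoly l z = rotate m th (Pstar m al) z) ->
  level_mes l h (2 * PI - 2 * al).
Proof.
move=> e; apply: (level_star m_gt0 al_gt0 al_ltP (th := th)) => t.
by rewrite -Cmod_Ppoly e -Ppoly_rot_star Cmod_Ppoly Fs_rot.
Qed.

Lemma level_mes_star : level_mes (star_zeros m al) h (2 * PI - 2 * al).
Proof. by apply: (level_star m_gt0 al_gt0 al_ltP (th := 0)) => t; rewrite subr0. Qed.

(** The zeros of P* attain the extremal measure as well, so [level_mes_pell] provides their Pell
    equation, with the same h and lam, without a separate computation. Uniqueness then identifies
    the two polynomials up to a rotation. *)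
Lemma level_mes_eq l : size l = m -> level_mes l h (2 * PI - 2 * al) ->
  exists th, forall z, Ppoly l z = rotate m th (Pstar m al) z.
Proof.
move=> sl mes; have ss : size (star_zeros m al) = m by rewrite size_star.
have [rho1 p1] := level_mes_pell m_gt0 al_gt0 al_ltP sl mes.
have [rho2 p2] := level_mes_pell m_gt0 al_gt0 al_ltP ss level_mes_star.
have h0 := level_gt0 m al_gt0 al_ltP.
have l0 : (0 < size l)%N by rewrite sl.
have [th e] := pell_uniq l0 (etrans sl (esym ss)) h0 (cis_neq0 al) p1 p2.
by exists th => z; rewrite -Ppoly_rot_star; apply: toC_inj; rewrite !toC_Ppoly e.
Qed.

End Equality.

Section Bridge.
Variables (m : nat) (al : R).
Hypotheses (m1 : le 1 m) (al0P : Rlt 0 al /\ Rlt al PI).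
Let m_gt0 : (0 < m)%N := introT ssrnat.ltP m1.
Let al_gt0 : 0 < al := introT RltP (proj1 al0P).
Let al_ltP : al < PI := introT RltP (proj2 al0P).

Lemma level_mes_lower l L : size l = m ->
  level_mes l (2 * pow (sin (al / 2)) m) L -> Rle (2 * PI - 2 * al) L.
Proof. by rewrite RpowE => sl mes; apply/RleP; apply: level_mes_ge mes. Qed.

Lemma level_mes_star_zeros :
  level_mes (star_zeros m al) (2 * pow (sin (al / 2)) m) (2 * PI - 2 * al).
Proof. by rewrite RpowE; apply: level_mes_star. Qed.

Lemma level_mes_extremal l : size l = m ->
  level_mes l (2 * pow (sin (al / 2)) m) (2 * PI - 2 * al) <->
  exists th, forall z, Ppoly l z = rotate m th (Pstar m al) z.
Proof.
rewrite RpowE => sl; split; first exact: level_mes_eq.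
by case=> th; apply: level_mes_rotated.
Qed.

End Bridge.

End Extremal.

Bind Scope R_scope with R.

Theorem theorem6 (m : nat) (h : R) :
  (1 <= m)%nat -> 0 < h < 2 ->
  delta_is m h (4 * acos (Rpower (h / 2) (/ INR m))) /\
  (forall alpha : R, 0 < alpha < PI -> h = 2 * (sin (alpha / 2)) ^ m ->
   forall phis : list R, length phis = m ->
     (level_mes phis h (4 * acos (Rpower (h / 2) (/ INR m))) <->
      exists theta : R, forall z : Cx, Ppoly phis z = rotate m theta (Pstar m alpha) z)).
Proof.
intros m1 h02; split.
- destruct (level_angle m h m1 h02) as [alpha [a0P e]].
  rewrite (acos_level m h alpha m1 a0P e), e; split.
  + intros L [phis [len mes]]; exact (Extremal.level_mes_lower m1 a0P len mes).
  + intros b Hb; apply Hb; exists (Extremal.star_zeros m alpha).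
    split; [apply Extremal.size_star|exact (Extremal.level_mes_star_zeros m1 a0P)].
- intros alpha a0P e phis len.
  rewrite (acos_level m h alpha m1 a0P e), e.
  exact (Extremal.level_mes_extremal m1 a0P len).
Qed.
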